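(* Let $\chi_1,\chi_2:F^\times\to E^\times$ be smooth characters such that $\sigma=\mathrm{Ind}_B^G(\chi_1,\chi_2)$ is irreducible, let $m\in\mathbb{Z}$ and $n\ge 0$ be integers, let $\tau=\det(\cdot)^m\otimes \mathrm{Sym}^n$ and $\rho=\tau\otimes\sigma$, realized on its Kirillov model $V_\rho=\mathcal{K}$. Put $\tilde\lambda=\chi_1(\pi)\pi^m$ and $\tilde\mu=\omega(\pi)\chi_2(\pi)\pi^m$. Assume that (i) $|\tilde\lambda\tilde\mu q\pi^n|=1$, and (ii) $|\tilde\lambda|\le|q^{-1}\pi^{-n}|$ and $|\tilde\mu|\le|q^{-1}\pi^{-n}|$. Assume in addition that either (1) $\chi_1,\chi_2$ are unramified and $n<q$, or (2) $\chi_1,\chi_2$ are tamely ramified and $n=0$. Let $V_\rho^0=\mathcal{O}_E[G]v$ be the $\mathcal{O}_E[G]$-submodule of $V_\rho=\mathcal{K}$ spanned by a non-zero vector $v$. Then there exist $\mathcal{O}_E$-lattices $M_0(\beta)\subset V_\tau$ ($\beta\in W=F/\mathcal{O}_F$) such that every $\phi\in V_\rho^0$ which vanishes outside $\mathcal{O}_F$ has an expansion $$\phi(x)=\sum_{l=l_0}^\infty\sum_{\beta\in W}C_l(\beta)\psi_\beta(\pi^{-l}x)\phi_l(x)\qquad(x\in F^\times),$$ with $l_0\in\mathbb{Z}$, $C_l(\beta)\in V_\tau$, only finitely many $C_l(\beta)\ne0$ for each $l$, and with $C_0(\beta)\in M_0(\beta)$ for every $\beta\in W$.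
   Context: $F$ is a non-archimedean local field of characteristic $0$ and residue characteristic $p$, $\mathcal{O}_F$ its ring of integers, $U_F=\mathcal{O}_F^\times$, $\pi$ a fixed uniformizer, $q$ the cardinality of $\mathcal{O}_F/\pi\mathcal{O}_F$, $v_F:F^\times\to\mathbb{Z}$ the normalized valuation. $E$ is an algebraic closure of $F$, with the absolute value $|\cdot|$ extending that of $F$, and $\mathcal{O}_E=\{x\in E:|x|\le1\}$. $G=GL_2(F)$ and $B\subset G$ is the subgroup of upper triangular matrices. $\omega:F^\times\to E^\times$ is the unramified character with $\omega(\pi)=q^{-1}$. A character of $F^\times$ is unramified if it is trivial on $\mathcal{O}_F^\times$, and tamely ramified if it is trivial on $1+\pi\mathcal{O}_F$. $\mathrm{Ind}_B^G(\chi_1,\chi_2)$ is the (unnormalized) space of functions $f:G\to E$ with $f\left(\begin{pmatrix}t_1&s\\0&t_2\end{pmatrix}g\right)=\chi_1(t_1)\chi_2(t_2)f(g)$ that are right invariant under some open subgroup of $G$; $G$ acts by right translation. $\mathrm{Sym}^n$ is the $n$-th symmetric power of the standard representation, and $V_\tau$ is the space of $\tau$. An $\mathcal{O}_E$-lattice in $V_\tau$ is the $\mathcal{O}_E$-span of an $E$-basis of $V_\tau$. Fix a locally constant additive character $\psi:F\to E^\times$ under which $\mathcal{O}_F$ is its own annihilator, i.e. $\{x\in F:\psi(x\mathcal{O}_F)=1\}=\mathcal{O}_F$. Put $\psi_b(x)=\psi(bx)$, and let $\phi_l$ be the characteristic function of $\pi^lU_F$. The function $\psi_b(\pi^{-l}x)\phi_l(x)$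 depends only on the image $\beta$ of $b$ in $W=F/\mathcal{O}_F$, and is written $\psi_\beta(\pi^{-l}x)\phi_l(x)$. Kirillov model. Let $C_c^\infty(F)$ be the space of locally constant compactly supported $E$-valued functions on $F$. The Kirillov model of $\sigma$ is the following space of functions on $F^\times$: $\mathcal{K}_\sigma=C_c^\infty(F)\chi_1+C_c^\infty(F)\omega\chi_2$ if $\chi_1\ne\omega\chi_2$, and $\mathcal{K}_\sigma=C_c^\infty(F)\chi_1+C_c^\infty(F)v_F\chi_1$ if $\chi_1=\omega\chi_2$. It carries the unique $G$-action that makes it isomorphic to $\sigma$ and for which $\begin{pmatrix}a&b\\0&1\end{pmatrix}$ acts by $\phi(x)\mapsto\psi(bx)\phi(ax)$. The Kirillov model of $\rho$ is $\mathcal{K}=V_\tau\otimes_E\mathcal{K}_\sigma$ with the tensor product action of $G$, viewed as a space of $V_\tau$-valued functions on $F^\times$; thus for $g=\begin{pmatrix}a&b\\0&1\end{pmatrix}$ one has $\rho(g)\phi(x)=\tau(g)(\psi(bx)\phi(ax))$. *)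

(* Defs.v *)
From HB Require Import structures.
From mathcomp Require Import all_boot all_order all_algebra.
From mathcomp Require Import generic_quotient ring_quotient.
From mathcomp Require Import mathcomp_extra boolp classical_sets functions.
From mathcomp Require Import cardinality fsbigop reals.

Set Implicit Arguments.
Unset Strict Implicit.
Unset Printing Implicit Defensive.
Import Order.TTheory GRing.Theory Num.Theory.

Local Open Scope classical_set_scope.
Local Open Scope ring_scope.
Local Open Scope quotient_scope.

Section Units.
Variable K : fieldType.

Record Kunit := KUnit { uval : K; _ : uval != 0 }.

HB.instance Definition _ := [isSub for uval].
HB.instance Definition _ := [Choice of Kunit by <:].

Fact Kunit_one_subproof : (1 : K) != 0. Proof. exact: oner_neq0. Qed.
Fact Kunit_mul_subproof (x y : Kunit) : val x * val y != 0.
Proof. by rewrite mulf_neq0 ?(valP x) ?(valP y). Qed.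
Fact Kunit_inv_subproof (x : Kunit) : (val x)^-1 != 0.
Proof. by rewrite invr_eq0 (valP x). Qed.

Definition Kunit_one : Kunit := KUnit Kunit_one_subproof.
Definition Kunit_mul (x y : Kunit) : Kunit := KUnit (Kunit_mul_subproof x y).
Definition Kunit_inv (x : Kunit) : Kunit := KUnit (Kunit_inv_subproof x).

Fact Kunit_mulA : associative Kunit_mul.
Proof. by move=> x y z; apply: val_inj; rewrite /= mulrA. Qed.
Fact Kunit_mul1 : left_id Kunit_one Kunit_mul.
Proof. by move=> x; apply: val_inj; rewrite /= mul1r. Qed.
Fact Kunit_mulr1 : right_id Kunit_one Kunit_mul.
Proof. by move=> x; apply: val_inj; rewrite /= mulr1. Qed.
Fact Kunit_mulV : left_inverse Kunit_one Kunit_inv Kunit_mul.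
Proof. by move=> x; apply: val_inj; rewrite /= mulVf ?(valP x). Qed.
Fact Kunit_mulrV : right_inverse Kunit_one Kunit_inv Kunit_mul.
Proof. by move=> x; apply: val_inj; rewrite /= mulfV ?(valP x). Qed.

HB.instance Definition _ :=
  isGroup.Build Kunit Kunit_mulA Kunit_mul1 Kunit_mulr1 Kunit_mulV Kunit_mulrV.

Record GL2 := MkGL2 { mxval : 'M[K]_2; _ : mxval \in unitmx }.

HB.instance Definition _ := [isSub for mxval].
HB.instance Definition _ := [Choice of GL2 by <:].

Fact GL2_one_subproof : (1%:M : 'M[K]_2) \in unitmx. Proof. exact: unitmx1. Qed.
Fact GL2_mul_subproof (g h : GL2) : val g *m val h \in unitmx.
Proof. by rewrite unitmx_mul (valP g) (valP h). Qed.
Fact GL2_inv_subproof (g : GL2) : invmx (val g) \in unitmx.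
Proof. by rewrite unitmx_inv (valP g). Qed.

Definition GL2_one : GL2 := MkGL2 GL2_one_subproof.
Definition GL2_mul (g h : GL2) : GL2 := MkGL2 (GL2_mul_subproof g h).
Definition GL2_inv (g : GL2) : GL2 := MkGL2 (GL2_inv_subproof g).

Fact GL2_mulA : associative GL2_mul.
Proof. by move=> x y z; apply: val_inj; rewrite /= mulmxA. Qed.
Fact GL2_mul1 : left_id GL2_one GL2_mul.
Proof. by move=> x; apply: val_inj; rewrite /= mul1mx. Qed.
Fact GL2_mulr1 : right_id GL2_one GL2_mul.
Proof. by move=> x; apply: val_inj; rewrite /= mulmx1. Qed.
Fact GL2_mulV : left_inverse GL2_one GL2_inv GL2_mul.
Proof. by move=> x; apply: val_inj; rewrite /= mulVmx ?(valP x). Qed.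
Fact GL2_mulrV : right_inverse GL2_one GL2_inv GL2_mul.
Proof. by move=> x; apply: val_inj; rewrite /= mulmxV ?(valP x). Qed.

HB.instance Definition _ :=
  isGroup.Build GL2 GL2_mulA GL2_mul1 GL2_mulr1 GL2_mulV GL2_mulrV.

Definition upper_mx (t1 s t2 : K) : 'M[K]_2 :=
  \matrix_(i, j) if i == 0 then (if j == 0 then t1 else s)
                 else (if j == 0 then 0 else t2).

Fact upper_subproof (t1 : Kunit) (s : K) (t2 : Kunit) :
  upper_mx (val t1) s (val t2) \in unitmx.
Proof.
rewrite unitmxE -det_tr det_trig; last first.
  apply/is_trig_mxP => i j; case: i j => [[|[]]] // ? [[|[]]] // ? _.
  by rewrite !mxE.
rewrite !big_ord_recl big_ord0 !mxE /= mulr1 unitfE.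
exact: mulf_neq0 (valP t1) (valP t2).
Qed.

Definition upper (t1 : Kunit) (s : K) (t2 : Kunit) : GL2 :=
  MkGL2 (upper_subproof t1 s t2).

End Units.

(* The value at 0 is unconstrained. *)
Record normalized_valuation (F : fieldType) := NormalizedValuation {
  nval :> F -> int;
  nvalM : forall x y, x != 0 -> y != 0 -> nval (x * y) = nval x + nval y;
  nvalD : forall x y, x != 0 -> y != 0 -> x + y != 0 ->
    Order.min (nval x) (nval y) <= nval (x + y);
  nval_surj : exists2 x, x != 0 & nval x = 1
}.

Section LocalField.
Variables (F : fieldType) (v : normalized_valuation F).

(* The fractional ideal pi^k O_F. *)
Definition pow_ideal (k : int) : {pred F} := fun x => (x == 0) || (k <= v x).

Lemma nval1 : v 1 = 0.
Proof.
apply: (@addrI _ (v 1)).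
by rewrite -nvalM ?oner_neq0 // mulr1 addr0.
Qed.

Lemma nvalN x : x != 0 -> v (- x) = v x.
Proof.
move=> x0; have N10 : (-1 : F) != 0 by rewrite oppr_eq0 oner_neq0.
have vN1 : v (-1) = 0.
  have := nvalM v N10 N10; rewrite mulrNN mulr1 nval1 => /esym/eqP.
  by rewrite -mulr2n mulrn_eq0 => /eqP.
by rewrite -mulN1r nvalM // vN1 add0r.
Qed.

Lemma pow_ideal_zmod (k : int) : zmod_closed (pow_ideal k).
Proof.
split=> [|x y]; rewrite !unfold_in ?eqxx //.
case: (eqVneq x 0) => [->|x0] /=.
  rewrite sub0r oppr_eq0; case: (eqVneq y 0) => //= y0 _.
  by rewrite nvalN.
move=> kx; case: (eqVneq y 0) => [->|y0] /=; first by rewrite subr0 kx orbT.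
move=> ky; case: (eqVneq (x - y) 0) => //= xy0.
have Ny0 : - y != 0 by rewrite oppr_eq0.
by apply: le_trans (nvalD v x0 Ny0 xy0); rewrite le_min kx nvalN.
Qed.

HB.instance Definition _ (k : int) :=
  GRing.isZmodClosed.Build F (pow_ideal k) (pow_ideal_zmod k).

Definition OF : {pred F} := pow_ideal 0.

Definition Wquot := Quotient.quot (pow_ideal 0).

Definition vcauchy (u : nat -> F) := forall k : int,
  exists N, forall i j, (N <= i)%N -> (N <= j)%N -> u i - u j \in pow_ideal k.

Definition vcvg_to (u : nat -> F) (l : F) := forall k : int,
  exists N, forall i, (N <= i)%N -> u i - l \in pow_ideal k.

(* O_F / pi O_F is realized as the image of O_F in F / pi O_F. *)
Record local_field0 (p q : nat) : Prop := LocalField0 {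
  lf_char0 : [pchar F] =i pred0;
  lf_complete : forall u, vcauchy u -> exists l, vcvg_to u l;
  lf_residue_card :
    (\pi_(Quotient.quot (pow_ideal 1)) @` [set x | x \in OF] #= `I_q)%card;
  lf_residue_prime : prime p;
  lf_residue_char : p%:R \in pow_ideal 1
}.

Definition vopen (U : set F) :=
  forall x, U x -> exists k : int, forall y, y - x \in pow_ideal k -> U y.

Definition vcompact (A : set F) := forall (I : choiceType) (U : I -> set F),
  (forall i, vopen (U i)) -> A `<=` \bigcup_i U i ->
  exists s : seq I, A `<=` \bigcup_(i in [set` s]) U i.

(* i is the identity for functions on F, and val for functions on F^*. *)
Definition locally_constant (X Y : Type) (i : X -> F) (f : X -> Y) :=
  forall x, exists k : int, forall y, i y - i x \in pow_ideal k -> f y = f x.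

(* F^* and GL_2(F) carry the topologies induced by F and M_2(F). *)
Definition open_subgroup (H : set (GL2 F)) :=
  [/\ H 1%g,
      forall g h, H g -> H h -> H (g * h)%g,
      forall g, H g -> H g^-1%g
    & forall g, H g -> exists k : int, forall h,
        (forall i j, (val h - val g) i j \in pow_ideal k) -> H h].

Section Characters.
Variable E : fieldType.

Record smooth_char (chi : Kunit F -> E) : Prop := SmoothChar {
  sc_neq0 : forall x, chi x != 0;
  sc_mul : forall x y, chi (x * y)%g = chi x * chi y;
  sc_smooth : locally_constant val chi
}.

Definition unramified (chi : Kunit F -> E) :=
  forall u, v (val u) = 0 -> chi u = 1.

Definition tamely_ramified (chi : Kunit F -> E) :=
  forall u, val u - 1 \in pow_ideal 1 -> chi u = 1.

(* The unramified character sending a uniformizer to q^-1. *)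
Definition omega (q : nat) (x : Kunit F) : E := (q%:R : E) ^ (- v (val x)).

Record self_dual_char (psi : F -> E) : Prop := SelfDualChar {
  ac_neq0 : forall x, psi x != 0;
  ac_add : forall x y, psi (x + y) = psi x * psi y;
  ac_smooth : locally_constant id psi;
  ac_annihilator : forall x,
    (forall y, y \in OF -> psi (x * y) = 1) <-> x \in OF
}.

End Characters.
End LocalField.

Section Representations.
Variable E : fieldType.

Definition lin_subspace (M : lmodType E) (V : set M) :=
  V 0 /\ forall a x y, V x -> V y -> V (a *: x + y).

Definition linear_on (M M' : lmodType E) (V : set M) (T : M -> M') :=
  forall a x y, V x -> V y -> T (a *: x + y) = a *: T x + T y.

(* The values of act outside V are irrelevant. *)
Record is_rep (G : groupType) (M : lmodType E) (V : set M)
    (act : G -> M -> M) : Prop := IsRep {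
  rep_sub : lin_subspace V;
  rep_stable : forall g x, V x -> V (act g x);
  rep_linear : forall g, linear_on V (act g);
  rep1 : forall x, V x -> act 1%g x = x;
  repM : forall g h x, V x -> act (g * h)%g x = act g (act h x)
}.

Definition rep_irreducible (G : groupType) (M : lmodType E) (V : set M)
    (act : G -> M -> M) :=
  V <> [set 0] /\
  forall U : set M, U `<=` V -> lin_subspace U ->
    (forall g x, U x -> U (act g x)) -> U = [set 0] \/ U = V.

Definition rep_iso (G : groupType) (M M' : lmodType E)
    (V : set M) (act : G -> M -> M) (V' : set M') (act' : G -> M' -> M') :=
  exists T : M -> M', [/\ set_bij V V' T, linear_on V T
    & forall g x, V x -> T (act g x) = act' g (T x)].

End Representations.

Section Models.
Variables (F : fieldType) (v : normalized_valuation F) (q : nat).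
Variable E : fieldType.

Definition Ind (chi1 chi2 : Kunit F -> E) : set (GL2 F -> E^o) :=
  [set f | (forall t1 s t2 g, f (upper t1 s t2 * g)%g = chi1 t1 * chi2 t2 * f g)
    /\ exists2 H, open_subgroup v H & forall g h, H h -> f (g * h)%g = f g].

Definition right_translation (g : GL2 F) (f : GL2 F -> E^o) : GL2 F -> E^o :=
  fun x => f (x * g)%g.

Definition Cc_infty : set (F -> E) :=
  [set f | locally_constant v id f /\
    exists2 A, vcompact v A & forall x, ~ A x -> f x = 0].

Definition K_sum (eta1 eta2 : Kunit F -> E) : set (Kunit F -> E^o) :=
  [set phi | exists f1 f2, [/\ Cc_infty f1, Cc_infty f2 &
     phi = fun x => f1 (val x) * eta1 x + f2 (val x) * eta2 x]].

Definition K_sigma (chi1 chi2 : Kunit F -> E) : set (Kunit F -> E^o) :=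
  let omega_chi2 := fun x => omega v E q x * chi2 x in
  if `[< chi1 = omega_chi2 >]
  then K_sum chi1 (fun x => (v (val x))%:~R * chi1 x)
  else K_sum chi1 omega_chi2.

Record kirillov_action (psi : F -> E) (chi1 chi2 : Kunit F -> E)
    (act : GL2 F -> (Kunit F -> E^o) -> (Kunit F -> E^o)) : Prop :=
  KirillovAction {
  ka_rep : is_rep (K_sigma chi1 chi2) act;
  ka_iso : rep_iso (Ind chi1 chi2) right_translation (K_sigma chi1 chi2) act;
  ka_mirabolic : forall a b phi, K_sigma chi1 chi2 phi ->
    act (upper a b 1%g) phi = fun x => psi (b * val x) * phi (a * x)%g
}.

(* Sym^n of the standard representation E^2 = E e1 + E e2, in the basis
   e1^i e2^(n-i), 0 <= i <= n. A vector with coordinates u i is encoded as the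
   polynomial \sum_i u i 'X^i (e1 = 'X, e2 = 1); g sends e1 to
   g 0 0 e1 + g 1 0 e2 and e2 to g 0 1 e1 + g 1 1 e2. *)
Definition symn (n : nat) (g : 'M[E]_2) (u : 'rV[E]_n.+1) : 'rV[E]_n.+1 :=
  poly_rV (\sum_(i < n.+1) u 0 i *:
    ((g 0 0 *: 'X + (g 1 0)%:P) ^+ i * (g 0 1 *: 'X + (g 1 1)%:P) ^+ (n - i))).

Variable iota : {rmorphism F -> E}.

Definition tau (m : int) (n : nat) (g : GL2 F) (u : 'rV[E]_n.+1) :
    'rV[E]_n.+1 :=
  iota (\det (val g)) ^ m *: symn (map_mx iota (val g)) u.

(* V_tau (x) K_sigma, as a space of functions: since V_tau = E^(n+1), it
   consists of the functions all of whose coordinates lie in K_sigma. *)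
Definition K_rho (n : nat) (chi1 chi2 : Kunit F -> E) :
    set (Kunit F -> 'rV[E]_n.+1) :=
  [set phi | forall i, K_sigma chi1 chi2 (fun x => phi x 0 i)].

(* On f(x) u, with f in K_sigma and u in V_tau, this is
   (sigma g f)(x) tau(g) u. *)
Definition rho (sigma : GL2 F -> (Kunit F -> E^o) -> (Kunit F -> E^o))
    (m : int) (n : nat) (g : GL2 F) (phi : Kunit F -> 'rV[E]_n.+1) :
    Kunit F -> 'rV[E]_n.+1 :=
  fun x => tau m g (\row_i sigma g (fun y => phi y 0 i) x).

(* psi_beta(pi^-l x) phi_l(x): the value does not depend on the chosen
   representative of beta, because pi^-l x is a unit when v x = l. *)
Definition psi_phi (psi : F -> E) (pi : Kunit F) (l : int) (beta : Wquot v)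
    (x : Kunit F) : E :=
  psi (repr beta * (val pi ^ (- l) * val x)) * (v (val x) == l)%:R.

End Models.

Section Lattices.
Variables (R : realType) (E : fieldType).

Record nonarch_abs (absE : E -> R) : Prop := NonarchAbs {
  abs_ge0 : forall x, 0 <= absE x;
  abs_eq0 : forall x, absE x = 0 <-> x = 0;
  absM : forall x y, absE (x * y) = absE x * absE y;
  absD : forall x y, absE (x + y) <= Num.max (absE x) (absE y)
}.

Definition extends_abs (F : fieldType) (v : normalized_valuation F) (q : nat)
    (iota : F -> E) (absE : E -> R) :=
  forall x, x != 0 -> absE (iota x) = (q%:R : R) ^ (- v x).

Definition is_lattice (absE : E -> R) (V : vectType E) (M : set V) :=
  exists2 e : (\dim {:V}).-tuple V, basis_of fullv e &
    M = [set w | exists2 c : 'I_(\dim {:V}) -> E,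
           forall i, absE (c i) <= 1 & w = \sum_i c i *: e`_i].

Definition OE_span (absE : E -> R) (G : Type) (M : lmodType E)
    (act : G -> M -> M) (w : M) : set M :=
  [set x | exists2 s : seq (E * G), forall c, c \in [seq d.1 | d <- s] ->
     absE c <= 1 & x = \sum_(d <- s) d.1 *: act d.2 w].

End Lattices.

(* Main.v *)
(* By the Iwasawa decomposition and smoothness, and because the central character of rho is
   unitary by (i), O_E[G]w lies in the O_E-span of mirabolic translates of finitely many
   vectors u f, with f in the Kirillov model of sigma and u in the unit ball M of V_tau.
   Identify phi on pi^l U_F with a function Phi_l on O_F via diag(pi^l, 1). The asymptotics
   of f at 0 give, with T g(x) = tau(diag(pi, 1)) g(pi x), la = chi1(pi) and
   mu = omega(pi) chi2(pi),
     Phi_l = (la + mu) T Phi_(l-1) - la mu T^2 Phi_(l-2) + c_l,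
   when chi1 = chi2 on units, where the c_l lie in a fixed multiple of the module X of
   functions whose psi_b-coefficients lie in tau(1, b; 0, 1) M. If g in X vanishes on U_F, its
   coefficients are constant along the fibres of beta |-> pi beta, which have q elements, and
   lie in the intersection of q translates of M; since n < q, Lagrange interpolation then puts
   T g in q pi^(n+m) X. As phi vanishes outside O_F, every Phi_l with l < 0 vanishes on U_F,
   so (i) and (ii) bound Phi_0 by induction.
   If chi1 <> chi2 on units (hence n = 0), phi = chi1 A + chi2 B with A, B satisfying first
   order recurrences; the relation A + (chi2/chi1) B = 0 on U_F and the value |g g'| = |q|^-1
   of the product of normalized Gauss sums balance the bounds on A and B. *)

Require Import Defs.
From HB Require Import structures.
From mathcomp Require Import all_boot all_order all_algebra.
From mathcomp Require Import generic_quotient ring_quotient.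
From mathcomp Require Import mathcomp_extra boolp classical_sets functions.
From mathcomp Require Import cardinality fsbigop reals.
From mathcomp Require Import ring zify.

Set Implicit Arguments.
Unset Strict Implicit.
Unset Printing Implicit Defensive.
Import Order.TTheory GRing.Theory Num.Theory.

Local Open Scope classical_set_scope.
Local Open Scope ring_scope.

(** * Valuations and residues *)

Section Valuation.
Variables (F : fieldType) (v : normalized_valuation F).
Implicit Types (x y u : F) (k l : int).

(** The values of phi on pi^l U_F determine Phi_l only on the units; the extension to O_F is extra
    data, carried along because the characters psi_beta are linearly independent on O_F but not on
    U_F. The relations that appear on restriction to U_F are what makes the coefficients of a
    function vanishing there constant along fibres. The level below which the data of phi vanish has
    no uniform lower bound, so the induction that climbs to level 0 has unbounded length. Each of
    its steps must preserve the radius exactly; fixed constants may be lost only before and after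
    it. Put w = q pi^(n+m). The operator T has the plain bound |pi^m|, and the bound |w| on
    functions vanishing on U_F. In la mu T^2 Phi_(l-2) the vanishing serves the inner T only, which
    gives |la mu w pi^m|, equal to 1 by (i); (ii) says that |la w| and |mu w| are at most 1. When
    the characters differ on units, multiplication by chi2/chi1 or by its inverse occurs at every
    step and costs a Gauss sum. Unequal radii for A and B let the two costs enter only through their
    product. *)

Definition val_unit : {pred F} := fun x => (x != 0) && (v x == 0).

Lemma pow_idealE k x : (x \in pow_ideal v k) = (x == 0) || (k <= v x).
Proof. by []. Qed.

Lemma val_unitE x : (x \in val_unit) = (x != 0) && (v x == 0).
Proof. by []. Qed.

Lemma OFE x : (x \in OF v) = (x \in pow_ideal v 0).
Proof. by []. Qed.

Lemma pow_ideal_le k l x : k <= l -> x \in pow_ideal v l -> x \in pow_ideal v k.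
Proof.
by move=> kl; rewrite !pow_idealE => /orP[->//|lx]; rewrite (le_trans kl) ?orbT.
Qed.

Lemma pow_idealM k l x y :
  x \in pow_ideal v k -> y \in pow_ideal v l -> x * y \in pow_ideal v (k + l).
Proof.
rewrite !pow_idealE mulf_eq0; have [->//|x0] := eqVneq x 0.
by have [->//|y0] := eqVneq y 0; rewrite /= nvalM //; apply: lerD.
Qed.

Lemma nvalV x : x != 0 -> v x^-1 = - v x.
Proof.
move=> x0; apply: (@addrI _ (v x)).
by rewrite -nvalM ?invr_eq0 // divff // nval1 subrr.
Qed.

Lemma nvalXz x k : x != 0 -> v (x ^ k) = v x * k.
Proof.
move=> x0; have nat_case (n : nat) : v (x ^+ n) = v x * n%:Z.
  elim: n => [|n IHn]; first by rewrite expr0 nval1 mulr0.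
  by rewrite exprS nvalM ?expf_neq0 // IHn intS mulrDr mulr1.
case: k => n; first by rewrite -exprnP nat_case.
by rewrite NegzE -exprnN nvalV ?expf_neq0 // nat_case mulrN.
Qed.

Lemma val_unit_neq0 u : u \in val_unit -> u != 0.
Proof. by case/andP. Qed.

Lemma val_unit_OF u : u \in val_unit -> u \in OF v.
Proof. by rewrite val_unitE => /andP[_ /eqP u0]; rewrite OFE pow_idealE u0 lexx orbT. Qed.

Lemma val_unitM u1 u2 : u1 \in val_unit -> u2 \in val_unit -> u1 * u2 \in val_unit.
Proof.
rewrite !val_unitE => /andP[u10 /eqP v1] /andP[u20 /eqP v2].
by rewrite mulf_neq0 // nvalM // v1 v2 eqxx.
Qed.

Lemma val_unitV u : u \in val_unit -> u^-1 \in val_unit.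
Proof. by rewrite !val_unitE => /andP[u0 /eqP v1]; rewrite invr_eq0 u0 nvalV // v1 oppr0 eqxx. Qed.

Lemma val_unit1 : 1 \in val_unit.
Proof. by rewrite val_unitE oner_neq0 nval1 eqxx. Qed.

Lemma val_unitN u : u \in val_unit -> - u \in val_unit.
Proof. by rewrite !val_unitE => /andP[u0 /eqP v1]; rewrite oppr_eq0 u0 nvalN // v1 eqxx. Qed.

Lemma OF0 : 0 \in OF v. Proof. exact: (rpred0 (pow_ideal v 0)). Qed.

Lemma OF1 : 1 \in OF v. Proof. exact/val_unit_OF/val_unit1. Qed.

Lemma OFM x y : x \in OF v -> y \in OF v -> x * y \in OF v.
Proof. by move=> xO yO; have := pow_idealM xO yO; rewrite addr0. Qed.

Lemma OFD x y : x \in OF v -> y \in OF v -> x + y \in OF v.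
Proof. exact: (rpredD (V := F) (S := pow_ideal v 0)). Qed.

Lemma OFN x : x \in OF v -> - x \in OF v.
Proof. by rewrite !OFE rpredN. Qed.

Lemma OF_pow1 x : x \in OF v -> (x \in pow_ideal v 1) = (x \notin val_unit).
Proof.
rewrite val_unitE OFE !pow_idealE; have [//|x0] := eqVneq x 0; rewrite -gtz0_ge1 /= => vx.
by rewrite lt_neqAle vx andbT eq_sym.
Qed.

Lemma pow_ideal_mulu k u x : u \in val_unit ->
  (u * x \in pow_ideal v k) = (x \in pow_ideal v k).
Proof.
move=> uU; apply/idP/idP => [|xk].
  move=> /(pow_idealM (val_unit_OF (val_unitV uU))).
  by rewrite add0r mulrA mulVf ?mul1r // val_unit_neq0.
by have := pow_idealM (val_unit_OF uU) xk; rewrite add0r.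
Qed.

Lemma val_unit_near u x : u \in val_unit -> x - u \in pow_ideal v 1 -> x \in val_unit.
Proof.
move=> uU xu; have uO := val_unit_OF uU.
have xO : x \in OF v by rewrite -(subrK u x) OFD // (pow_ideal_le _ xu).
apply: contraTT uU; rewrite -!OF_pow1 // => x1.
by rewrite -(subKr x u) rpredB.
Qed.

Definition is_residue_system (q : nat) (rs : seq F) :=
  [/\ size rs = q, {subset rs <= OF v},
      forall i j, (i < q)%N -> (j < q)%N -> rs`_i - rs`_j \in pow_ideal v 1 -> i = j
    & forall x, x \in OF v -> exists2 r, r \in rs & x - r \in pow_ideal v 1].

(** The cardinality hypothesis is a bijection between [I_q] and the image of O_F in F / pi O_F; a
    representative in O_F is chosen for each index. *)
Lemma residue_system_exists (p q : nat) : local_field0 v p q ->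
  exists rs, is_residue_system q rs.
Proof.
case=> _ _ card_res _ _.
have /card_esym/card_bijP/= := card_res.
case=> f bij_f.
have mI (i : nat) : (i < q)%N -> i \in `I_q by move=> iq; apply/mem_set.
pose idx (i : 'I_q) : `I_q := SigSub (mI _ (ltn_ord i)).
have /choice[rep repP] : forall i : 'I_q, exists x, x \in OF v /\
    (\pi_(Quotient.quot (pow_ideal v 1)) x)%qT = val (f (idx i)).
  move=> i; case: (f _) => y /= yP; have [x xO xy] := set_mem yP.
  by exists x.
have eq_pi x y : (\pi_(Quotient.quot (pow_ideal v 1)) x = \pi y)%qT <-> x - y \in pow_ideal v 1.
  split=> [/eqP|h]; first by rewrite eqmodE.
  by apply/eqP; rewrite eqmodE.
exists (map rep (enum 'I_q)).
have nthE i (hi : (i < q)%N) : (map rep (enum 'I_q))`_i = rep (Ordinal hi).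
  by rewrite (nth_map (Ordinal hi)) ?size_enum_ord // (nth_ord_enum _ (Ordinal hi)).
split.
- by rewrite size_map size_enum_ord.
- by move=> _ /mapP[i _ ->]; case: (repP i).
- move=> i j hi hj; rewrite !nthE => /eq_pi.
  have [_ ->] := repP (Ordinal hi); have [_ ->] := repP (Ordinal hj).
  by move=> /val_inj/(bij_inj bij_f) => /(congr1 val).
- move=> x xO; case: bij_f => g fK gK.
  have xP : (\pi_(Quotient.quot (pow_ideal v 1)) x)%qT \in
      [set (\pi_(Quotient.quot (pow_ideal v 1)) y)%qT | y in [set y | y \in OF v]].
    by apply/mem_set; exists x.
  pose gi := g (SigSub xP); have gi_lt : (val gi < q)%N by have := set_mem (valP gi).
  exists (rep (Ordinal gi_lt)); first by apply: map_f; rewrite mem_enum.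
  apply/eq_pi; have [_ ->] := repP (Ordinal gi_lt).
  have -> : idx (Ordinal gi_lt) = gi by apply: val_inj.
  by rewrite gK.
Qed.

Lemma residue_uniq q rs : is_residue_system q rs -> uniq rs.
Proof.
case=> szrs rsO rsinj _; apply/(uniqP 0) => i j.
rewrite !inE !szrs => iq jq ij; apply: rsinj => //.
by rewrite ij subrr (rpred0 (pow_ideal v 1)).
Qed.

Lemma residue_inj q rs x y : is_residue_system q rs -> x \in rs -> y \in rs ->
  x - y \in pow_ideal v 1 -> x = y.
Proof.
case=> szrs rsO rsinj _ xrs yrs xy.
have := xrs; have := yrs; rewrite -!index_mem !szrs => iy ix.
rewrite -(nth_index 0 xrs) -(nth_index 0 yrs); congr (_`_ _); apply: rsinj => //.
by rewrite !nth_index.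
Qed.

End Valuation.

(** * Absolute values and symmetric powers *)

Section AbsoluteValue.
Variables (R : realType) (E : fieldType) (absE : E -> R).
Hypothesis habsE : nonarch_abs absE.
Implicit Types (r s : R).

Lemma absE0 : absE 0 = 0. Proof. exact/(abs_eq0 habsE). Qed.

Lemma absE_gt0 x : x != 0 -> 0 < absE x.
Proof.
move=> x0; rewrite lt_neqAle abs_ge0 // andbT eq_sym.
by apply: contra_neq x0 => /(abs_eq0 habsE).
Qed.

Lemma absE1 : absE 1 = 1.
Proof.
have a1 : absE 1 != 0 by rewrite gt_eqF // absE_gt0 ?oner_neq0.
by apply: (mulfI a1); rewrite -absM // !mulr1.
Qed.

Lemma absEV x : absE x^-1 = (absE x)^-1.
Proof.
have [->|x0] := eqVneq x 0; first by rewrite invr0 absE0 invr0.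
have ax : absE x != 0 by rewrite gt_eqF // absE_gt0.
by apply: (mulfI ax); rewrite -absM // !divff // absE1.
Qed.

Lemma absEX x k : absE (x ^+ k) = absE x ^+ k.
Proof. by elim: k => [|k IHk]; rewrite ?expr0 ?absE1 // !exprS absM // IHk. Qed.

Lemma absEXz x (k : int) : absE (x ^ k) = absE x ^ k.
Proof. by case: k => k; rewrite ?NegzE -?exprnN -?exprnP ?absEV absEX. Qed.

Lemma absE_root_of_unity x k : (0 < k)%N -> x ^+ k = 1 -> absE x = 1.
Proof.
move=> k0 /(congr1 absE); rewrite absEX absE1 => /eqP.
by rewrite pexpr_eq1 ?abs_ge0 // => /eqP.
Qed.

Lemma absEN x : absE (- x) = absE x.
Proof.
rewrite -mulN1r absM // (@absE_root_of_unity (-1) 2) ?mul1r //.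
by rewrite sqrrN expr1n.
Qed.

Lemma absED_le r x y : absE x <= r -> absE y <= r -> absE (x + y) <= r.
Proof. by move=> xr yr; rewrite (le_trans (absD habsE _ _)) // ge_max xr yr. Qed.

Lemma absE_sum_le (I : Type) (s : seq I) (P : pred I) (G : I -> E) r : 0 <= r ->
  (forall i, P i -> absE (G i) <= r) -> absE (\sum_(i <- s | P i) G i) <= r.
Proof.
move=> r0 Gr; elim/big_rec: _ => [|i x Pi xr]; first by rewrite absE0.
by apply: absED_le => //; apply: Gr.
Qed.

Lemma absE_nat_le1 k : absE k%:R <= 1.
Proof.
elim: k => [|k IHk]; first by rewrite absE0.
by rewrite -addn1 natrD absED_le // absE1.
Qed.

Definition poly_ball (r : R) (p : {poly E}) := forall k, absE p`_k <= r.

Definition ball n (r : R) (u : 'rV[E]_n) := forall i, absE (u 0 i) <= r.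

Lemma ballD n r (u w : 'rV[E]_n) : ball r u -> ball r w -> ball r (u + w).
Proof. by move=> ur wr i; rewrite mxE absED_le. Qed.

Lemma ballZ n r c (u : 'rV[E]_n) : ball r u -> ball (absE c * r) (c *: u).
Proof. by move=> ur i; rewrite mxE absM // ler_wpM2l ?abs_ge0. Qed.

Lemma ball_le n r s (u : 'rV[E]_n) : r <= s -> ball r u -> ball s u.
Proof. by move=> rs ur i; apply: le_trans rs. Qed.

Lemma ball0 n r : 0 <= r -> ball r (0 : 'rV[E]_n).
Proof. by move=> r0 i; rewrite mxE absE0. Qed.

Lemma ball_sum n (I : Type) (s : seq I) (P : pred I) (G : I -> 'rV[E]_n) r :
  0 <= r -> (forall i, P i -> ball r (G i)) -> ball r (\sum_(i <- s | P i) G i).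
Proof.
move=> r0 Gr; elim/big_rec: _ => [|i x Pi xr]; first exact: ball0.
by apply: ballD => //; apply: Gr.
Qed.

Lemma poly_ballM r s p q : 0 <= r -> 0 <= s ->
  poly_ball r p -> poly_ball s q -> poly_ball (r * s) (p * q).
Proof.
move=> r0 s0 pr qs k; rewrite coefM; apply: absE_sum_le => [|i _].
  exact: mulr_ge0.
by rewrite absM // ler_pM ?abs_ge0.
Qed.

Lemma poly_ballD r p q : poly_ball r p -> poly_ball r q -> poly_ball r (p + q).
Proof. by move=> pr qr k; rewrite coefD absED_le. Qed.

Lemma poly_ballC r c : 0 <= r -> absE c <= r -> poly_ball r c%:P.
Proof. by move=> r0 cr k; rewrite coefC; case: eqP; rewrite ?absE0. Qed.

(* Newton interpolation: the differences of the nodes are units. *)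
Lemma interpolation_ball (xs : seq E) (P : {poly E}) r : 0 <= r ->
  (forall x, x \in xs -> absE x <= 1) ->
  pairwise (fun x y => 1 <= absE (y - x)) xs ->
  (forall x, x \in xs -> absE P.[x] <= r) ->
  (size P <= size xs)%N -> poly_ball r P.
Proof.
move=> r0; elim: xs P => [|x xs IHxs] P xs1 /=.
  by rewrite size_poly_leq0 => _ _ /eqP-> k; rewrite coef0 absE0.
case/andP=> /allP far pw Pr szP.
have /factor_theorem[Q PQ] : root (P - P.[x]%:P) x.
  by rewrite rootE !hornerE subrr.
have PE : P = Q * ('X - x%:P) + P.[x]%:P by rewrite -PQ subrK.
have Px : absE P.[x] <= r by apply: Pr; rewrite mem_head.
rewrite PE; apply: poly_ballD; last exact: poly_ballC.
rewrite -[r]mulr1; apply: poly_ballM => //; last first.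
  move=> k; rewrite coefB coefX coefC; apply: absED_le; first exact: absE_nat_le1.
  rewrite absEN; case: ifP => _; rewrite ?absE0 //.
  by apply: xs1; rewrite mem_head.
(* At each remaining node [Q] takes the divided difference of [P], whose denominator has absolute
   value at least 1, so [Q] inherits the bound. *)
apply: IHxs => // [y ys|y ys|].
- by apply: xs1; rewrite inE ys orbT.
- have yx0 : y - x != 0.
    by have := far _ ys; apply: contraTneq => ->; rewrite absE0 ler10.
  have -> : Q.[y] = (P.[y] - P.[x]) / (y - x).
    by apply: (canRL (mulfK yx0)); rewrite {1}PE !hornerE addrK.
  rewrite absM // absEV -[r]mulr1.
  apply: ler_pM; rewrite ?invr_ge0 ?(abs_ge0 habsE) //.
    by apply: absED_le; rewrite ?absEN //; apply: Pr; rewrite inE ys orbT.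
  have ax := far _ ys; rewrite invf_le1 //; exact: lt_le_trans ltr01 ax.
- have [->|Q0] := eqVneq Q 0; first by rewrite size_poly0.
  have szQ : size (Q * ('X - x%:P)) = (size Q).+1.
    by rewrite size_mul ?polyXsubC_eq0 // size_XsubC addn2.
  rewrite -ltnS -szQ; apply: leq_trans szP.
  rewrite -PQ; apply: leq_trans (size_polyD _ _) _.
  rewrite geq_max size_polyN size_polyC leqnn /=.
  have: P != 0.
    apply: contra_neq Q0 => P0.
    by move: PQ; rewrite P0 horner0 subrr => /esym/eqP; rewrite mulf_eq0 polyXsubC_eq0 orbF => /eqP.
  by rewrite -size_poly_gt0; case: (P.[x] != 0).
Qed.

End AbsoluteValue.

(** * Symmetric powers as substitutions in binary forms *)

Section SymmetricPower.
Variable E : fieldType.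
Implicit Types (g h : 'M[E]_2) (p a b : {poly E}).

(** The value at (a, b) of the binary form of degree [d] whose dehomogenization is [p]. *)
Definition hom_eval (d : nat) (p a b : {poly E}) :=
  \sum_(k < d.+1) p`_k *: (a ^+ k * b ^+ (d - k)).

Definition symn_col0 g : {poly E} := g 0 0 *: 'X + (g 1 0)%:P.
Definition symn_col1 g : {poly E} := g 0 1 *: 'X + (g 1 1)%:P.

Lemma size_linear_poly (c d : E) : (size (c *: 'X + d%:P)%R <= 2)%N.
Proof.
rewrite (leq_trans (size_polyD _ _)) // geq_max size_polyC.
rewrite (leq_trans (size_scale_leq _ _)) ?size_polyX //.
by case: (d != 0).
Qed.

Lemma size_linear_exp (c d : E) k : (size ((c *: 'X + d%:P) ^+ k)%R <= k.+1)%N.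
Proof.
rewrite (leq_trans (size_poly_exp_leq _ _)) // ltnS.
by rewrite -[leqRHS]mul1n leq_mul // -subn1 leq_subLR size_linear_poly.
Qed.

Lemma size_linear_expM (c d c' d' : E) i j :
  (size ((c *: 'X + d%:P) ^+ i * (c' *: 'X + d'%:P) ^+ j)%R <= (i + j).+1)%N.
Proof.
rewrite (leq_trans (size_polyMleq _ _)) // -subn1 leq_subLR.
by rewrite add1n -addnS -addSn leq_add ?size_linear_exp.
Qed.

(** Homogenization is multiplicative. The size hypothesis makes the coefficient of [p] of index
    [d.+1] vanish, so that no term of degree too high is cut off. *)
Lemma hom_eval_linear d p a b (c e : E) : (size p <= d.+1)%N ->
  hom_eval d.+1 (p * (c *: 'X + e%:P)) a b = hom_eval d p a b * (c *: a + e *: b).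
Proof.
move=> szp; rewrite /hom_eval [RHS]mulrDr.
have coefE k : (p * (c *: 'X + e%:P))`_k = c * (if k is k'.+1 then p`_k' else 0) + e * p`_k.
  rewrite mulrDr coefD -scalerAr coefZ coefMX mulrC coefMC [e * _]mulrC [_ * c]mulrC.
  by case: k.
under eq_bigr do rewrite coefE scalerDl; rewrite big_split /=; congr (_ + _).
  rewrite big_ord_recl mulr0 scale0r add0r mulr_suml; apply: eq_bigr => k _.
  by rewrite /= subSS -!scalerAl -!scalerAr scalerA mulrC exprS -!mulrA [a * _]mulrCA [_ * a]mulrC.
rewrite big_ord_recr /= [p`_d.+1]nth_default // mulr0 scale0r addr0 mulr_suml.
apply: eq_bigr => k _; rewrite -!scalerAl -!scalerAr scalerA mulrC.
by rewrite subSn -1?ltnS ?ltn_ord // exprSr mulrA.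
Qed.

Lemma hom_eval_linear_exp (c d c' d' : E) a b i j :
  hom_eval (i + j) ((c *: 'X + d%:P) ^+ i * (c' *: 'X + d'%:P) ^+ j) a b =
  (c *: a + d *: b) ^+ i * (c' *: a + d' *: b) ^+ j.
Proof.
elim: j => [|j IHj]; last first.
  by rewrite addnS exprSr mulrA hom_eval_linear ?size_linear_expM // IHj exprSr mulrA.
rewrite addn0 !expr0 !mulr1; elim: i => [|i IHi].
  by rewrite /hom_eval big_ord1 coef1 scale1r !expr0 mulr1.
by rewrite exprSr hom_eval_linear ?size_linear_exp // IHi exprSr.
Qed.

Variable n : nat.
Implicit Types u w : 'rV[E]_n.+1.

Lemma symnE g u :
  symn g u = poly_rV (hom_eval n (rVpoly u) (symn_col0 g) (symn_col1 g)).
Proof.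
by congr poly_rV; apply: eq_bigr => i _; rewrite coef_rVpoly_ord.
Qed.

Lemma symn_poly g u : rVpoly (symn g u) =
  \sum_(i < n.+1) u 0 i *: (symn_col0 g ^+ i * symn_col1 g ^+ (n - i)).
Proof.
rewrite poly_rV_K //; apply: (leq_trans (size_sum _ _ _)).
apply/bigmax_leqP => i _; rewrite (leq_trans (size_scale_leq _ _)) //.
by have := size_linear_expM (g 0 0) (g 1 0) (g 0 1) (g 1 1) i (n - i); rewrite subnKC ?leq_ord.
Qed.

Lemma symn_coef g u k : symn g u 0 k =
  \sum_(i < n.+1) u 0 i * (symn_col0 g ^+ i * symn_col1 g ^+ (n - i))`_k.
Proof.
rewrite -coef_rVpoly_ord symn_poly coef_sum.
by apply: eq_bigr => i _; rewrite coefZ.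
Qed.

Lemma symnP g c u w : symn g (c *: u + w) = c *: symn g u + symn g w.
Proof.
apply/rowP => k.
have coordE (A B : 'rV[E]_n.+1) i : (c *: A + B) 0 i = c * A 0 i + B 0 i by rewrite !mxE.
rewrite coordE !symn_coef mulr_sumr -big_split.
by apply: eq_bigr => i _; rewrite coordE mulrDl mulrA.
Qed.

(** Substituting the columns of [g] into a product of powers of the columns of [h] gives, by
    [hom_eval_linear_exp], the same powers of the columns of [g *m h]. *)
Lemma symnM g h u : symn (g *m h) u = symn g (symn h u).
Proof.
rewrite [RHS]symnE symn_poly; congr poly_rV.
rewrite /hom_eval; under [RHS]eq_bigr do rewrite coef_sum scaler_suml.
rewrite exchange_big; apply: eq_bigr => i _.
under eq_bigr do rewrite coefZ -scalerA.
rewrite -scaler_sumr; congr (_ *: _).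
have := hom_eval_linear_exp (h 0 0) (h 1 0) (h 0 1) (h 1 1) (symn_col0 g) (symn_col1 g) i (n - i).
rewrite subnKC ?leq_ord // /hom_eval => ->.
have lift1 : lift ord0 ord0 = 1 :> 'I_2 by apply: val_inj.
have lin (a b c d x y : E) : (a * x + b * y) *: 'X + (c * x + d * y)%:P =
    x *: (a *: 'X + c%:P) + y *: (b *: 'X + d%:P).
  by rewrite -!mul_polyC !polyCD !polyCM; ring.
rewrite /symn_col0 /symn_col1 -!lin.
by rewrite !mxE !big_ord_recl !big_ord0 lift1 !addr0.
Qed.

Lemma symn_diag g u k : g 1 0 = 0 -> g 0 1 = 0 ->
  symn g u 0 k = g 0 0 ^+ k * g 1 1 ^+ (n - k) * u 0 k.
Proof.
move=> g10 g01; rewrite symn_coef (bigD1 k) //= big1 ?addr0 => [|i ik].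
  rewrite /symn_col0 /symn_col1 g10 g01 scale0r addr0 add0r exprZn -rmorphXn /=.
  by rewrite coefMC coefZ coefXn eqxx mulr1 mulrC.
rewrite /symn_col0 /symn_col1 g10 g01 scale0r addr0 add0r exprZn -rmorphXn /=.
by rewrite coefMC coefZ coefXn eq_sym -val_eqE in ik *; rewrite (negPf ik) !(mul0r, mulr0).
Qed.

Lemma symn_dg g u k : g 1 0 = 0 -> g 0 1 = 0 -> g 1 1 = 1 ->
  symn g u 0 k = g 0 0 ^+ k * u 0 k.
Proof. by move=> g10 g01 g11; rewrite symn_diag // g11 expr1n mulr1. Qed.

Lemma symn1 u : symn 1%:M u = u.
Proof. by apply/rowP => k; rewrite symn_dg ?mxE // expr1n mul1r. Qed.

(** Every coordinate of [u] occurs here as a coefficient of a power of [g 0 1]. Bounds on this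
    single coordinate for enough unipotent [g] therefore bound the whole vector. *)
Lemma symn_up_top g u : g 0 0 = 1 -> g 1 0 = 0 -> g 1 1 = 1 ->
  symn g u 0 ord_max = \sum_(i < n.+1) u 0 i * g 0 1 ^+ (n - i).
Proof.
move=> g00 g10 g11; rewrite symn_coef; apply: eq_bigr => i _; congr (_ * _).
rewrite /symn_col0 /symn_col1 g00 g10 g11 scale1r addr0 coefXnM ltnNge leq_ord /=.
elim: (n - i)%N => [|j IHj]; first by rewrite !expr0 coef1.
rewrite !exprS mulrDl coefD -scalerAl coefZ coefXM /= IHj mul1r.
by rewrite [_`_j.+1]nth_default ?addr0 // size_linear_exp.
Qed.

Variables (R : realType) (absE : E -> R) (habsE : nonarch_abs absE).

Lemma symn_ball g u r : 0 <= r -> (forall i j, absE (g i j) <= 1) ->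
  ball absE r u -> ball absE r (symn g u).
Proof.
move=> r0 g1 ur k; rewrite symn_coef; apply: absE_sum_le => // i _.
rewrite absM // -[r]mulr1; apply: ler_pM; rewrite ?abs_ge0 //.
have lin1 c d : absE c <= 1 -> absE d <= 1 -> poly_ball absE 1 (c *: 'X + d%:P).
  move=> c1 d1; apply: poly_ballD => //; last exact: poly_ballC.
  move=> j; rewrite coefZ coefX; case: eqP => _; rewrite ?mulr1 // mulr0.
  by rewrite absE0.
have exp1 p j : poly_ball absE 1 p -> poly_ball absE 1 (p ^+ j).
  move=> p1; elim: j => [|j IHj]; first by rewrite expr0; apply: poly_ballC; rewrite ?absE1.
  by rewrite exprS -[X in poly_ball _ X]mulr1; apply: poly_ballM.
by rewrite -[X in _ <= X]mulr1; apply: poly_ballM => //; apply: exp1; apply: lin1.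
Qed.

Lemma symn_bounded g : exists2 K : R, 0 <= K & forall r u, 0 <= r ->
  ball absE r u -> ball absE (K * r) (symn g u).
Proof.
pose a i k := absE (symn_col0 g ^+ i * symn_col1 g ^+ (n - i))`_k.
have a0 i k : 0 <= a i k by apply: abs_ge0.
have s0 i : 0 <= \sum_(k < n.+1) a i k by apply: sumr_ge0.
exists (\sum_(i < n.+1) \sum_(k < n.+1) a i k) => [|r u r0 ur k].
  exact: sumr_ge0.
rewrite symn_coef; apply: absE_sum_le => // [|i _].
  by rewrite mulr_ge0 // sumr_ge0.
rewrite absM // mulrC ler_pM ?abs_ge0 //.
rewrite (bigD1 i) //= (bigD1 k) //= -addrA lerDl addr_ge0 // sumr_ge0 //.
Qed.

End SymmetricPower.

(** * The representation tau *)

Section Tau.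
Variables (R : realType) (F : fieldType) (v : normalized_valuation F) (p q : nat).
Hypothesis hF : local_field0 v p q.
Variable pi : Kunit F.
Hypothesis hpi : v (val pi) = 1.
Variables (E : closedFieldType) (iota : {rmorphism F -> E}) (absE : E -> R).
Hypotheses (habsE : nonarch_abs absE) (habsF : extends_abs v q iota absE).
Implicit Type r : R.

Definition up (b : F) : GL2 F := upper (1%g : Kunit F) b 1%g.
Definition dg (a : Kunit F) : GL2 F := upper a 0 1%g.

Lemma upper_entries (a : Kunit F) b d : (val (upper a b d) 0 0 = val a) *
  (val (upper a b d) 0 1 = b) * (val (upper a b d) 1 0 = 0) *
  (val (upper a b d) 1 1 = val d).
Proof. by rewrite !mxE. Qed.

Lemma det_mx2 (A : 'M[F]_2) : \det A = A 0 0 * A 1 1 - A 0 1 * A 1 0.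
Proof.
rewrite (expand_det_row _ 0) !big_ord_recl big_ord0 addr0 /cofactor !det_mx11 !mxE.
have lift1 : lift ord0 ord0 = 1 :> 'I_2 by apply: val_inj.
have lift0 : lift 1 ord0 = 0 :> 'I_2 by apply: val_inj.
by rewrite lift1 lift0 /= expr0 expr1 mul1r mulN1r mulrN.
Qed.

Lemma mx2P (A B : 'M[F]_2) : A 0 0 = B 0 0 -> A 0 1 = B 0 1 ->
  A 1 0 = B 1 0 -> A 1 1 = B 1 1 -> A = B.
Proof.
move=> h00 h01 h10 h11; apply/matrixP => i j.
have ord2 (k : 'I_2) : k = 0 \/ k = 1.
  by case: k => [[|[|k]]] // hk; [left|right]; apply: val_inj.
by case: (ord2 i) => ->; case: (ord2 j) => ->.
Qed.

Lemma mulmx2E (A B : 'M[F]_2) i j : (A *m B) i j = A i 0 * B 0 j + A i 1 * B 1 j.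
Proof.
rewrite !mxE !big_ord_recl big_ord0 addr0; congr (_ + A i _ * B _ j); exact: val_inj.
Qed.

Lemma upperM (a a' d d' : Kunit F) b b' : (upper a b d * upper a' b' d')%g =
  upper (a * a')%g (val a * b' + b * val d') (d * d')%g.
Proof.
apply: val_inj; apply: mx2P; rewrite [LHS]mulmx2E !upper_entries /=; ring.
Qed.

Lemma upD b b' : up (b + b') = (up b * up b')%g.
Proof. by rewrite upperM mulg1 /= mul1r mulr1 addrC. Qed.

Lemma dgM a a' : dg (a * a')%g = (dg a * dg a')%g.
Proof. by rewrite upperM mulg1 /= mulr0 mul0r addr0. Qed.

Lemma dg_up a b : (dg a * up b)%g = (up (val a * b) * dg a)%g.
Proof. by rewrite !upperM !mulg1 mul1g /= mulr0 mul0r addr0 add0r mulr1. Qed.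

Lemma upper_up_dg a b : upper a b 1%g = (up b * dg a)%g.
Proof. by rewrite upperM mul1g mulg1 /= mul1r mulr1 add0r. Qed.

Lemma up0 : up 0 = 1%g.
Proof. by apply: val_inj; apply: mx2P; rewrite !upper_entries /= mxE. Qed.

Lemma dg1 : dg 1%g = 1%g. Proof. exact: up0. Qed.

Definition ppow (l : int) : Kunit F := KUnit (expfz_neq0 l (valP pi)).

Lemma val_ppow l : val (ppow l) = val pi ^ l. Proof. by []. Qed.

Lemma ppowD k l : ppow (k + l) = (ppow k * ppow l)%g.
Proof. by apply: val_inj; rewrite /= expfzDr // (valP pi). Qed.

Lemma nval_ppow l : v (val (ppow l)) = l.
Proof. by rewrite val_ppow nvalXz ?(valP pi) // hpi mul1r. Qed.

Lemma ppow0 : ppow 0 = 1%g. Proof. exact: val_inj. Qed.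

Lemma ppow1 : ppow 1 = pi. Proof. by apply: val_inj; rewrite /= expr1z. Qed.

Lemma unit_part (x : Kunit F) :
  exists2 u : Kunit F, val u \in val_unit v & x = (ppow (v (val x)) * u)%g.
Proof.
exists ((ppow (v (val x)))^-1 * x)%g; last by rewrite mulgA mulgV mul1g.
rewrite val_unitE /= mulf_neq0 ?(valP x) ?invr_eq0 ?expfz_neq0 ?(valP pi) //=.
rewrite nvalM ?nvalV ?invr_eq0 ?expfz_neq0 ?(valP pi) ?(valP x) // nvalXz ?(valP pi) // hpi mul1r; exact/eqP/(addNr (v (val x))).
Qed.

Lemma residue_card_gt1 : (1 < q)%N.
Proof.
have [rs [szrs rsO rsinj rsP]] := residue_system_exists hF.
have [r0 r0s r0P] := rsP _ (OF0 v); have [r1 r1s r1P] := rsP _ (OF1 v).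
have r01 : r0 != r1.
  apply: contraTneq (val_unit1 v) => r01; rewrite -OF_pow1 ?OF1 //.
  have -> : 1 = (1 - r1) - (0 - r0) :> F by rewrite r01; ring.
  exact: rpredB.
rewrite -szrs; move: r0s r1s r01; case: (rs) => [|a [|b s]] //.
by rewrite !inE => /eqP-> /eqP->; rewrite eqxx.
Qed.

Lemma card_neq0 : (q%:R : E) != 0.
Proof.
have ch : [pchar E] =i pred0 by move=> x; rewrite (fmorph_pchar iota) (lf_char0 hF).
by rewrite ((pcharf0P _).1 ch) -lt0n (ltn_trans _ residue_card_gt1).
Qed.

Lemma absE_card_gt0 : 0 < absE q%:R. Proof. by rewrite absE_gt0 // card_neq0. Qed.

Lemma absE_iota_OF x : x \in OF v -> absE (iota x) <= 1.
Proof.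
rewrite OFE pow_idealE; have [->|x0] /= := eqVneq x 0; first by rewrite rmorph0 absE0.
move=> vx; rewrite habsF // -invr_expz invf_le1 ?exprz_gt0 ?ltr0n ?(ltn_trans _ residue_card_gt1) //.
by case: (v x) vx => // k _; rewrite -exprnP exprn_ege1 // ler1n ltnW ?residue_card_gt1.
Qed.

Lemma absE_iota_unit x : x \in val_unit v -> absE (iota x) = 1.
Proof. by rewrite val_unitE => /andP[x0 /eqP vx]; rewrite habsF // vx oppr0 expr0z. Qed.

Lemma iota_pi_neq0 : iota (val pi) != 0.
Proof. by rewrite fmorph_eq0 (valP pi). Qed.

Lemma absE_iota_pi : absE (iota (val pi)) = (q%:R)^-1.
Proof. by rewrite habsF ?(valP pi) // hpi -invr_expz expr1z. Qed.

(** A real radius need not be a value of [absE]. Enlarging it to one, by a negative power of the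
    uniformizer, is what turns balls into lattices at the end. *)
Lemma absE_unbounded r : exists2 c, c != 0 & r <= absE c.
Proof.
have q1 := residue_card_gt1; exists ((iota (val pi)) ^- Num.bound r).
  by rewrite invr_eq0 expf_neq0 // iota_pi_neq0.
rewrite absEV // absEX // absE_iota_pi exprVn invrK -natrX.
have [r0|r0] := lerP 0 r; last by rewrite (le_trans (ltW r0)).
apply/ltW/(lt_le_trans (archi_boundP r0)); rewrite ler_nat.
exact/ltnW/ltn_expl.
Qed.

Variables (m : int) (n : nat).
Local Notation tau := (tau iota m (n := n)).

Lemma tauP g c u w : tau g (c *: u + w) = c *: tau g u + tau g w.
Proof. by rewrite /Defs.tau symnP scalerDr !scalerA mulrC. Qed.

Lemma tau0 g : tau g 0 = 0.
Proof. by have := tauP g (-1) 0 0; rewrite addr0 scaler0 scaleN1r addNr. Qed.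

Lemma tauZ g c u : tau g (c *: u) = c *: tau g u.
Proof. by rewrite -[c *: u]addr0 tauP tau0 addr0. Qed.

Lemma tauD g u w : tau g (u + w) = tau g u + tau g w.
Proof. by rewrite -[u]scale1r tauP !scale1r. Qed.

Lemma tau_sum (I : Type) g (s : seq I) (P : pred I) (G : I -> 'rV[E]_n.+1) :
  tau g (\sum_(i <- s | P i) G i) = \sum_(i <- s | P i) tau g (G i).
Proof. by apply: (big_morph (tau g) (tauD g) (tau0 g)). Qed.

Lemma tauM g h u : tau (g * h)%g u = tau g (tau h u).
Proof.
rewrite tauZ /Defs.tau /= map_mxM symnM scalerA det_mulmx rmorphM.
by rewrite expfzMl mulrC.
Qed.

Lemma tau1 u : tau 1%g u = u.
Proof. by rewrite /Defs.tau /= det1 rmorph1 exp1rz scale1r map_mx1 symn1. Qed.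

Lemma tauKV g u : tau g^-1%g (tau g u) = u.
Proof. by rewrite -tauM mulVg tau1. Qed.

Lemma tau_eq0 g u : tau g u = 0 -> u = 0.
Proof. by move=> h; rewrite -[u](tauKV g) h tau0. Qed.

Lemma tau_ball g u r : 0 <= r -> \det (val g) \in val_unit v ->
  (forall i j, val g i j \in OF v) -> ball absE r u -> ball absE r (tau g u).
Proof.
move=> r0 detg gO ur.
have -> : r = absE (iota (\det (val g)) ^ m) * r.
  by rewrite absEXz // absE_iota_unit // exp1rz mul1r.
apply: ballZ => //; apply: symn_ball => // i j.
by rewrite mxE absE_iota_OF.
Qed.

Lemma tau_upper_ball (a d : Kunit F) b u r : 0 <= r -> val a \in val_unit v ->
  val d \in val_unit v -> b \in OF v -> ball absE r u ->
  ball absE r (tau (upper a b d) u).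
Proof.
move=> r0 aU dU bO; apply: tau_ball => //.
  by rewrite det_mx2 !upper_entries mulr0 subr0 val_unitM.
move=> i j; rewrite mxE; do 2?case: ifP => _ //; rewrite ?OF0 ?val_unit_OF //.
Qed.

Lemma tau_up_ball b u r : 0 <= r -> b \in OF v -> ball absE r u ->
  ball absE r (tau (up b) u).
Proof. by move=> r0 bO; apply: tau_upper_ball; rewrite ?val_unit1. Qed.

Lemma tau_bounded g : exists2 K : R, 0 <= K & forall r u, 0 <= r ->
  ball absE r u -> ball absE (K * r) (tau g u).
Proof.
have [K K0 KP] := symn_bounded n habsE (map_mx iota (val g)).
exists (absE (iota (\det (val g)) ^ m) * K) => [|r u r0 ur].
  by rewrite mulr_ge0 // (abs_ge0 habsE).
by rewrite -mulrA; apply: ballZ => //; apply: KP.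
Qed.

Lemma tau_dgE a u k : tau (dg a) u 0 k = iota (val a) ^ m * (iota (val a) ^+ k * u 0 k).
Proof.
rewrite mxE det_mx2 !upper_entries mulr1 mul0r subr0; congr (_ * _).
by rewrite symn_dg !mxE /= ?rmorph0 ?rmorph1.
Qed.

(** The coordinate of index [k] is scaled by pi^(m+k), and the worst index is 0. *)
Lemma tau_dg_pi_ball u r : 0 <= r -> ball absE r u ->
  ball absE (absE (iota (val pi) ^ m) * r) (tau (dg pi) u).
Proof.
move=> r0 ur k; rewrite tau_dgE absM // ler_wpM2l ?(abs_ge0 habsE) //.
rewrite absM // -[r]mul1r ler_pM ?(abs_ge0 habsE) // absEX //.
rewrite exprn_ile1 ?(abs_ge0 habsE) // absE_iota_OF // OFE pow_idealE hpi.
by rewrite ler01 orbT.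
Qed.

(* The top coordinate of tau (up b) u is a polynomial of degree n in b; its values at the
   q residues are controlled by the hypothesis, and n < q. *)
Lemma tau_dg_pi_contract u r : (n < q)%N -> 0 <= r ->
  (forall y, y \in OF v -> ball absE r (tau (up (y / val pi)) u)) ->
  ball absE (absE (iota (val pi) ^+ n) * (absE (iota (val pi) ^ m) * r)) (tau (dg pi) u).
Proof.
move=> nq r0 ur; set w := iota (val pi).
have w0 : w != 0 by apply: iota_pi_neq0.
have [rs [szrs rsO rsinj _]] := residue_system_exists hF.
(* Scaled so that its value at [y] is pi^n times the top coordinate of [tau (up (y / pi)) u]. Its
   coefficient of degree [n - k] is [u 0 k * w ^+ k], which is coordinate [k] of [tau (dg pi) u] up
   to the factor pi^m. *)
pose P : {poly E} := \sum_(i < n.+1) (u 0 i * w ^+ i) *: 'X^(n - i).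
have Peval y : P.[iota y] = w ^+ n * tau (up (y / val pi)) u 0 ord_max.
  rewrite mxE det_mx2 !upper_entries mulr1 mulr0 subr0 rmorph1 exp1rz mul1r.
  rewrite symn_up_top; try by rewrite mxE upper_entries ?rmorph1 ?rmorph0.
  rewrite horner_sum mulr_sumr; apply: eq_bigr => i _.
  rewrite hornerZ hornerXn mxE upper_entries fmorph_div exprMn exprVn.
  have -> : w ^+ n = w ^+ (n - i) * w ^+ i by rewrite -exprD subnK ?leq_ord.
  by rewrite -/w; field; rewrite expf_neq0.
have Pball : poly_ball absE (absE (w ^+ n) * r) P.
  apply: (interpolation_ball habsE (xs := map iota rs)) => //.
  - by rewrite mulr_ge0 // (abs_ge0 habsE).
  - by move=> _ /mapP[y yrs ->]; apply: absE_iota_OF; apply: rsO.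
  - apply/(pairwiseP 0) => i j; rewrite !inE size_map szrs => iq jq ij.
    rewrite !(nth_map 0) ?szrs // -rmorphB absE_iota_unit //.
    have : rs`_j - rs`_i \notin pow_ideal v 1.
      by apply/negP => /(rsinj _ _ jq iq) ji; rewrite ji ltnn in ij.
    by rewrite OF_pow1 ?negbK // OFD ?OFN ?rsO ?mem_nth ?szrs.
  - move=> _ /mapP[y yrs ->]; rewrite Peval absM // ler_wpM2l ?(abs_ge0 habsE) //.
    exact/ur/rsO.
  - rewrite size_map szrs (leq_trans _ nq) //; apply: (leq_trans (size_sum _ _ _)).
    apply/bigmax_leqP => i _; rewrite (leq_trans (size_scale_leq _ _)) //.
    by rewrite size_polyXn ltnS leq_subr.
move=> k; rewrite tau_dgE absM // mulrCA ler_wpM2l ?(abs_ge0 habsE) //.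
have := Pball (n - k)%N; rewrite coef_sum (bigD1 k) //= big1 => [|i ik].
  by rewrite addr0 coefZ coefXn eqxx mulr1 mulrC.
rewrite coefZ coefXn eqn_sub2lE ?leq_ord //; case: eqP => [/val_inj ki|]; last by rewrite mulr0.
by rewrite ki eqxx in ik.
Qed.

End Tau.

Lemma sum_pred1_seq (I : eqType) (W : nmodType) (r : seq I) (j : I) (G : I -> W) :
  uniq r -> j \in r -> \sum_(i <- r | i == j) G i = G j.
Proof.
move=> ur jr; rewrite big_mkcond (bigD1_seq j) //= eqxx big1 ?addr0 // => i.
by move/negPf->.
Qed.

(** * Expansions in additive characters *)

Section TwistedSpan.
Variables (R : realType) (F : fieldType) (v : normalized_valuation F) (p q : nat).
Hypothesis hF : local_field0 v p q.
Variable pi : Kunit F.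
Hypothesis hpi : v (val pi) = 1.
Variables (E : closedFieldType) (iota : {rmorphism F -> E}) (absE : E -> R).
Hypotheses (habsE : nonarch_abs absE) (habsF : extends_abs v q iota absE).
Variable psi : F -> E.
Hypothesis hpsi : self_dual_char v psi.
Implicit Types (r s : R) (b y u : F).

Lemma psi0 : psi 0 = 1.
Proof.
by apply: (mulfI (ac_neq0 hpsi 0)); rewrite -(ac_add hpsi) addr0 mulr1.
Qed.

Lemma psi_OF y : y \in OF v -> psi y = 1.
Proof. by move=> /(ac_annihilator hpsi)/(_ 1 (OF1 v)); rewrite mulr1. Qed.

Lemma psi_congr y y' : y - y' \in OF v -> psi y = psi y'.
Proof. by move=> yy'; rewrite -(subrK y' y) (ac_add hpsi) psi_OF ?mul1r. Qed.

Definition cls (x : F) : Wquot v := (\pi_(Wquot v) x)%qT.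

Lemma cls_eq x y : cls x = cls y <-> x - y \in OF v.
Proof.
rewrite /cls; split=> [/eqP|h]; first by rewrite eqmodE.
by apply/eqP; rewrite eqmodE.
Qed.

Lemma repr_cls x : repr (cls x) - x \in OF v.
Proof. by apply/cls_eq; rewrite /cls reprK. Qed.

Lemma cls_repr (beta : Wquot v) : cls (repr beta) = beta.
Proof. exact: reprK. Qed.

(** Dedekind's argument. Self-duality of [psi] separates distinct classes by some [y] in O_F;
    comparing the relation at [y + u] with a multiple of the relation at [u] removes the term of
    [b0]. *)
Lemma psi_independent (V : lmodType E) (B : seq (Wquot v)) (C : Wquot v -> V) :
  uniq B ->
  (forall u, u \in OF v -> \sum_(beta <- B) psi (repr beta * u) *: C beta = 0) ->
  forall beta, beta \in B -> C beta = 0.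
Proof.
elim: B C => // b0 B IHB C /= /andP[b0B uB] sum0.
have CB beta : beta \in B -> C beta = 0.
  move=> bB; have [y yO psi_y] : exists2 y, y \in OF v & psi (repr beta * y) != psi (repr b0 * y).
    have beta_b0 : beta != b0 by apply: contraNneq b0B => <-.
    apply: contrapT => no_y; case/eqP: beta_b0.
    rewrite -(cls_repr beta) -(cls_repr b0); apply/cls_eq/(ac_annihilator hpsi) => y yO.
    have [//|psi_y] := eqVneq (psi (repr beta * y)) (psi (repr b0 * y)); last first.
      by case: no_y; exists y.
    move=> psi_y; apply: (mulIf (ac_neq0 hpsi (repr b0 * y))).
    by rewrite mulrBl -(ac_add hpsi) subrK psi_y mul1r.
  pose C' g := (psi (repr g * y) - psi (repr b0 * y)) *: C g.
  suff sum0' u : u \in OF v -> \sum_(g <- B) psi (repr g * u) *: C' g = 0.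
    have /eqP := IHB C' uB sum0' _ bB.
    by rewrite scaler_eq0 subr_eq0 (negPf psi_y) => /eqP.
  move=> uO; have := sum0 _ (OFD yO uO); have := sum0 _ uO; rewrite !big_cons.
  move=> /(congr1 (fun w => psi (repr b0 * y) *: w)).
  rewrite scaler0 scalerDr scalerA -(ac_add hpsi) -mulrDr => h1 h2.
  have := congr2 (fun x z => x - z) h2 h1.
  rewrite subrr opprD addrACA subrr add0r scaler_sumr -sumrB => h3; apply: etrans h3.
  apply: eq_bigr => g _; rewrite scalerA -scalerBl scalerA; congr (_ *: _).
  by rewrite [repr g * (_ + _)]mulrDr (ac_add hpsi); ring.
move=> beta; rewrite inE => /orP[/eqP->|]; last exact: CB.
have := sum0 0 (OF0 v); rewrite big_cons mulr0 psi0 scale1r big1_seq ?addr0 // => g /andP[_ gB].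
by rewrite CB ?scaler0.
Qed.

Variables (m : int) (n : nat).
Local Notation tau := (tau iota m (n := n)).
Local Notation V := 'rV[E]_n.+1.

(* The functions on O_F with an expansion in which the coefficient of psi_b lies in the lattice
   tau(up b) M, M being the ball of radius r; this lattice only depends on b modulo O_F. *)
Definition twisted_span r (f : F -> V) := exists2 s : seq (F * V),
  forall d, d \in s -> ball absE r (tau (up (- d.1)) d.2) &
  forall u, u \in OF v -> f u = \sum_(d <- s) psi (d.1 * u) *: d.2.

(** On O_F the result involves only the values of [f] on pi O_F, so [f] may be altered on the units
    without changing it there. *)
Definition shift (f : F -> V) : F -> V := fun u => tau (dg pi) (f (val pi * u)).

Lemma val_pi_OF : val pi \in OF v.
Proof. by rewrite OFE pow_idealE hpi ler01 orbT. Qed.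

Lemma twisted_span_ext r f g : (forall u, u \in OF v -> f u = g u) ->
  twisted_span r f -> twisted_span r g.
Proof. by move=> fg [s sr fE]; exists s => // u uO; rewrite -fg // fE. Qed.

Lemma twisted_span_le r r' f : r <= r' -> twisted_span r f -> twisted_span r' f.
Proof. by move=> rr' [s sr fE]; exists s => // d /sr; apply: ball_le. Qed.

Lemma twisted_spanD r f g : twisted_span r f -> twisted_span r g ->
  twisted_span r (fun u => f u + g u).
Proof.
move=> [s sr fE] [t tr gE]; exists (s ++ t) => [d|u uO].
  by rewrite mem_cat => /orP[/sr|/tr].
by rewrite big_cat fE // gE.
Qed.

Lemma twisted_span0 r : twisted_span r (fun=> 0).
Proof. by exists [::] => // u _; rewrite big_nil. Qed.

Lemma twisted_spanZ r c f : twisted_span r f ->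
  twisted_span (absE c * r) (fun u => c *: f u).
Proof.
move=> [s sr fE]; exists [seq (d.1, c *: d.2) | d <- s] => [_ /mapP[d ds ->]|u uO].
  by rewrite /= tauZ; apply: ballZ => //; apply: sr.
rewrite fE // big_map scaler_sumr; apply: eq_bigr => d _.
by rewrite !scalerA mulrC.
Qed.

Lemma twisted_spanZ_le r r' c f : absE c * r <= r' -> twisted_span r f ->
  twisted_span r' (fun u => c *: f u).
Proof. by move=> le_r /(twisted_spanZ c); apply: twisted_span_le. Qed.

Lemma tau_up_shift b (w : V) : tau (up (- (val pi * b))) (tau (dg pi) w) =
  tau (dg pi) (tau (up (- b)) w).
Proof. by rewrite -!tauM dg_up mulrN. Qed.

Lemma twisted_span_shift r f : 0 <= r -> twisted_span r f ->
  twisted_span (absE (iota (val pi) ^ m) * r) (shift f).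
Proof.
move=> r0 [s sr fE]; exists [seq (val pi * d.1, tau (dg pi) d.2) | d <- s].
  move=> _ /mapP[d ds ->] /=; rewrite tau_up_shift.
  by apply: (tau_dg_pi_ball hF hpi) => //; apply: sr.
move=> u uO; rewrite /shift fE ?OFM ?val_pi_OF // tau_sum big_map.
by apply: eq_bigr => d _; rewrite tauZ mulrCA mulrA.
Qed.

Lemma ball_up_congr r b b' (w : V) : 0 <= r -> b - b' \in OF v ->
  ball absE r (tau (up (- b)) w) -> ball absE r (tau (up (- b')) w).
Proof.
move=> r0 bb' wr; have -> : - b' = (b - b') + - b by ring.
by rewrite upD tauM; apply: (tau_up_ball hF habsE habsF).
Qed.

(** Frequencies of the same class define the same function on O_F and the same lattice, so their
    coefficients can be added without leaving the ball. *)
Lemma twisted_span_normal r f : 0 <= r -> twisted_span r f ->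
  exists (B : seq (Wquot v)) (C : Wquot v -> V),
  [/\ uniq B, forall beta, beta \notin B -> C beta = 0,
      forall beta, ball absE r (tau (up (- repr beta)) (C beta)) &
      forall u, u \in OF v -> f u = \sum_(beta <- B) psi (repr beta * u) *: C beta].
Proof.
move=> r0 [s sr fE]; pose B := undup [seq cls d.1 | d <- s].
exists B, (fun beta => \sum_(d <- s | cls d.1 == beta) d.2); split.
- exact: undup_uniq.
- move=> beta; rewrite mem_undup => bs; rewrite big_seq_cond big1 // => d /andP[ds /eqP db].
  by case/negP: bs; rewrite -db; apply: (map_f (fun d => cls d.1)).
- move=> beta; rewrite tau_sum big_seq_cond; apply: ball_sum => // d /andP[ds /eqP <-].
  apply: ball_up_congr (sr _ ds) => //; rewrite -opprB OFN // repr_cls //.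
- move=> u uO; rewrite fE //.
  under [RHS]eq_bigr do rewrite scaler_sumr big_mkcond.
  rewrite exchange_big [LHS]big_seq [RHS]big_seq; apply: eq_bigr => d ds.
  rewrite -big_mkcond (eq_bigl (pred1 (cls d.1))) => [|beta]; last by rewrite eq_sym.
  have dB : cls d.1 \in B by rewrite mem_undup; apply: (map_f (fun d => cls d.1)).
  rewrite sum_pred1_seq ?undup_uniq //; congr (_ *: _).
  by apply: psi_congr; rewrite -mulrBl OFM // -opprB OFN // repr_cls.
Qed.

Lemma sum_support (B B' : seq (Wquot v)) (h : Wquot v -> V) : uniq B -> uniq B' ->
  {subset B <= B'} -> (forall beta, beta \notin B -> h beta = 0) ->
  \sum_(beta <- B') h beta = \sum_(beta <- B) h beta.
Proof.
move=> uB uB' BB' h0; rewrite (bigID (mem B)) /= [X in _ + X]big1 ?addr0; last by move=> ? /h0.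
rewrite -big_filter; apply/perm_big/uniq_perm; rewrite ?filter_uniq // => beta.
by rewrite mem_filter; case: (boolP (beta \in B)) => //= /BB'.
Qed.

(** * Coefficients of a function that vanishes on the units *)

Section Contraction.
Variables (B : seq (Wquot v)) (C : Wquot v -> V) (f : F -> V).
Hypotheses (uB : uniq B) (C0 : forall beta, beta \notin B -> C beta = 0).
Hypothesis fE : forall u, u \in OF v -> f u = \sum_(beta <- B) psi (repr beta * u) *: C beta.
Hypothesis f0 : forall u, u \in val_unit v -> f u = 0.

(* (psi_gamma - 1) f vanishes on O_F, since psi_gamma is trivial on pi O_F. *)
Lemma coef_translation (gamma : F) : val pi * gamma \in OF v ->
  forall beta, C (cls (repr beta - gamma)) = C beta.
Proof.
move=> pgO; pose sg (beta : Wquot v) := cls (repr beta - gamma).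
pose tg (beta : Wquot v) := cls (repr beta + gamma).
have sgK (beta : Wquot v) : sg (tg beta) = beta.
  rewrite -[RHS]cls_repr; apply/cls_eq.
  by rewrite -addrA -opprD [gamma + _]addrC repr_cls.
have sgVK (beta : Wquot v) : tg (sg beta) = beta.
  rewrite -[RHS]cls_repr; apply/cls_eq.
  by rewrite -addrA -[gamma - _]opprB repr_cls.
(* Contains the supports of both [C] and its translate, so that independence applies to their
   difference. *)
pose B' := undup (B ++ map tg B).
have BB' : {subset B <= B'} by move=> b bB; rewrite mem_undup mem_cat bB.
have vanish u : u \in OF v ->
    \sum_(beta <- B') psi (repr beta * u) *: (C (sg beta) - C beta) = 0.
  move=> uO; under eq_bigr do rewrite scalerBr.
  rewrite sumrB [X in _ - X](@sum_support B) ?undup_uniq //; last first.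
    by move=> beta /C0 ->; rewrite scaler0.
  rewrite -fE //.
  have -> : \sum_(beta <- B') psi (repr beta * u) *: C (sg beta) = psi (gamma * u) *: f u.
    rewrite fE // scaler_sumr.
    under [RHS]eq_bigr do rewrite scalerA.
    rewrite -(@sum_support B (map sg B')) //; first last.
    - by move=> beta /C0 ->; rewrite scaler0.
    - move=> beta bB; apply/mapP; exists (tg beta); last by rewrite sgK.
      by rewrite mem_undup mem_cat; apply/orP; right; apply: map_f.
    - rewrite map_inj_uniq ?undup_uniq //; exact: (can_inj sgVK).
    rewrite big_map; apply: eq_bigr => beta _; congr (_ *: _).
    rewrite -(ac_add hpsi) -mulrDl; apply: psi_congr; rewrite -mulrBl OFM //.
    have -> : repr beta - (gamma + repr (sg beta)) =
      - (repr (sg beta) - (repr beta - gamma)) by ring.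
    by rewrite OFN // repr_cls.
  have [uU|uU] := boolP (u \in val_unit v); first by rewrite f0 // scaler0 subrr.
  rewrite (psi_OF (_ : gamma * u \in OF v)) ?scale1r ?subrr //.
  have up : u / val pi \in OF v.
    move: uU; rewrite -OF_pow1 // OFE !pow_idealE mulf_eq0.
    have [//|u0] /= := eqVneq u 0; rewrite invr_eq0 (negPf (valP pi)) /=.
    by rewrite nvalM ?nvalV ?invr_eq0 ?(valP pi) // hpi subr_ge0.
  have -> : gamma * u = (val pi * gamma) * (u / val pi).
    by field; rewrite (valP pi).
  exact: OFM.
move=> beta; have [bB'|bB'] := boolP (beta \in B').
  by apply/eqP; rewrite -subr_eq0; apply/eqP; apply: (psi_independent (undup_uniq _) vanish bB').
rewrite !C0 //; first by apply: contra bB' => /BB'.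
apply: contra bB' => bB; rewrite mem_undup mem_cat; apply/orP; right.
by apply/mapP; exists (sg beta); rewrite // sgVK.
Qed.

(* The coefficients are constant along the q-element fibres of beta |-> pi beta, which
   produces the factor q. *)
Lemma shift_fibre_sum u : u \in OF v ->
  shift f u = \sum_(beta <- undup [seq cls (val pi * repr beta) | beta <- B])
     psi (repr beta * u) *: (q%:R *: tau (dg pi) (C (cls (repr beta / val pi)))).
Proof.
move=> uO; have p0 := valP pi; pose th (beta : Wquot v) := cls (val pi * repr beta).
rewrite /shift fE ?OFM ?val_pi_OF // tau_sum.
pose T := undup [seq th beta | beta <- B].
have -> : \sum_(beta <- B) tau (dg pi) (psi (repr beta * (val pi * u)) *: C beta) =
    \sum_(beta <- B) \sum_(t <- T | t == th beta)
       psi (repr t * u) *: tau (dg pi) (C (cls (repr t / val pi))).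
  rewrite big_seq [RHS]big_seq; apply: eq_bigr => beta bB.
  rewrite sum_pred1_seq ?undup_uniq ?mem_undup ?map_f // tauZ; congr (_ *: tau _ _).
    apply: psi_congr; rewrite mulrA -mulrBl OFM // -opprB OFN // [_ * val pi]mulrC.
    exact: repr_cls.
  (* [repr beta] and [repr (th beta) / pi] differ by an element of pi^-1 O_F, so [C] takes the same
     value at both. *)
  rewrite -(@coef_translation (repr beta - repr (th beta) / val pi)).
    by congr C; apply/cls_eq; rewrite subKr subrr OF0.
  rewrite mulrBr mulrCA divff // mulr1 -opprB OFN //; exact: repr_cls.
under eq_bigr do rewrite big_mkcond.
rewrite exchange_big -/T big_seq [RHS]big_seq; apply: eq_bigr => t tT.
rewrite -big_mkcond big_const_seq iter_addr_0 -scaler_nat scalerA [_ * psi _]mulrC -scalerA; congr (_ *: _).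
(* If the common coefficient on the fibre is nonzero, the whole fibre lies in [B], outside which [C]
   vanishes. The fibre consists of the classes of [repr ll + x / pi] for [x] in a residue system, so
   it is counted exactly q times. *)
set w := tau _ _; have [->|w0] := eqVneq w 0; first by rewrite !scaler0.
congr (_%:R *: _); set ll := cls (repr t / val pi).
have [rs rsS] := residue_system_exists hF; have [szrs rsO _ rsP] := rsS.
have Cll : C ll != 0 by apply: contra_neq w0; rewrite /w => ->; rewrite tau0.
rewrite -szrs -(size_map (fun x => cls (repr ll + x / val pi)) rs) -size_filter.
apply/perm_size/uniq_perm; first exact: filter_uniq.
  rewrite map_inj_in_uniq ?(residue_uniq rsS) // => x y xrs yrs /cls_eq.
  rewrite opprD addrACA subrr add0r -mulrBl => xy; apply: (residue_inj rsS) => //.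
  have := pow_idealM (k := 1) (l := 0) (x := val pi) _ xy.
  by rewrite addr0 mulrCA divff // mulr1; apply; rewrite pow_idealE hpi lexx orbT.
have thll : val pi * repr ll - repr t \in OF v.
  have := OFM val_pi_OF (repr_cls (repr t / val pi)).
  by rewrite mulrBr [_ * (_ / _)]mulrCA divff // mulr1.
move=> beta; rewrite mem_filter; apply/idP/idP => [/andP[/eqP tb bB]|/mapP[x xrs ->]].
  have dO : val pi * (repr beta - repr ll) \in OF v.
    have tb' : repr t - val pi * repr beta \in OF v by rewrite tb; apply: repr_cls.
    have -> : val pi * (repr beta - repr ll) =
      - ((val pi * repr ll - repr t) + (repr t - val pi * repr beta)) by ring.
    by rewrite OFN // OFD.
  have [x xrs xP] := rsP _ dO; apply/mapP; exists x => //.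
  rewrite -[LHS]cls_repr; apply/cls_eq.
  have -> : repr beta - (repr ll + x / val pi) =
    (val pi * (repr beta - repr ll) - x) * (val pi)^-1 by field; rewrite p0.
  have := pow_idealM (l := -1) xP; rewrite subrr; apply.
  by rewrite pow_idealE nvalV // hpi lexx orbT.
have xO := rsO _ xrs; set b := cls _; apply/andP; split.
  apply/eqP; rewrite -[LHS]cls_repr; apply/cls_eq.
  have -> : repr t - val pi * repr b =
    - ((val pi * repr ll - repr t) + val pi * (repr b - (repr ll + x / val pi)) + x).
    by field; rewrite p0.
  by rewrite OFN // OFD // OFD // OFM ?val_pi_OF // repr_cls.
apply: contraNT Cll => /C0 Cb; rewrite -Cb; apply/eqP.
rewrite -(@coef_translation (x / val pi) _ b); last by rewrite mulrCA divff // mulr1.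
congr C; rewrite -[LHS]cls_repr; apply/cls_eq.
have -> : repr ll - (repr b - x / val pi) = - (repr b - (repr ll + x / val pi)) by ring.
by rewrite OFN // repr_cls.
Qed.

End Contraction.

Lemma twisted_span_contract r f : (n < q)%N -> 0 <= r -> twisted_span r f ->
  (forall u, u \in val_unit v -> f u = 0) ->
  twisted_span (absE (q%:R * iota (val pi) ^+ n * iota (val pi) ^ m) * r) (shift f).
Proof.
move=> nq r0 fr f0; have [B [C [uB C0 Cr fE]]] := twisted_span_normal r0 fr.
pose T := undup [seq cls (val pi * repr beta) | beta <- B].
exists [seq (repr t, q%:R *: tau (dg pi) (C (cls (repr t / val pi)))) | t <- T].
  move=> _ /mapP[t _ ->] /=; rewrite tauZ !(absM habsE) -!mulrA; apply: ballZ => //.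
  set ll := cls _.
  apply: (@ball_up_congr _ (val pi * repr ll)).
  - by rewrite !mulr_ge0 ?(abs_ge0 habsE).
  - have := OFM val_pi_OF (repr_cls (repr t / val pi)).
    by rewrite mulrBr [_ * (_ / _)]mulrCA divff ?(valP pi) // mulr1.
  rewrite tau_up_shift; apply: (tau_dg_pi_contract hF) => // y yO.
  (* Constancy along the fibre puts this coefficient in the ball attached to [repr ll - y / pi] for
     every integral [y], which is the hypothesis of [tau_dg_pi_contract]. *)
  rewrite -tauM -upD -(@coef_translation B C f _ _ _ _ (y / val pi)) //; last first.
    by rewrite mulrCA divff ?(valP pi) // mulr1.
  have -> : y / val pi - repr ll = - (repr ll - y / val pi) by ring.
  by apply: ball_up_congr (Cr _) => //; apply: repr_cls.
by move=> u uO; rewrite (shift_fibre_sum uB C0 fE f0 uO) big_map.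
Qed.

End TwistedSpan.

(** * Fourier expansion of periodic functions *)

Section Fourier.
Variables (R : realType) (F : fieldType) (v : normalized_valuation F) (p q : nat).
Hypothesis hF : local_field0 v p q.
Variable pi : Kunit F.
Hypothesis hpi : v (val pi) = 1.
Variables (E : closedFieldType) (iota : {rmorphism F -> E}).
Variable psi : F -> E.
Hypothesis hpsi : self_dual_char v psi.
Implicit Types (x y u : F) (h : F -> E).

(** Injectivity modulo pi makes [th] permute the finitely many residue classes. It is applied to
    translations and to multiplication by a unit. *)
Lemma residue_reindex rs (th : F -> F) h : is_residue_system v q rs ->
  (forall x, x \in OF v -> th x \in OF v) ->
  (forall x y, x \in OF v -> y \in OF v ->
     th x - th y \in pow_ideal v 1 -> x - y \in pow_ideal v 1) ->
  (forall x y, x \in OF v -> y \in OF v -> x - y \in pow_ideal v 1 -> h x = h y) ->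
  \sum_(r <- rs) h (th r) = \sum_(r <- rs) h r.
Proof.
move=> rsS thO thI hc; have [szrs rsO _ rsP] := rsS.
pose red x := nth 0 rs (find (fun r => x - r \in pow_ideal v 1) rs).
have redP x : x \in OF v -> red x \in rs /\ x - red x \in pow_ideal v 1.
  move=> /rsP[r rrs xr].
  have hs : has (fun r => x - r \in pow_ideal v 1) rs by apply/hasP; exists r.
  by split; [rewrite mem_nth // -has_find | apply: (nth_find 0 hs)].
have -> : \sum_(r <- rs) h (th r) = \sum_(r <- map (red \o th) rs) h r.
  rewrite big_map big_seq [RHS]big_seq; apply: eq_bigr => r rrs.
  have [rr xr] := redP _ (thO _ (rsO _ rrs)).
  by apply: hc xr; [apply/thO/rsO | apply: rsO].
apply: perm_big; have uM : uniq (map (red \o th) rs).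
  rewrite map_inj_in_uniq ?(residue_uniq rsS) // => x y xrs yrs /= rxy.
  apply: (residue_inj rsS) => //; apply: thI; rewrite ?rsO //.
  have [_ hx] := redP _ (thO _ (rsO _ xrs)); have [_ hy] := redP _ (thO _ (rsO _ yrs)).
  by have := rpredB hx hy; rewrite rxy opprB addrA subrK.
have sM : {subset map (red \o th) rs <= rs}.
  by move=> _ /mapP[x xrs ->]; case: (redP _ (thO _ (rsO _ xrs))).
apply: uniq_perm => //; first exact: residue_uniq rsS.
by case: (uniq_min_size uM sM); rewrite ?size_map.
Qed.

Lemma div_pi_OF x : x \in pow_ideal v 1 -> x / val pi \in OF v.
Proof.
move=> x1; have := pow_idealM (l := -1) x1; rewrite subrr; apply.
by rewrite pow_idealE nvalV ?(valP pi) // hpi lexx orbT.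
Qed.

Lemma mul_pi_pow1 x : x \in OF v -> x * val pi \in pow_ideal v 1.
Proof.
move=> xO; have := pow_idealM (k := 0) (l := 1) xO; rewrite add0r; apply.
by rewrite pow_idealE hpi lexx orbT.
Qed.

Lemma psi_residue_congr a x y : a \in OF v -> x - y \in pow_ideal v 1 ->
  psi (x / val pi * a) = psi (y / val pi * a).
Proof.
by move=> aO xy; apply: (psi_congr hpsi); rewrite -mulrBl -mulrBl OFM // div_pi_OF.
Qed.

(** Orthogonality of characters: for a unit [u], self-duality gives an integral [y] with psi(y u /
    pi) different from 1, and translation by [y] multiplies the sum by that value. *)
Lemma psi_residue_sum rs u : is_residue_system v q rs -> u \in OF v ->
  \sum_(r <- rs) psi (r / val pi * u) = if u \in val_unit v then 0 else q%:R.
Proof.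
move=> rsS uO; have [szrs rsO _ _] := rsS; case: ifP => uU; last first.
  have upO : u / val pi \in OF v by apply: div_pi_OF; rewrite OF_pow1 ?uU.
  rewrite big_seq (eq_bigr (fun=> 1)) => [|r rrs]; last first.
    by rewrite mulrAC -mulrA (psi_OF hpsi) // OFM // rsO.
  by rewrite -big_seq big_const_seq iter_addr_0 count_predT szrs.
have [y yO psi_y] : exists2 y, y \in OF v & psi (y / val pi * u) != 1.
  apply: contrapT => no_y.
  have : u / val pi \in OF v.
    apply/(ac_annihilator hpsi) => y yO.
    have [<-|yN] := eqVneq (psi (y / val pi * u)) 1.
      by congr psi; ring.
    by case: no_y; exists y.
  move=> upO; have : u \in pow_ideal v 1.
    by rewrite -(divfK (valP pi) u) mul_pi_pow1.
  by rewrite OF_pow1 // uU.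
pose h x := psi (x / val pi * u).
have := @residue_reindex rs (fun x => x + y) h rsS.
set S := \sum_(r <- rs) h r => /(_ _ _ _)/esym hS.
have : S = psi (y / val pi * u) * S.
  rewrite {1}hS; first last.
  - by move=> a b _ _; apply: psi_residue_congr.
  - by move=> a b _ _; rewrite opprD addrACA subrr addr0.
  - by move=> a aO; rewrite OFD.
  by rewrite mulr_sumr; apply: eq_bigr => r _; rewrite /h !mulrDl (ac_add hpsi) mulrC.
move/eqP; rewrite -subr_eq0 -[X in X - _]mul1r -mulrBl mulf_eq0 subr_eq0 eq_sym.
by rewrite (negPf psi_y) => /eqP.
Qed.

Definition exp_span h := exists s : seq (F * E),
  forall u, u \in OF v -> h u = \sum_(d <- s) psi (d.1 * u) * d.2.

Lemma exp_span_sum (I : Type) (s : seq I) (G : I -> F -> E) :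
  (forall i, exp_span (G i)) -> exp_span (fun u => \sum_(i <- s) G i u).
Proof.
move=> Gs; elim: s => [|i s [t IHs]].
  by exists [::] => u _; rewrite !big_nil.
have [ti Hi] := Gs i; exists (ti ++ t) => u uO.
by rewrite big_cons big_cat Hi // IHs.
Qed.

Lemma exp_span_sum_seq (I : eqType) (s : seq I) (G : I -> F -> E) :
  (forall i, i \in s -> exp_span (G i)) -> exp_span (fun u => \sum_(i <- s) G i u).
Proof.
move=> Gs; have [t Ht] : exp_span (fun u => \sum_(i <- s) if i \in s then G i u else 0).
  apply: exp_span_sum => i; case: (boolP (i \in s)) => [/Gs//|_].
  by exists [::] => u _; rewrite big_nil.
exists t => u uO; rewrite -Ht // big_seq [RHS]big_seq.
by apply: eq_bigr => i ->.
Qed.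

Lemma exp_span_ext h h' : (forall u, u \in OF v -> h u = h' u) ->
  exp_span h -> exp_span h'.
Proof. by move=> hh' [s hs]; exists s => u uO; rewrite -hh' // hs. Qed.

Lemma exp_spanD h h' : exp_span h -> exp_span h' -> exp_span (fun u => h u + h' u).
Proof.
move=> [s hs] [t ht]; exists (s ++ t) => u uO; by rewrite big_cat hs // ht.
Qed.

Lemma exp_spanZ c h : exp_span h -> exp_span (fun u => c * h u).
Proof.
move=> [s hs]; exists [seq (d.1, d.2 * c) | d <- s] => u uO.
rewrite hs // big_map mulr_sumr; apply: eq_bigr => d _ /=; ring.
Qed.

Lemma exp_span_psi b : exp_span (fun u => psi (b * u)).
Proof. by exists [:: (b, 1)] => u _; rewrite big_seq1 mulr1. Qed.

Lemma indicator_pow1 rs x : is_residue_system v q rs -> x \in OF v ->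
  (x \in pow_ideal v 1)%:R = q%:R^-1 * \sum_(r <- rs) psi (r / val pi * x).
Proof.
move=> rsS xO; rewrite psi_residue_sum // OF_pow1 //; case: ifP => _ /=.
  by rewrite mulr0.
by rewrite mulVf // (card_neq0 hF iota).
Qed.

(* Induction on N: each residue class in O_F is a rescaled copy of O_F. *)
Lemma exp_span_periodic N h :
  (forall x y, x \in OF v -> y \in OF v -> x - y \in pow_ideal v N%:Z -> h x = h y) ->
  exp_span h.
Proof.
have [rs rsS] := residue_system_exists hF; have [_ rsO _ rsP] := rsS.
elim: N h => [|N IHN] h hN.
  exists [:: (0, h 0)] => u uO; rewrite big_seq1 mul0r (psi0 hpsi) mul1r.
  by apply: hN; rewrite ?OF0 // subr0.
have p0 := valP pi.
have piece r : r \in rs -> exists t : seq (F * E), forall x, x \in OF v ->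
    h (r + val pi * x) = \sum_(d <- t) psi (d.1 * x) * d.2.
  move=> rrs; apply: (IHN (fun x => h (r + val pi * x))) => x y xO yO xy.
  have rO a : a \in OF v -> r + val pi * a \in OF v.
    by move=> aO; apply: OFD (rsO _ rrs) (OFM (val_pi_OF hpi) aO).
  apply: hN; [exact: rO | exact: rO |].
  rewrite opprD addrACA subrr add0r -mulrBr intS.
  by apply: pow_idealM => //; rewrite pow_idealE hpi lexx orbT.
apply: (exp_span_ext (h := fun u => \sum_(r <- rs)
    (u - r \in pow_ideal v 1)%:R * h u)) => [u uO|].
  have [r rrs ur] := rsP _ uO.
  rewrite (bigD1_seq r) ?(residue_uniq rsS) //= ur mul1r big_seq_cond big1 ?addr0 //.
  move=> r' /andP[r'rs rr']; case: (boolP (u - r' \in _)) => [ur'|]; last by rewrite mul0r.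
  case/eqP: rr'; apply: (residue_inj rsS) => //.
  have -> : r' - r = (u - r) - (u - r') by ring.
  exact: rpredB.
apply: exp_span_sum_seq => r rrs; have [t tP] := piece r rrs.
(* On the class of [r], [h] is an exponential sum in (u - r) / pi. The indicator of the class is
   itself an average of exponentials of frequencies r' / pi, so the frequencies add and the constant
   phases come from [r]. *)
apply: (exp_span_ext (h := fun u => q%:R^-1 * \sum_(r' <- rs) \sum_(d <- t)
    psi ((r' / val pi + d.1 / val pi) * u) * (psi (- ((r' / val pi + d.1 / val pi) * r)) * d.2))) => [u uO|]; last first.
  apply/exp_spanZ/exp_span_sum => r'; apply: exp_span_sum => d.
  by apply: exp_span_ext (exp_spanZ _ (exp_span_psi (r' / val pi + d.1 / val pi))) => u _; rewrite mulrC.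
have urO : u - r \in OF v by rewrite OFD // OFN // rsO.
have -> : (u - r \in pow_ideal v 1)%:R * h u =
    (u - r \in pow_ideal v 1)%:R * \sum_(d <- t) psi (d.1 * ((u - r) / val pi)) * d.2.
  case: (boolP (_ \in _)) => ur; last by rewrite !mul0r.
  by rewrite -tP ?div_pi_OF // [val pi * _]mulrC divfK // addrC subrK.
rewrite (indicator_pow1 rsS) // -mulrA mulr_suml; congr (_ * _).
apply: eq_bigr => r' _; rewrite mulr_sumr; apply: eq_bigr => d _.
rewrite !mulrA -!(ac_add hpsi); congr (psi _ * _); field; exact: p0.
Qed.

End Fourier.

(** * Tame characters and Gauss sums *)

Section TameCharacters.
Variables (R : realType) (F : fieldType) (v : normalized_valuation F) (p q : nat).
Hypothesis hF : local_field0 v p q.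
Variable pi : Kunit F.
Hypothesis hpi : v (val pi) = 1.
Variables (E : closedFieldType) (iota : {rmorphism F -> E}) (absE : E -> R).
Hypotheses (habsE : nonarch_abs absE) (habsF : extends_abs v q iota absE).
Variable psi : F -> E.
Hypothesis hpsi : self_dual_char v psi.
Implicit Types (x y u : F) (e : F -> E) (r K : R).

(* Tame characters of the units, extended by zero to F. *)
Record tame_fun e : Prop := TameFun {
  tame_congr : forall x y, x \in OF v -> y \in OF v -> x - y \in pow_ideal v 1 -> e x = e y;
  tame_off : forall x, x \notin val_unit v -> e x = 0;
  tame_neq0 : forall x, x \in val_unit v -> e x != 0;
  tameM : forall x y, x \in val_unit v -> y \in val_unit v -> e (x * y) = e x * e y
}.

Lemma tame_fun_inv e : tame_fun e -> tame_fun (fun u => (e u)^-1).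
Proof.
case=> ec e0 en eM; split=> [x y xO yO xy|x xU|x xU|x y xU yU].
- by rewrite (ec x y).
- by rewrite e0 // invr0.
- by rewrite invr_eq0 en.
- by rewrite eM // invfM.
Qed.

Lemma tame1 e : tame_fun e -> e 1 = 1.
Proof.
move=> te; apply: (mulfI (tame_neq0 te (val_unit1 v))).
by rewrite -(tameM te) ?val_unit1 // !mulr1.
Qed.

Lemma tameX e u k : tame_fun e -> u \in val_unit v ->
  u ^+ k \in val_unit v /\ e (u ^+ k) = e u ^+ k.
Proof.
move=> te uU; elim: k => [|k [IHU IHk]]; first by rewrite !expr0 val_unit1 tame1.
by rewrite !exprS val_unitM // (tameM te) // IHk.
Qed.

(** On O_F a tame function takes at most q values, so two of the first q + 1 powers of [e u]
    coincide and [e u] is a root of unity. *)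
Lemma tame_abs e u : tame_fun e -> u \in val_unit v -> absE (e u) = 1.
Proof.
move=> te uU; have [rs [szrs rsO _ rsP]] := residue_system_exists hF.
pose s := [seq e u ^+ i | i <- seq.iota 0 q.+1].
have : ~~ uniq s.
  apply: contraTN isT => us; have : {subset s <= map e rs}.
    move=> _ /mapP[i _ ->]; have [uiU <-] := tameX i te uU.
    have [x xrs xu] := rsP _ (val_unit_OF uiU).
    by apply/mapP; exists x => //; apply: (tame_congr te (val_unit_OF uiU) (rsO _ xrs) xu).
  by move/(uniq_leq_size us); rewrite !size_map size_iota szrs ltnn.
case/(uniqPn 0) => i [j [ij]]; rewrite size_map size_iota => jq.
rewrite !(nth_map 0%N) ?size_iota ?(ltn_trans ij) // !nth_iota ?(ltn_trans ij) // !add0n.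
move/eqP; rewrite -(subnKC (ltnW ij)) exprD -{1}[_ ^+ i]mulr1.
have ei : e u ^+ i != 0 by rewrite expf_neq0 // (tame_neq0 te).
rewrite (inj_eq (mulfI ei)) eq_sym => /eqP.
by apply: (absE_root_of_unity habsE); rewrite subn_gt0.
Qed.

Lemma tame_expansion e rs u : tame_fun e -> is_residue_system v q rs -> u \in OF v ->
  e u = \sum_(r' <- rs) psi (r' / val pi * u) *
    (q%:R^-1 * \sum_(r <- rs) e r * psi (- (r' * r / val pi))).
Proof.
move=> te rsS uO; have [_ rsO _ rsP] := rsS.
have -> : e u = \sum_(r <- rs) (u - r \in pow_ideal v 1)%:R * e r.
  have [r rrs ur] := rsP _ uO.
  rewrite (bigD1_seq r) ?(residue_uniq rsS) //= ur mul1r big_seq_cond big1 ?addr0.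
    exact: (tame_congr te uO (rsO _ rrs) ur).
  move=> r' /andP[r'rs rr']; case: (boolP (u - r' \in _)) => [ur'|]; last by rewrite mul0r.
  case/eqP: rr'; apply: (residue_inj rsS) => //.
  have -> : r' - r = (u - r) - (u - r') by ring.
  exact: rpredB.
transitivity (\sum_(r <- rs) \sum_(r' <- rs) q%:R^-1 * (psi (r' / val pi * (u - r)) * e r)).
  rewrite big_seq [RHS]big_seq; apply: eq_bigr => r rrs.
  rewrite (indicator_pow1 hF hpi iota hpsi rsS); last by rewrite OFD // OFN // rsO.
  by rewrite -mulrA mulr_suml mulr_sumr.
rewrite exchange_big; apply: eq_bigr => r' _.
rewrite mulrCA mulr_sumr mulr_sumr; apply: eq_bigr => r _.
have -> : psi (r' / val pi * (u - r)) = psi (r' / val pi * u) * psi (- (r' * r / val pi)).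
  by rewrite -(ac_add hpsi); congr psi; ring.
ring.
Qed.

(** The Gauss sum of [e] against the additive character psi(-x / pi) of the residue field, divided
    by q. *)
Definition gauss_coef e rs := q%:R^-1 * \sum_(r <- rs) e r * psi (- (r / val pi)).

(** For a unit [x], substitute [x * r] in the Gauss sum. For a non-unit both sides vanish: the left
    because a nontrivial character sums to zero, the right because the inverse of 0 is 0. *)
Lemma gauss_coefM e rs x : tame_fun e -> is_residue_system v q rs ->
  (exists2 y, y \in val_unit v & e y != 1) -> x \in OF v ->
  q%:R^-1 * \sum_(r <- rs) e r * psi (- (x * r / val pi)) = (e x)^-1 * gauss_coef e rs.
Proof.
move=> te rsS [y yU ey] xO; have [_ rsO _ _] := rsS.
rewrite /gauss_coef [RHS]mulrCA; congr (_ * _).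
have [xU|xU] := boolP (x \in val_unit v); last first.
  rewrite (tame_off te xU) invr0 mul0r.
  have -> : \sum_(r <- rs) e r * psi (- (x * r / val pi)) = \sum_(r <- rs) e r.
    rewrite big_seq [RHS]big_seq; apply: eq_bigr => r rrs.
    rewrite (psi_OF hpsi) ?mulr1 // OFN // mulrAC.
    by apply: OFM (rsO _ rrs); apply: (div_pi_OF hpi); rewrite OF_pow1.
  have := @residue_reindex F v q E rs (fun r : F => y * r) e rsS.
  set S := \sum_(r <- rs) e r => /(_ _ _ (tame_congr te)) hS.
  have : S = e y * S.
    rewrite -{1}hS; first last.
    - by move=> a b aO bO; rewrite -mulrBr pow_ideal_mulu.
    - by move=> a aO; rewrite OFM // val_unit_OF.
    rewrite mulr_sumr big_seq [RHS]big_seq; apply: eq_bigr => r rrs.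
    have [rU|rU] := boolP (r \in val_unit v); first by rewrite (tameM te).
    have yrU : y * r \notin val_unit v.
      apply: contra rU => yrU.
      by rewrite -(mulKf (val_unit_neq0 yU) r) val_unitM ?val_unitV.
    by rewrite (tame_off te yrU) (tame_off te rU) mulr0.

  move/eqP; rewrite -subr_eq0 -[X in X - _]mul1r -mulrBl mulf_eq0 subr_eq0 eq_sym.
  by rewrite (negPf ey) => /eqP.
pose h z := e z * psi (- (z / val pi)).
have hc a b : a \in OF v -> b \in OF v -> a - b \in pow_ideal v 1 -> h a = h b.
  move=> aO bO ab; rewrite /h (tame_congr te aO bO ab); congr (_ * _).
  apply: (psi_congr hpsi); rewrite -opprD OFN // -mulrBl; exact: div_pi_OF.
have <- := @residue_reindex F v q E rs (fun r : F => x * r) h rsS _ _ hc; first last.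
- by move=> a b aO bO; rewrite -mulrBr pow_ideal_mulu.
- by move=> a aO; rewrite OFM.
rewrite mulr_sumr; apply: eq_bigr => r _; rewrite /h.
have [rU|rU] := boolP (r \in val_unit v).
  by rewrite (tameM te) // mulrA mulKf // (tame_neq0 te).
have xrU : x * r \notin val_unit v.
  apply: contra rU => xrU.
  by rewrite -(mulKf (val_unit_neq0 xU) r) val_unitM ?val_unitV.
by rewrite (tame_off te xrU) (tame_off te rU) !mul0r mulr0.
Qed.

Lemma gauss_coef_expansion e rs u : tame_fun e -> is_residue_system v q rs ->
  (exists2 y, y \in val_unit v & e y != 1) -> u \in OF v ->
  e u = \sum_(r' <- rs) psi (r' / val pi * u) * ((e r')^-1 * gauss_coef e rs).
Proof.
move=> te rsS nt uO; rewrite (tame_expansion te rsS uO) big_seq [RHS]big_seq.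
by apply: eq_bigr => r' r'rs; rewrite gauss_coefM //; case: rsS => _ ->.
Qed.

(* Evaluate the expansion of e at -1. *)
Lemma gauss_coef_mul e rs : tame_fun e -> is_residue_system v q rs ->
  (exists2 y, y \in val_unit v & e y != 1) ->
  absE (gauss_coef e rs) * absE (gauss_coef (fun u => (e u)^-1) rs) = (absE q%:R)^-1.
Proof.
move=> te rsS nt; have N1U := val_unitN (val_unit1 v).
have q0 := card_neq0 hF iota.
have := gauss_coef_expansion te rsS nt (val_unit_OF N1U).
have -> : \sum_(r' <- rs) psi (r' / val pi * -1) * ((e r')^-1 * gauss_coef e rs) =
    gauss_coef e rs * (q%:R * gauss_coef (fun u => (e u)^-1) rs).
  move: (gauss_coef e rs) => g; rewrite /gauss_coef mulVKf // mulr_sumr.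
  by apply: eq_bigr => r' _; rewrite mulrN1; ring.
move/(congr1 absE); rewrite (tame_abs te N1U) !(absM habsE) => h.
have q1 := absE_card_gt0 hF iota habsE.
apply: (mulfI (lt0r_neq0 q1)); rewrite divff ?lt0r_neq0 // [RHS]h; ring.
Qed.

Variables (m : int) (n : nat).
Local Notation tau := (tau iota m (n := n)).
Local Notation V := 'rV[E]_n.+1.
Local Notation twisted_span := (twisted_span v iota absE psi m (n := n)).

Lemma twisted_span_mul (h : F -> E) (s : seq (F * E)) K r (f : F -> V) :
  (forall u, u \in OF v -> h u = \sum_(d <- s) psi (d.1 * u) * d.2) ->
  (forall d w, d \in s -> ball absE r w -> ball absE (K * r) (d.2 *: tau (up (- d.1)) w)) ->
  twisted_span r f -> twisted_span (K * r) (fun u => h u *: f u).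
Proof.
move=> hs sK [t tr fE].
exists [seq (d.1 + c.1, d.2 *: c.2) | d <- s, c <- t] => [_ /allpairsP[[d c] [ds ct ->]] /=|u uO].
  by rewrite tauZ opprD upD tauM; apply: sK => //; apply: tr.
rewrite hs // fE // scaler_suml big_allpairs_dep; apply: eq_bigr => d _.
rewrite scaler_sumr; apply: eq_bigr => c _ /=.
by rewrite mulrDl (ac_add hpsi) !scalerA; congr (_ *: _); ring.
Qed.

(** The constant depends on [h] alone and may be large. This is affordable for a single
    multiplication, but not at every step of an induction. *)
Lemma twisted_span_mul_exp h : exp_span v psi h -> exists2 K : R, 0 <= K & forall r f,
  0 <= r -> twisted_span r f -> twisted_span (K * r) (fun u => h u *: f u).
Proof.
case=> s hs.
have [K K0 KP] : exists2 K : R, 0 <= K & forall r d w, 0 <= r -> d \in s ->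
    ball absE r w -> ball absE (K * r) (d.2 *: tau (up (- d.1)) w).
  elim: s {hs} => [|d s [K K0 KP]]; first by exists 0.
  have [Kd Kd0 KdP] := tau_bounded iota habsE m n (up (- d.1)).
  exists (absE d.2 * Kd + K) => [|r c w r0]; first by rewrite addr_ge0 ?mulr_ge0 ?(abs_ge0 habsE).
  rewrite inE => /orP[/eqP->|cs] wr.
    apply: (@ball_le _ _ absE _ (absE d.2 * (Kd * r))); last by apply: ballZ => //; apply: KdP.
    by rewrite mulrA ler_wpM2r // lerDl.
  apply: ball_le (KP _ _ _ r0 cs wr).
  by rewrite ler_wpM2r // lerDr mulr_ge0 ?(abs_ge0 habsE).
by exists K => // r f r0; apply: twisted_span_mul hs _ => d w ds; apply: KP.
Qed.

Lemma twisted_span_tame e : tame_fun e -> exists2 K : R, 0 <= K & forall r f,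
  0 <= r -> twisted_span r f -> twisted_span (K * r) (fun u => e u *: f u).
Proof.
move=> te; apply: twisted_span_mul_exp.
by apply: (exp_span_periodic hF hpi iota hpsi (N := 1)); apply: tame_congr.
Qed.

End TameCharacters.

(** * Multiplication by a tame character in degree zero *)

Section GaussBound.
Variables (R : realType) (F : fieldType) (v : normalized_valuation F) (p q : nat).
Hypothesis hF : local_field0 v p q.
Variable pi : Kunit F.
Hypothesis hpi : v (val pi) = 1.
Variables (E : closedFieldType) (iota : {rmorphism F -> E}) (absE : E -> R).
Hypotheses (habsE : nonarch_abs absE) (habsF : extends_abs v q iota absE).
Variable psi : F -> E.
Hypothesis hpsi : self_dual_char v psi.
Variable m : int.
Local Notation twisted_span := (twisted_span v iota absE psi m (n := 0)).

Lemma tau_up_Sym0 b (w : 'rV[E]_1) : tau iota m (up b) w = w.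
Proof.
apply/rowP => k; have -> : k = ord_max by rewrite [k]ord1 [ord_max]ord1.
rewrite mxE det_mx2 !upper_entries mulr1 mulr0 subr0 rmorph1 exp1rz mul1r symn_up_top; try by rewrite !mxE /= ?rmorph1 ?rmorph0.
by rewrite big_ord1 expr0 mulr1 [ord_max]ord1 [ord0]ord1.
Qed.

(** For n = 0 unipotent matrices act trivially, so the cost is the largest Fourier coefficient of
    [e]. Each of these is zero or a root of unity times the Gauss sum. *)
Lemma twisted_span_gauss e rs r f : tame_fun v e -> is_residue_system v q rs ->
  (exists2 y, y \in val_unit v & e y != 1) -> twisted_span r f ->
  twisted_span (absE (gauss_coef q pi psi e rs) * r) (fun u => e u *: f u).
Proof.
move=> te rsS nt; apply: (twisted_span_mul hpsi (s := [seq (x / val pi,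
   (e x)^-1 * gauss_coef q pi psi e rs) | x <- rs])) => [u uO|_ w /mapP[x xrs ->] /=].
  by rewrite big_map (gauss_coef_expansion hF hpi iota hpsi te rsS nt uO).
rewrite tau_up_Sym0 => wr.
have := ballZ habsE ((e x)^-1 * gauss_coef q pi psi e rs) wr.
rewrite (absM habsE); have [xU|xU] := boolP (x \in val_unit v).
  by rewrite (absEV habsE) (tame_abs hF habsE te xU) invr1 mul1r.
rewrite (tame_off te xU) invr0 (absE0 habsE) !mul0r scale0r => zr i.
by apply: le_trans (zr i) _; rewrite mulr_ge0 ?(abs_ge0 habsE) // (le_trans _ (wr i)) ?(abs_ge0 habsE).
Qed.

End GaussBound.

(** * The Kirillov model *)

Section CompactSupport.
Variables (F : fieldType) (v : normalized_valuation F) (E : fieldType).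

(** Finitely many balls of constancy cover the compact set, and the largest of their exponents
    serves for any pair of points one of which lies in it; elsewhere both values are 0. *)
Lemma Cc_infty_uniform (f : F -> E) : Cc_infty v f ->
  exists N : nat, forall x y, x - y \in pow_ideal v N%:Z -> f x = f y.
Proof.
case=> f_lc [A cA fA]; have [k kP] := choice f_lc.
pose U x := [set y | y - x \in pow_ideal v (k x)].
have U_open x : vopen v (U x).
  move=> y /= yx; exists (k x) => z zy /=.
  by have := rpredD zy yx; rewrite addrA subrK.
have U_self x : U x x by rewrite /U /= subrr (rpred0 (pow_ideal v _)).
have AU : A `<=` \bigcup_i U i by move=> x _; exists x; last exact: U_self.
have [s sP] := cA F U U_open AU.
pose N := \max_(x <- s) `|k x|%N; exists N.
have main x y : A x -> x - y \in pow_ideal v N%:Z -> f x = f y.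
  move=> Ax xy; have [c /= cs cx] := sP x Ax.
  have kN : k c <= N%:Z.
    apply: le_trans (ler_norm _) _; rewrite -abszE lez_nat.
    by rewrite /N (big_rem c) //= leq_maxl.
  rewrite (kP c x cx) (kP c y) //.
  have -> : y - c = (x - c) - (x - y) by ring.
  by apply: rpredB cx _; apply: pow_ideal_le xy.
move=> x y xy; have [Ax|nAx] := pselect (A x); first exact: main.
have [Ay|nAy] := pselect (A y); last by rewrite !fA.
by apply/esym/main => //; rewrite -opprB rpredN.
Qed.

Lemma Cc_infty_bounded (f : F -> E) : Cc_infty v f ->
  exists N : nat, forall x, x \notin pow_ideal v (- N%:Z) -> f x = 0.
Proof.
case=> f_lc [A cA fA].
pose U (n : nat) := [set x | x \in pow_ideal v (- n%:Z)].
have U_open n : vopen v (U n).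
  move=> y /= yn; exists (- n%:Z) => z zy /=.
  by have := rpredD zy yn; rewrite subrK.
have AU : A `<=` \bigcup_i U i.
  move=> x _; exists `|v x|%N => //; rewrite /U /= pow_idealE; apply/orP; right.
  by rewrite abszE lerNl ler_normr lexx orbT.
have [s sP] := cA nat U U_open AU.
exists (\max_(n <- s) n)%N => x xN; apply: fA => Ax.
have [n /= ns xn] := sP x Ax; case/negP: xN; apply: pow_ideal_le xn.
by rewrite lerN2 lez_nat (big_rem n) //= leq_maxl.
Qed.

End CompactSupport.

(** * Smoothness, central character and the Iwasawa decomposition *)

Section Kirillov.
Variables (F : fieldType) (v : normalized_valuation F) (p q : nat).
Hypothesis hF : local_field0 v p q.
Variable pi : Kunit F.
Hypothesis hpi : v (val pi) = 1.
Variables (E : closedFieldType) (psi : F -> E).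
Variables chi1 chi2 : Kunit F -> E.
Variable sigma : GL2 F -> (Kunit F -> E^o) -> (Kunit F -> E^o).
Hypothesis hsigma : kirillov_action v q psi chi1 chi2 sigma.
Local Notation K_sigma := (K_sigma v q chi1 chi2).
Local Notation Ind := (Ind v chi1 chi2).

Lemma sigma_stable g f : K_sigma f -> K_sigma (sigma g f).
Proof. exact: rep_stable (ka_rep hsigma) g f. Qed.

Lemma sigmaM g h f : K_sigma f -> sigma (g * h)%g f = sigma g (sigma h f).
Proof. exact: repM (ka_rep hsigma) g h f. Qed.

Lemma linear_on_scale (M M' : lmodType E) (V : set M) (T : M -> M') c x :
  linear_on V T -> V x -> T (c *: x) = c *: T x.
Proof.
move=> linT Vx; have := linT (c - 1) x x Vx Vx.
by rewrite !scalerBl !scale1r !subrK.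
Qed.

(** Transported from the induced model, where invariance under an open subgroup is part of the
    definition. *)
Lemma sigma_smooth f : K_sigma f ->
  exists N : nat, forall y, y \in pow_ideal v N%:Z -> sigma (up y) f = f.
Proof.
case: (ka_iso hsigma) => T [[_ _ surjT] linT eqT] /surjT[f0 /= Vf0 <-].
have [_ [H [H1 _ _ Hopen] fH]] := Vf0.
have [k kP] := Hopen _ H1; exists `|k|%N => y yk.
rewrite -eqT //; congr T; apply/funext => g; rewrite /right_translation fH //.
apply: kP => i j; rewrite -up0; have {}yk := pow_ideal_le (le_trans (ler_norm k) _) yk.
rewrite !mxE; do 2?case: ifP => _; rewrite ?subrr ?subr0 ?(rpred0 (pow_ideal v _)) //.
by apply: yk; rewrite -abszE.
Qed.

(** In the induced model right translation by a scalar is also left translation, whose effect the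
    two characters prescribe. *)
Lemma sigma_scalar f (z : Kunit F) : K_sigma f ->
  sigma (upper z 0 z) f = (chi1 z * chi2 z) *: f.
Proof.
case: (ka_iso hsigma) => T [[_ _ surjT] linT eqT] /surjT[f0 /= Vf0 <-].
rewrite -eqT // -(linear_on_scale _ linT) //; congr T; apply/funext => g.
rewrite /right_translation; have [-> _] : (g * upper z 0 z = upper z 0 z * g)%g /\ True.
  split=> //; apply: val_inj; apply: mx2P; rewrite !mulmx2E !upper_entries; ring.
by case: Vf0 => -> _.
Qed.

Lemma OF_mod_pow_finite (N : nat) : exists xs : seq F,
  {subset xs <= OF v} /\
  forall y, y \in OF v -> exists2 x, x \in xs & y - x \in pow_ideal v N%:Z.
Proof.
have [rs [_ rsO _ rsP]] := residue_system_exists hF.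
elim: N => [|N [xs [xsO xsP]]].
  exists [:: 0]; split=> [x|y yO]; first by rewrite inE => /eqP->; apply: OF0.
  by exists 0; rewrite ?mem_head // subr0.
exists [seq r + val pi * x | r <- rs, x <- xs]; split.
  move=> _ /allpairsP[[r x] /= [rrs xxs ->]].
  exact: OFD (rsO _ rrs) (OFM (val_pi_OF hpi) (xsO _ xxs)).
move=> y yO; have [r rrs yr] := rsP _ yO.
have [x xxs yx] := xsP _ (div_pi_OF hpi yr).
exists (r + val pi * x); first by apply/allpairsP; exists (r, x).
have -> : y - (r + val pi * x) = val pi * ((y - r) / val pi - x).
  by field; rewrite (valP pi).
by rewrite intS; apply: pow_idealM; rewrite // pow_idealE hpi lexx orbT.
Qed.

Lemma GL2_weyl_subproof : (\matrix_(i, j) (if i == 0 then (if j == 0 then 0 else -1)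
  else (if j == 0 then 1 else 0)) : 'M[F]_2) \in unitmx.
Proof. by rewrite unitmxE det_mx2 !mxE /= mul0r sub0r mulN1r opprK unitr1. Qed.

Definition weyl : GL2 F := MkGL2 GL2_weyl_subproof.

Lemma weyl_entries : (val weyl 0 0 = 0) * (val weyl 0 1 = -1) *
  (val weyl 1 0 = 1) * (val weyl 1 1 = 0).
Proof. by rewrite !mxE. Qed.

Lemma lower_entries y (k := (weyl^-1 * (up y * weyl))%g) : (val k 0 0 = 1) * (val k 0 1 = 0) *
  (val k 1 0 = - y) * (val k 1 1 = 1).
Proof.
have wk : (weyl * k = up y * weyl)%g by rewrite mulgA mulgV mul1g.
have : val weyl *m val k = val (up y) *m val weyl := congr1 val wk.
move: (val k) => K kE.
have kij i j : (val weyl *m K) i j = (val (up y) *m val weyl) i j by rewrite kE.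
have := (kij 0 0, kij 0 1, kij 1 0, kij 1 1).
rewrite !mulmx2E !weyl_entries !upper_entries /=.
rewrite !mul0r !mulN1r !mul1r !mulr0 !mulr1 !add0r !addr0.
case=> [[[h00 h01] h10] h11].
by split; [split; [split|]|]; rewrite // -[LHS]opprK ?h00 ?h01 ?opprK.
Qed.

(** The bottom row of [g] is a point of the projective line, so it is proportional to an integral
    row with an entry 1. The two families of representatives have bottom rows (1, y) and (-y, 1),
    and dividing by the right one leaves an upper triangular matrix. *)
Lemma iwasawa (g : GL2 F) : exists (z a : Kunit F) (b y : F), y \in OF v /\
  (g = (upper z 0 z * upper a b 1 * (weyl * up y))%g \/
   g = (upper z 0 z * upper a b 1 * (weyl^-1 * (up y * weyl)))%g).
Proof.
have tri (h : GL2 F) : val h 1 0 = 0 -> exists (z a : Kunit F) (b : F),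
    h = (upper z 0 z * upper a b 1)%g.
  move=> h10; have : \det (val h) != 0 by rewrite -unitfE -unitmxE (valP h).
  rewrite det_mx2 h10 mulr0 subr0 mulf_eq0 negb_or => /andP[h00 h11].
  have a0 : val h 0 0 / val h 1 1 != 0 by rewrite mulf_neq0 // invr_eq0.
  exists (KUnit h11), (KUnit a0), (val h 0 1 / val h 1 1).
  apply: val_inj; apply: mx2P; rewrite ?mulmx2E !upper_entries /= ?h10; by field.
have rows (k : GL2 F) : val k 1 0 * val g 1 1 = val k 1 1 * val g 1 0 -> \det (val k) = 1 ->
    exists (z a : Kunit F) (b : F), g = (upper z 0 z * upper a b 1 * k)%g.
  move=> krow detk; suff /tri[z [a [b hE]]] : val (g * k^-1)%g 1 0 = 0.
    by exists z, a, b; rewrite -hE mulgVK.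
  have gE : val g = val (g * k^-1)%g *m val k := congr1 val (esym (mulgVK k g)).
  move: krow; rewrite gE; move: (val (g * k^-1)%g) => H; rewrite !mulmx2E => krow.
  rewrite det_mx2 in detk; move: (val k) krow detk => K krow detk.
  rewrite -[LHS]mulr1 -detk.
  transitivity (K 1 1 * (H 1 0 * K 0 0 + H 1 1 * K 1 0) -
      K 1 0 * (H 1 0 * K 0 1 + H 1 1 * K 1 1)); first by ring.
  by rewrite krow subrr.
have [g11|g11] := boolP ((val g 1 1 != 0) && (val g 1 0 / val g 1 1 \in OF v)).
  case/andP: g11 => g11 yO; set y := _ / _ in yO.
  have [||z [a [b gE]]] := rows (weyl^-1 * (up (- y) * weyl))%g.
  - by rewrite !lower_entries /y; field.
  - by rewrite det_mx2 !lower_entries; ring.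
  by exists z, a, b, (- y); split; [rewrite OFN|right].
have g10 : val g 1 0 != 0.
  apply: contraNneq g11 => g10; rewrite g10 mul0r OF0 andbT.
  have : \det (val g) != 0 by rewrite -unitfE -unitmxE (valP g).
  by rewrite det_mx2 g10 mulr0 subr0 mulf_eq0 negb_or => /andP[].
have yO : val g 1 1 / val g 1 0 \in OF v.
  have [->|g11'] := eqVneq (val g 1 1) 0; first by rewrite mul0r OF0.
  move: g11; rewrite g11' /= !OFE !pow_idealE !mulf_eq0 !invr_eq0 (negPf g10) (negPf g11') /=.
  rewrite !nvalM ?invr_eq0 // !nvalV // -ltNge => h; apply: ltW; move: h.
  by rewrite subr_lt0 subr_gt0.
set y := _ / _ in yO; have val1 : val (1%g : Kunit F) = 1 by [].
have [||z [a [b gE]]] := rows (weyl * up y)%g.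
- by rewrite !mulmx2E !weyl_entries !upper_entries val1 /y; field.
- by rewrite det_mx2 !mulmx2E !weyl_entries !upper_entries val1; ring.
by exists z, a, b, y; split=> //; left.
Qed.

End Kirillov.

Section UnitExtension.
Variables (F : fieldType) (v : normalized_valuation F) (E : closedFieldType).
Variable chi : Kunit F -> E.
Hypothesis hchi : smooth_char v chi.

(** Fourier analysis takes place on F, while [chi] is defined on [Kunit F]. On units [insub]
    succeeds, so the default of [oapp] is never reached. *)
Definition unit_ext (u : F) : E := if u \in val_unit v then oapp chi 0 (insub u) else 0.

Lemma unit_extE (u : Kunit F) : val u \in val_unit v -> unit_ext (val u) = chi u.
Proof. by move=> uU; rewrite /unit_ext uU valK. Qed.

Lemma char1 : chi 1%g = 1.
Proof. by apply: (mulfI (sc_neq0 hchi 1%g)); rewrite -(sc_mul hchi) mulg1 mulr1. Qed.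

Lemma char_ppow (pi : Kunit F) (l : int) : chi (ppow pi l) = chi pi ^ l.
Proof.
have nat_case (k : nat) : chi (ppow pi k) = chi pi ^+ k.
  elim: k => [|k IHk]; first by rewrite ppow0 char1.
  by rewrite intS ppowD (sc_mul hchi) ppow1 IHk exprS.
case: l => k; first exact: nat_case.
rewrite NegzE -exprnN; apply: (mulfI (sc_neq0 hchi (ppow pi k.+1))).
by rewrite -(sc_mul hchi) -ppowD subrr ppow0 char1 nat_case divff // expf_neq0 // (sc_neq0 hchi).
Qed.

Lemma val_unit_exists (u : F) : u \in val_unit v -> exists x : Kunit F, val x = u.
Proof. by move=> uU; exists (KUnit (val_unit_neq0 uU)). Qed.

Lemma tame_fun_unit_ext : tamely_ramified v chi -> tame_fun v unit_ext.
Proof.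
move=> tame; split=> [x y xO yO xy|x xU|x xU|x y xU yU].
- have [xU|xU] := boolP (x \in val_unit v); last first.
    rewrite /unit_ext (negPf xU) ifF //; apply: contraNF xU => yU.
    by apply: val_unit_near yU xy.
  have yU : y \in val_unit v by apply: val_unit_near xU _; rewrite -opprB rpredN.
  have [x' x'E] := val_unit_exists xU; have [y' y'E] := val_unit_exists yU.
  rewrite -x'E -y'E !unit_extE ?x'E ?y'E //.
  rewrite -[x'](mulgVK y') (sc_mul hchi) tame ?mul1r //= -/(val x') -/(val y') x'E y'E.
  rewrite -[1](divff (val_unit_neq0 yU)) -mulrBl mulrC.
  by rewrite pow_ideal_mulu ?val_unitV.
- by rewrite /unit_ext (negPf xU).
- by have [x' x'E] := val_unit_exists xU; rewrite -x'E unit_extE ?x'E // (sc_neq0 hchi).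
- have [x' x'E] := val_unit_exists xU; have [y' y'E] := val_unit_exists yU.
  have -> : x * y = val (x' * y')%g by rewrite -x'E -y'E.
  rewrite -x'E -y'E !unit_extE ?x'E ?y'E // ?(sc_mul hchi) //=.
  by rewrite -/(val x') -/(val y') x'E y'E val_unitM.
Qed.

Lemma unramified_tame : unramified v chi -> tamely_ramified v chi.
Proof.
move=> unr u u1; apply: unr.
by have /andP[_ /eqP] := val_unit_near (val_unit1 v) u1.
Qed.

End UnitExtension.

(** * Reduction to mirabolic translates *)

Section Reduction.
Variables (R : realType) (F : fieldType) (v : normalized_valuation F) (p q : nat).
Hypothesis hF : local_field0 v p q.
Variable pi : Kunit F.
Hypothesis hpi : v (val pi) = 1.
Variables (E : closedFieldType) (iota : {rmorphism F -> E}) (absE : E -> R).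
Hypotheses (habsE : nonarch_abs absE) (habsF : extends_abs v q iota absE).
Variable psi : F -> E.
Variables chi1 chi2 : Kunit F -> E.
Hypotheses (hchi1 : smooth_char v chi1) (hchi2 : smooth_char v chi2).
Hypotheses (htame1 : tamely_ramified v chi1) (htame2 : tamely_ramified v chi2).
Variables (m : int) (n : nat).
Hypothesis hcentral : absE (chi1 pi * chi2 pi * iota (val pi) ^ m * iota (val pi) ^ m
  * iota (val pi) ^+ n) = 1.
Variable sigma : GL2 F -> (Kunit F -> E^o) -> (Kunit F -> E^o).
Hypothesis hsigma : kirillov_action v q psi chi1 chi2 sigma.
Local Notation K_sigma := (K_sigma v q chi1 chi2).
Local Notation V := 'rV[E]_n.+1.
Local Notation tau := (tau iota m (n := n)).
Implicit Type r : R.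

Definition mirabolic_translate (a : Kunit F) (b : F) (f : Kunit F -> E) (u : V) :
    Kunit F -> V :=
  fun x => (psi (b * val x) * f (a * x)%g) *: tau (upper a b 1%g) u.

(** To be thought of as the closed ball of radius r of an ultrametric norm; the rules below are all
    that the reduction uses. *)
Variable good : R -> (Kunit F -> V) -> Prop.
Hypothesis good0 : forall r, 0 <= r -> good r (fun=> 0).
Hypothesis goodD : forall r f g, good r f -> good r g -> good r (fun x => f x + g x).
Hypothesis goodZ : forall r c f, good r f -> good (absE c * r) (fun x => c *: f x).
Hypothesis good_le : forall r s f, r <= s -> good r f -> good s f.
Hypothesis good_translate : forall f, K_sigma f -> exists2 K : R, 0 <= K &
  forall a b u, ball absE 1 u -> good K (mirabolic_translate a b f u).

Lemma good_sum r (I : eqType) (s : seq I) (G : I -> Kunit F -> V) : 0 <= r ->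
  (forall i, i \in s -> good r (G i)) -> good r (fun x => \sum_(i <- s) G i x).
Proof.
move=> r0; elim: s => [|i s IHs] Gs.
  have -> : (fun x => \sum_(i <- [::]) G i x) = fun=> 0.
    by apply/funext => x; rewrite big_nil.
  exact: good0.
rewrite (_ : (fun _ => _) = fun x => G i x + \sum_(j <- s) G j x); last first.
  by apply/funext => x; rewrite big_cons.
apply: goodD; first by apply: Gs; rewrite mem_head.
by apply: IHs => j js; apply: Gs; rewrite inE js orbT.
Qed.

(** By smoothness [sigma (h * up y) f] depends only on [y] modulo a power of pi. Finitely many
    vectors occur, and the sum of their bounds serves for all [y] in O_F. *)
Lemma good_orbit (h : GL2 F) f : K_sigma f -> exists2 K : R, 0 <= K & forall y a b u,
  y \in OF v -> ball absE 1 u -> good K (mirabolic_translate a b (sigma (h * up y)%g f) u).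
Proof.
move=> Kf; have [N fN] := sigma_smooth hsigma Kf.
have [xs [xsO xsP]] := OF_mod_pow_finite hF hpi N.
have /choice[K KP] : forall x : F, exists K : R, 0 <= K /\ forall a b u, ball absE 1 u ->
    good K (mirabolic_translate a b (sigma (h * up x)%g f) u).
  move=> x; have [K K0 KP] := good_translate (sigma_stable hsigma (h * up x)%g Kf).
  by exists K.
have K0 x : 0 <= K x by case: (KP x).
exists (\sum_(x <- xs) K x) => [|y a b u yO u1]; first exact: sumr_ge0.
have [x xxs yx] := xsP _ yO.
have -> : sigma (h * up y)%g f = sigma (h * up x)%g f.
  by rewrite -{1}(subrK x y) addrC upD mulgA [LHS](sigmaM hsigma) ?fN.
apply: good_le (proj2 (KP x) a b u u1).
by rewrite (big_rem x) //= lerDl sumr_ge0.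
Qed.

Lemma tau_scalar (z : Kunit F) (u : V) : tau (upper z 0 z) u =
  (iota (val z) ^ m * iota (val z) ^ m * iota (val z) ^+ n) *: u.
Proof.
apply/rowP => k; rewrite mxE [RHS]mxE det_mx2 !upper_entries mulr0 subr0 rmorphM expfzMl.
rewrite -[RHS]mulrA; congr (_ * _); rewrite symn_diag !mxE //= ?rmorph0 //.
by rewrite -exprD subnKC ?leq_ord.
Qed.

(** [hcentral] concerns pi alone; on units the tame characters take roots of unity as values, and
    every [z] is a power of pi times a unit. *)
Lemma central_abs (z : Kunit F) : absE (chi1 z * chi2 z *
  (iota (val z) ^ m * iota (val z) ^ m * iota (val z) ^+ n)) = 1.
Proof.
pose ph (x : Kunit F) := chi1 x * chi2 x *
  (iota (val x) ^ m * iota (val x) ^ m * iota (val x) ^+ n).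
have phM x y : ph (x * y)%g = ph x * ph y.
  rewrite /ph (sc_mul hchi1) (sc_mul hchi2) /= rmorphM !expfzMl exprMn; ring.
have phpi : absE (ph pi) = 1 by rewrite -hcentral; congr absE; rewrite /ph; ring.
have ph1 : ph 1%g = 1.
  by rewrite /ph (char1 hchi1) (char1 hchi2) /= rmorph1 !exp1rz expr1n !mulr1.
have phpow (k : nat) : absE (ph (ppow pi k)) = 1.
  elim: k => [|k IHk]; first by rewrite ppow0 ph1 absE1.
  by rewrite intS ppowD ppow1 phM (absM habsE) phpi IHk mulr1.
have phppow l : absE (ph (ppow pi l)) = 1.
  case: l => // k; have := congr1 absE ph1.
  rewrite -(ppow0 pi) -(addNr (k.+1 : int)) ppowD phM (absM habsE) phpow mulr1 NegzE => ->.
  exact: absE1.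
have phunit (u : Kunit F) : val u \in val_unit v -> absE (ph u) = 1.
  move=> uU; rewrite /ph !(absM habsE) !(absEXz habsE) (absEX habsE) (absE_iota_unit habsF uU).
  rewrite -(unit_extE chi1 uU) -(unit_extE chi2 uU).
  by rewrite !(tame_abs hF habsE _ uU) ?expr1n ?exp1rz ?mulr1 //; apply: tame_fun_unit_ext.
have [u uU ->] := unit_part hpi z.
by rewrite -/(ph _) phM (absM habsE) phppow phunit // mulr1.
Qed.

Lemma rho_decomposition (w : Kunit F -> V) (z a : Kunit F) b (k : GL2 F) :
  K_rho v q chi1 chi2 w ->
  rho iota sigma m (upper z 0 z * upper a b 1 * k)%g w =
  fun x => (chi1 z * chi2 z * (iota (val z) ^ m * iota (val z) ^ m * iota (val z) ^+ n)) *: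
    \sum_(i < n.+1) mirabolic_translate a b (sigma k (fun y => w y 0 i))
       (tau k (delta_mx 0 i)) x.
Proof.
move=> Kw; apply/funext => x; rewrite /rho.
have Kwk i : K_sigma (sigma k (fun y => w y 0 i)) by apply: (sigma_stable hsigma).
have -> : \row_i sigma (upper z 0 z * upper a b 1 * k)%g (fun y => w y 0 i) x =
   (chi1 z * chi2 z) *: \sum_(i < n.+1)
     (psi (b * val x) * sigma k (fun y => w y 0 i) (a * x)%g) *: delta_mx 0 i :> V.
  apply/rowP => j; rewrite !mxE summxE (bigD1 j) //= big1 => [|i ij]; last first.
    by rewrite !mxE eqxx (eq_sym j) (negPf ij) mulr0.
  rewrite !mxE !eqxx mulr1 addr0.
  rewrite (sigmaM hsigma) // (sigmaM hsigma) // (sigma_scalar hsigma).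
    by rewrite (ka_mirabolic hsigma).
  exact: (sigma_stable hsigma).
rewrite -mulgA tauM tau_scalar tauZ scalerA mulrC; congr (_ *: _).
by rewrite tau_sum; apply: eq_bigr => i _; rewrite tauZ tauM.
Qed.

Lemma good_OE_span (w : Kunit F -> V) : K_rho v q chi1 chi2 w ->
  exists2 K : R, 0 <= K & forall phi, OE_span absE (rho iota sigma m (n := n)) w phi ->
    good K phi.
Proof.
move=> Kw.
have /choice[K1 K1P] : forall i : 'I_n.+1, exists K : R, 0 <= K /\ forall y a b u,
    y \in OF v -> ball absE 1 u ->
    good K (mirabolic_translate a b (sigma (weyl F * up y)%g (fun x => w x 0 i)) u).
  by move=> i; have [K K0 KP] := good_orbit (weyl F) (Kw i); exists K.
have /choice[K2 K2P] : forall i : 'I_n.+1, exists K : R, 0 <= K /\ forall y a b u,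
    y \in OF v -> ball absE 1 u -> good K (mirabolic_translate a b
      (sigma ((weyl F)^-1 * (up y * weyl F))%g (fun x => w x 0 i)) u).
  move=> i; have [K K0 KP] := good_orbit (weyl F)^-1%g (sigma_stable hsigma (weyl F) (Kw i)).
  exists K; split=> // y a b u yO u1; have := KP y a b u yO u1.
  by rewrite -(sigmaM hsigma) // mulgA.
pose K := \sum_i (K1 i + K2 i).
have K12 i : 0 <= K1 i + K2 i by rewrite addr_ge0 //; [case: (K1P i) | case: (K2P i)].
have K0 : 0 <= K by apply: sumr_ge0.
have K1K i : K1 i <= K.
  rewrite /K (bigD1 i) //= -addrA lerDl addr_ge0 ?sumr_ge0 //; by case: (K2P i).
have K2K i : K2 i <= K.
  rewrite /K (bigD1 i) //= addrAC lerDr addr_ge0 ?sumr_ge0 //; by case: (K1P i).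
exists K => // phi [s s1 ->].
have -> : \sum_(d <- s) d.1 *: rho iota sigma m d.2 w =
    fun x => \sum_(d <- s) d.1 *: rho iota sigma m d.2 w x.
  by apply/funext => x; rewrite fct_sumE.
have goodZ1 c f : absE c <= 1 -> good K f -> good K (fun x => c *: f x).
  by move=> c1 /(goodZ c); apply: good_le; rewrite ler_piMl.
have delta1 i : ball absE 1 (delta_mx 0 i : V).
  by move=> j; rewrite mxE (absE_nat_le1 habsE).
have goodrho g : good K (rho iota sigma m g w).
  have [z [a [b [y [yO]]]]] := iwasawa v g.
  (* Here [k] lies in GL_2(O_F), so [tau k] keeps the basis vectors in the unit ball, and the
     central factor has absolute value 1. *)
  have fin k : \det (val k) \in val_unit v -> (forall i j, val k i j \in OF v) ->
      g = (upper z 0 z * upper a b 1 * k)%g ->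
      (forall i u, ball absE 1 u ->
         good K (mirabolic_translate a b (sigma k (fun x => w x 0 i)) u)) ->
      good K (rho iota sigma m g w).
    move=> detk kO -> kgood; rewrite rho_decomposition //.
    apply: goodZ1; first by rewrite central_abs.
    apply: good_sum => // i _; apply: kgood.
    by apply: (tau_ball hF habsE habsF).
  have ord2 (k : 'I_2) : k = 0 \/ k = 1.
    by case: k => [[|[|k]]] // hk; [left|right]; apply: val_inj.
  case=> gE; apply: fin gE _.
  - rewrite det_mx2 !mulmx2E !weyl_entries !upper_entries.
    by rewrite !(mul1r, mulr1, mulr0, mul0r, add0r, addr0, mulN1r, opprK, subr0, sub0r) val_unit1.
  - move=> i j; rewrite mulmx2E; case: (ord2 i) => ->; case: (ord2 j) => ->;
      rewrite !weyl_entries !upper_entries;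
      by rewrite ?(mul1r, mulr1, mulr0, mul0r, add0r, addr0, mulN1r, opprK, subr0, sub0r) ?OFN ?OF0 ?OF1.
  - by move=> i u u1; apply: good_le (K1K i) _; apply: (proj2 (K1P i)).
  - by rewrite det_mx2 !lower_entries mulr1 mul0r subr0 val_unit1.
  - move=> i j; case: (ord2 i) => ->; case: (ord2 j) => ->; rewrite !lower_entries;
      by rewrite ?OFN ?OF0 ?OF1.
  - by move=> i u u1; apply: good_le (K2K i) _; apply: (proj2 (K2P i)).
elim: s s1 => [|d s IHs] s1.
  have -> : (fun x => \sum_(d <- [::]) d.1 *: rho iota sigma m d.2 w x) = fun=> 0.
    by apply/funext => x; rewrite big_nil.
  exact: good0.
rewrite (_ : (fun _ => _) = fun x => d.1 *: rho iota sigma m d.2 w x +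
    \sum_(d <- s) d.1 *: rho iota sigma m d.2 w x); last first.
  by apply/funext => x; rewrite big_cons.
apply: goodD; first by apply: goodZ1 => //; apply: s1; rewrite mem_head.
by apply: IHs => c cs; apply: s1; rewrite inE cs orbT.
Qed.

End Reduction.

(** * Recurrences *)

Section ScalarFamilies.
Variables (R : realType) (F : fieldType) (v : normalized_valuation F) (p q : nat).
Hypothesis hF : local_field0 v p q.
Variable pi : Kunit F.
Hypothesis hpi : v (val pi) = 1.
Variables (E : closedFieldType) (iota : {rmorphism F -> E}) (absE : E -> R).
Hypotheses (habsE : nonarch_abs absE) (habsF : extends_abs v q iota absE).
Variable psi : F -> E.
Hypothesis hpsi : self_dual_char v psi.
Variables (m : int) (n : nat).
Local Notation tau := (tau iota m (n := n)).
Local Notation V := 'rV[E]_n.+1.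
Local Notation twisted_span := (twisted_span v iota absE psi m (n := n)).
Local Notation shift := (shift pi iota m (n := n)).
Implicit Types (r K : R) (G : int -> F -> E).

(* If G l describes a scalar function on pi^l U_F, then twist_family describes its translate
   by the mirabolic element (pi^k u0, b), brought back to U_F by diag(pi^l, 1). *)
Definition twist_family G (k : int) (u0 : Kunit F) (b : F) (u : V) (l : int) (x : F) : V :=
  (G (l + k) (val u0 * x) * psi (b * (val pi ^ l * x))) *:
    tau (dg (ppow pi l) * upper (ppow pi k * u0) b 1)%g u.

Lemma twist_family_shift G k u0 b u l x :
  shift (twist_family G k u0 b u (l - 1)) x =
  twist_family (fun j y => G (j - 1) (val pi * y)) k u0 b u l x.
Proof.
have piE : (pi * ppow pi (l - 1))%g = ppow pi l by rewrite -{1}(ppow1 pi) -ppowD addrC subrK.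
rewrite /shift /twist_family tauZ -tauM mulgA -dgM piE.
rewrite [l - 1 + k]addrAC [val u0 * (val pi * x)]mulrCA; congr ((_ * psi _) *: _).
congr (_ * _); rewrite mulrA; congr (_ * _).
by rewrite -[X in _ * X](expr1z (val pi)) -expfzDr ?subrK // (valP pi).
Qed.

(** The bound is uniform in the mirabolic element: [b] only translates the frequencies, which the
    twisted lattices absorb, and the unit [u0] preserves the ball. Only the level [l + k]
    matters. *)
Lemma twist_family_span G j : exp_span v psi (G j) -> exists2 K : R, 0 <= K &
  forall l k u0 b u, l + k = j -> val u0 \in val_unit v -> ball absE 1 u ->
    twisted_span K (twist_family G k u0 b u l).
Proof.
case=> s hs.
have /choice[K KP] : forall d : F * E, exists K : R, 0 <= K /\ forall u, ball absE 1 u ->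
    ball absE K (d.2 *: tau (up (- d.1) * dg (ppow pi j))%g u).
  move=> d; have [K K0 KP] := tau_bounded iota habsE m n (up (- d.1) * dg (ppow pi j))%g.
  exists (absE d.2 * K); split=> [|u u1]; first by rewrite mulr_ge0 ?(abs_ge0 habsE).
  by apply: ballZ => //; have := KP 1 u ler01 u1; rewrite mulr1.
have K0 d : 0 <= K d by case: (KP d).
exists (\sum_(d <- s) K d) => [|l k u0 b u lk u0U u1]; first exact: sumr_ge0.
have matE : (dg (ppow pi l) * upper (ppow pi k * u0) b 1 =
    up (val pi ^ l * b) * dg (ppow pi j * u0))%g.
  by rewrite upper_up_dg mulgA dg_up -mulgA -dgM mulgA -ppowD lk.
exists [seq (d.1 * val u0 + val pi ^ l * b,
    d.2 *: tau (up (val pi ^ l * b) * dg (ppow pi j * u0))%g u) | d <- s].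
  move=> _ /mapP[d ds ->] /=.
  have -> : tau (up (- (d.1 * val u0 + val pi ^ l * b)))
      (d.2 *: tau (up (val pi ^ l * b) * dg (ppow pi j * u0))%g u) =
      tau (upper u0 0 1%g) (d.2 *: tau (up (- d.1) * dg (ppow pi j))%g u).
    rewrite [LHS]tauZ [RHS]tauZ -!tauM; congr (_ *: tau _ _).
    rewrite [RHS]mulgA -[upper u0 0 1%g]/(dg u0) dg_up mulgA -upD -mulgA -dgM.
    by rewrite opprD subrK mulrN [val u0 * _]mulrC; congr (_ * dg _)%g; apply: val_inj; apply: mulrC.
  apply: (tau_upper_ball hF habsE habsF); rewrite ?sumr_ge0 ?OF0 ?val_unit1 //.
  apply: ball_le (proj2 (KP d) u u1).
  by rewrite (big_rem d) //= lerDl sumr_ge0.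
move=> x xO; rewrite /twist_family lk matE hs; last by rewrite OFM // val_unit_OF.
move: (tau _ u) => t; rewrite big_map mulr_suml scaler_suml; apply: eq_bigr => d _ /=.
rewrite scalerA; congr (_ *: _); rewrite mulrDl (ac_add hpsi).
have -> : d.1 * (val u0 * x) = d.1 * val u0 * x by ring.
have -> : b * (val pi ^ l * x) = val pi ^ l * b * x by ring.
ring.
Qed.

Lemma twist_family_span_all G (J : seq int) :
  (forall j, j \in J -> exp_span v psi (G j)) ->
  (forall j x, j \notin J -> G j x = 0) -> exists2 K : R, 0 <= K &
  forall l k u0 b u, val u0 \in val_unit v -> ball absE 1 u ->
    twisted_span K (twist_family G k u0 b u l).
Proof.
move=> GJ G0.
have /choice[K KP] : forall j : int, exists K : R, 0 <= K /\ (j \in J ->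
    forall l k u0 b u, l + k = j -> val u0 \in val_unit v -> ball absE 1 u ->
    twisted_span K (twist_family G k u0 b u l)).
  move=> j; have [/GJ/twist_family_span[K K0 KP]|] := boolP (j \in J); first by exists K.
  by exists 0.
have K0 j : 0 <= K j by case: (KP j).
exists (\sum_(j <- J) K j) => [|l k u0 b u u0U u1]; first exact: sumr_ge0.
have [lkJ|lkJ] := boolP (l + k \in J).
  apply: twisted_span_le (proj2 (KP _) lkJ l k u0 b u erefl u0U u1).
  by rewrite (big_rem (l + k)) //= lerDl sumr_ge0.
apply: (twisted_span_ext (f := fun=> 0)) => [x _|]; last exact: twisted_span0.
by rewrite /twist_family G0 // mul0r scale0r.
Qed.

Lemma Cc_infty_exp_span (f : F -> E) (c : F) : Cc_infty v f ->
  exp_span v psi (fun x => f (c * x)).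
Proof.
move=> /Cc_infty_uniform[N fN]; apply: (exp_span_periodic hF hpi iota hpsi
  (N := `|N%:Z - v c|%N)) => x y xO yO xy; apply: fN.
rewrite -mulrBr; have [->|c0] := eqVneq c 0; first by rewrite mul0r (rpred0 (pow_ideal v _)).
have cc : c \in pow_ideal v (v c) by rewrite pow_idealE lexx orbT.
apply: pow_ideal_le (pow_idealM cc xy).
by rewrite -lerBlDl abszE ler_norm.
Qed.

End ScalarFamilies.

(** * Second order recurrences and their defects *)

Section Recurrence.
Variables (R : realType) (F : fieldType) (v : normalized_valuation F) (p q : nat).
Hypothesis hF : local_field0 v p q.
Variable pi : Kunit F.
Hypothesis hpi : v (val pi) = 1.
Variables (E : closedFieldType) (iota : {rmorphism F -> E}) (absE : E -> R).
Hypotheses (habsE : nonarch_abs absE) (habsF : extends_abs v q iota absE).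
Variable psi : F -> E.
Hypothesis hpsi : self_dual_char v psi.
Variables (m : int) (n : nat).
Local Notation tau := (tau iota m (n := n)).
Local Notation V := 'rV[E]_n.+1.
Local Notation twisted_span := (twisted_span v iota absE psi m (n := n)).
Local Notation shift := (shift pi iota m (n := n)).
Implicit Types (r K : R) (G g : int -> F -> E) (Phi : int -> F -> V) (s t c : E).

Lemma shiftD (f1 f2 : F -> V) x : shift (fun y => f1 y + f2 y) x = shift f1 x + shift f2 x.
Proof. exact: tauD. Qed.

Lemma shiftZ c (f : F -> V) x : shift (fun y => c *: f y) x = c *: shift f x.
Proof. exact: tauZ. Qed.

(** The failure of the recurrence with characteristic polynomial X^2 - s X + t. *)
Definition defect s t Phi (l : int) (x : F) : V :=
  Phi l x - s *: shift (Phi (l - 1)) x + t *: shift (shift (Phi (l - 2))) x.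

Lemma defectD s t Phi Phi' l x :
  defect s t (fun l y => Phi l y + Phi' l y) l x = defect s t Phi l x + defect s t Phi' l x.
Proof.
rewrite /defect shiftD; have -> : shift (fun y => Phi (l - 2) y + Phi' (l - 2) y) =
    fun y => shift (Phi (l - 2)) y + shift (Phi' (l - 2)) y.
  by apply/funext => y; apply: shiftD.
rewrite shiftD !scalerDr opprD (addrACA (Phi l x)); exact: addrACA.
Qed.

Lemma defectZ s t c Phi l x :
  defect s t (fun l y => c *: Phi l y) l x = c *: defect s t Phi l x.
Proof.
rewrite /defect shiftZ; have -> : shift (fun y => c *: Phi (l - 2) y) =
    fun y => c *: shift (Phi (l - 2)) y.
  by apply/funext => y; apply: shiftZ.
by rewrite shiftZ !scalerDr scalerN !scalerA [s * c]mulrC [t * c]mulrC.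
Qed.

Definition scalar_defect s t G (l : int) (x : F) : E :=
  G l x - s * G (l - 1) (val pi * x) + t * G (l - 2) (val pi * (val pi * x)).

Lemma defect_twist_family s t G k u0 b u l x :
  defect s t (twist_family pi iota psi m G k u0 b u) l x =
  twist_family pi iota psi m (scalar_defect s t G) k u0 b u l x.
Proof.
rewrite /defect; have l2 : l - 2 = l - 1 - 1 by rewrite -addrA -opprD.
have -> : shift (twist_family pi iota psi m G k u0 b u (l - 2)) =
    twist_family pi iota psi m (fun j y => G (j - 1) (val pi * y)) k u0 b u (l - 1).
  by apply/funext => y; rewrite l2 twist_family_shift.
rewrite !twist_family_shift /twist_family /scalar_defect.
move: (tau _ u) => e; rewrite !scalerA -scalerBl -scalerDl; congr (_ *: _).
by rewrite -[l + k - 1 - 1]addrA -opprD; ring.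
Qed.

(** At levels far below 0 compact support kills the function on units only, not on all of O_F.
    Cutting it off there creates a defect at the two levels [L] and [L + 1] alone. *)
Definition cut (L : int) g (l : int) (x : F) : E := if l < L then 0 else g l x.

Lemma scalar_defect_cut s t g L l x : l \notin [:: L; L + 1] ->
  (forall l x, scalar_defect s t g l x = 0) -> scalar_defect s t (cut L g) l x = 0.
Proof.
move=> lL g0; have := g0 l x; rewrite /scalar_defect /cut.
have [lL1|lL1] := ltP l L.
  have -> : l - 1 < L by lia.
  have -> : l - 2 < L by lia.
  by rewrite !mulr0 subr0 addr0.
rewrite !inE negb_or in lL; case/andP: lL => lL2 lL3.
have -> : (l - 1 < L) = false by lia.
by have -> : (l - 2 < L) = false by lia.
Qed.

Lemma exp_span_scalar_defect_cut s t g L l :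
  (forall l (c : F), exp_span v psi (fun x => g l (c * x))) ->
  exp_span v psi (scalar_defect s t (cut L g) l).
Proof.
move=> gs.
have cs j (c : F) : exp_span v psi (fun x => cut L g j (c * x)).
  rewrite /cut; case: (j < L); last exact: gs.
  by exists [::] => u _; rewrite big_nil.
rewrite /scalar_defect; apply: exp_spanD; last first.
  by apply: exp_spanZ; apply: exp_span_ext (cs (l - 2) (val pi * val pi)) => u _; rewrite mulrA.
apply: exp_spanD; first by apply: exp_span_ext (cs l 1) => u _; rewrite mul1r.
by apply: exp_span_ext (exp_spanZ (- s) (cs (l - 1) (val pi))) => u _; rewrite mulNr.
Qed.

Variables chi1 chi2 : Kunit F -> E.
Hypotheses (hchi1 : smooth_char v chi1) (hchi2 : smooth_char v chi2).
Hypotheses (htame1 : tamely_ramified v chi1) (htame2 : tamely_ramified v chi2).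
Variables s1 t1 s2 t2 : E.
Let la := chi1 pi.
Let mu := omega v E q pi * chi2 pi.
Hypothesis root1 : la ^+ 2 - s1 * la + t1 = 0.
Hypothesis root2 : mu ^+ 2 - s2 * mu + t2 = 0.
(** In this case the Kirillov model contains v chi1, whose levels l la^l satisfy the recurrence only
    if la is a double root. *)
Hypothesis double_root : chi1 = (fun x => omega v E q x * chi2 x) ->
  s1 = 2 * la /\ t1 = la ^+ 2.

(* phi is described on pi^l U_F by tau(diag(pi^l, 1))^-1 (chi1 Phi1_l + chi2 Phi2_l). The
   coefficients (s, t) are (la + mu, la mu) when chi1 and chi2 agree on units; otherwise they
   are (la, 0) for Phi1 and (mu, 0) for Phi2. *)
Record good_data r (phi : Kunit F -> V) (Phi1 Phi2 : int -> F -> V) (L : int) : Prop := GoodData {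
  gd_eq : forall l (u : Kunit F), val u \in val_unit v -> phi (ppow pi l * u)%g =
    tau (dg (ppow pi l))^-1%g (chi1 u *: Phi1 l (val u) + chi2 u *: Phi2 l (val u));
  gd_low : forall l x, l < L -> Phi1 l x = 0 /\ Phi2 l x = 0;
  gd_span1 : forall l, twisted_span r (defect s1 t1 Phi1 l);
  gd_span2 : forall l, twisted_span r (defect s2 t2 Phi2 l)
}.

Definition good r (phi : Kunit F -> V) := exists Phi1 Phi2 L, good_data r phi Phi1 Phi2 L.

Lemma good_zero r : 0 <= r -> good r (fun=> 0).
Proof.
move=> r0; exists (fun _ _ => 0), (fun _ _ => 0), 0; split=> [l u _|l x _|l|l] //.
- by rewrite !scaler0 addr0 tau0.
- apply: (twisted_span_ext (f := fun=> 0)) => [x _|]; last exact: twisted_span0.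
  by rewrite /defect /shift !tau0 !scaler0 subr0 addr0.
- apply: (twisted_span_ext (f := fun=> 0)) => [x _|]; last exact: twisted_span0.
  by rewrite /defect /shift !tau0 !scaler0 subr0 addr0.
Qed.

Lemma good_add r phi phi' : good r phi -> good r phi' -> good r (fun x => phi x + phi' x).
Proof.
move=> [P1 [P2 [L [eq1 low1 sp1 sp2]]]] [P1' [P2' [L' [eq1' low1' sp1' sp2']]]].
exists (fun l y => P1 l y + P1' l y), (fun l y => P2 l y + P2' l y), (Order.min L L').
split=> [l u uU|l x|l|l].
- by rewrite eq1 // eq1' // -tauD !scalerDr addrACA.
- rewrite lt_min => /andP[lL lL']; have [-> ->] := low1 l x lL.
  by have [-> ->] := low1' l x lL'; rewrite !addr0.
- by apply: twisted_span_ext (twisted_spanD (sp1 l) (sp1' l)) => x _; rewrite defectD.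
- by apply: twisted_span_ext (twisted_spanD (sp2 l) (sp2' l)) => x _; rewrite defectD.
Qed.

Lemma good_scale r c phi : good r phi -> good (absE c * r) (fun x => c *: phi x).
Proof.
move=> [P1 [P2 [L [eq1 low1 sp1 sp2]]]].
exists (fun l y => c *: P1 l y), (fun l y => c *: P2 l y), L.
split=> [l u uU|l x lL|l|l].
- by rewrite eq1 // -tauZ scalerDr !scalerA ![_ * c]mulrC.
- by have [-> ->] := low1 l x lL; rewrite !scaler0.
- by apply: twisted_span_ext (twisted_spanZ habsE c (sp1 l)) => x _; rewrite defectZ.
- by apply: twisted_span_ext (twisted_spanZ habsE c (sp2 l)) => x _; rewrite defectZ.
Qed.

Lemma good_mono r r' phi : r <= r' -> good r phi -> good r' phi.
Proof.
move=> rr' [P1 [P2 [L [eq1 low1 sp1 sp2]]]]; exists P1, P2, L.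
by split=> // l; [apply: twisted_span_le (sp1 l) | apply: twisted_span_le (sp2 l)].
Qed.

Lemma ppow_pred_mul (j : int) y : val pi ^ (j - 1) * (val pi * y) = val pi ^ j * y.
Proof. by rewrite -{2}(subrK 1 j) [in RHS]expfzDr ?(valP pi) // expr1z mulrA. Qed.

(** Passing from (l, x) to (l - 1, pi x) does not change [val pi ^ l * x], so only the powers of [c]
    are compared. *)
Lemma scalar_defect_geometric s t c (f : F -> E) l x : c != 0 -> c ^+ 2 - s * c + t = 0 ->
  scalar_defect s t (fun l x => c ^ l * f (val pi ^ l * x)) l x = 0.
Proof.
move=> c0 root; rewrite /scalar_defect.
have -> : l - 2 = l - 1 - 1 by rewrite -addrA -opprD.
rewrite !ppow_pred_mul; set fx := f _; rewrite !(expfzDr _ _ c0) !exprN1.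
transitivity (c ^ l * fx * c ^- 2 * (c ^+ 2 - s * c + t)); last by rewrite root mulr0.
by move: (c ^ l) => d; field.
Qed.

Lemma scalar_defect_log c (f1 f2 : F -> E) l x : c != 0 ->
  scalar_defect (2 * c) (c ^+ 2)
    (fun l x => c ^ l * (f1 (val pi ^ l * x) + l%:~R * f2 (val pi ^ l * x))) l x = 0.
Proof.
move=> c0; rewrite /scalar_defect.
have -> : l - 2 = l - 1 - 1 by rewrite -addrA -opprD.
rewrite !ppow_pred_mul !(expfzDr _ _ c0) !exprN1 !rmorphB /= rmorph1.
by move: (c ^ l) (f1 _) (f2 _) (l%:~R) => d y z k; field.
Qed.

Lemma omega_ppow l (u : Kunit F) : val u \in val_unit v ->
  omega v E q (ppow pi l * u)%g = omega v E q pi ^ l.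
Proof.
rewrite val_unitE => /andP[u0 /eqP vu]; rewrite /omega /= exprz_exp hpi.
by rewrite nvalM ?expfz_neq0 ?(valP pi) // -/(val u) vu addr0 nvalXz ?(valP pi) // hpi mul1r mulN1r.
Qed.

Lemma omega_neq0 x : omega v E q x != 0.
Proof. by rewrite /omega expfz_neq0 // (card_neq0 hF iota). Qed.

Lemma K_sigma_families f : K_sigma v q chi1 chi2 f -> exists g1 g2 L,
  [/\ forall l (u : Kunit F), val u \in val_unit v ->
        f (ppow pi l * u)%g = chi1 u * cut L g1 l (val u) + chi2 u * cut L g2 l (val u),
      forall l x, scalar_defect s1 t1 g1 l x = 0 /\ scalar_defect s2 t2 g2 l x = 0 &
      forall l (c : F), exp_span v psi (fun x => g1 l (c * x)) /\
                  exp_span v psi (fun x => g2 l (c * x))].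
Proof.
have la0 : la != 0 := sc_neq0 hchi1 pi.
have mu0 : mu != 0 by rewrite mulf_neq0 ?omega_neq0 // (sc_neq0 hchi2).
have spanE (f1 : F -> E) (a c : F) : Cc_infty v f1 -> exp_span v psi (fun x => f1 (a * (c * x))).
  move=> cf; apply: exp_span_ext (Cc_infty_exp_span hF hpi iota hpsi (a * c) cf) => u _.
  by rewrite mulrA.
have low f1 N l (u : Kunit F) : (forall x, x \notin pow_ideal v (- N%:Z) -> f1 x = 0 :> E) ->
    val u \in val_unit v -> l < - N%:Z -> f1 (val pi ^ l * val u) = 0.
  move=> f1N uU lN; apply: f1N; rewrite mulrC pow_ideal_mulu // pow_idealE.
  by rewrite -val_ppow (nval_ppow hpi) negb_or (valP (ppow pi l)) -ltNge.
rewrite /K_sigma; case: asboolP => [chiE|_] [f1 [f2 [cf1 cf2 ->]]].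
  have [N1 N1P] := Cc_infty_bounded cf1; have [N2 N2P] := Cc_infty_bounded cf2.
  have [-> ->] := double_root chiE.
  (* Both terms carry chi1, so the first family takes everything; the factor v(x) becomes l on pi^l
     U_F. *)
  exists (fun l x => la ^ l * (f1 (val pi ^ l * x) + l%:~R * f2 (val pi ^ l * x))).
  exists (fun _ _ => 0), (- (N1 + N2)%N%:Z).
  split=> [l u uU|l x|l c].
  - rewrite (sc_mul hchi1) (char_ppow hchi1) -/la /cut.
    have -> : v (val (ppow pi l * u)%g) = l.
      rewrite /= nvalM ?expfz_neq0 ?(valP pi) ?(valP u) // -val_ppow (nval_ppow hpi).
      by case/andP: uU => _ /eqP ->; rewrite addr0.
    rewrite [val _]/(val pi ^ l * val u).
    case: ltP => [lN|_]; last by ring.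
    by rewrite (low _ N1) ?(low _ N2) //; [ring | lia | lia].
  - split; first exact: scalar_defect_log.
    by rewrite /scalar_defect !mulr0 subr0 addr0.
  - split; last by exists [::] => u _; rewrite big_nil.
    by apply/exp_spanZ/exp_spanD; [|apply: exp_spanZ]; apply: spanE.
have [N1 N1P] := Cc_infty_bounded cf1; have [N2 N2P] := Cc_infty_bounded cf2.
exists (fun l x => la ^ l * f1 (val pi ^ l * x)).
exists (fun l x => mu ^ l * f2 (val pi ^ l * x)), (- (N1 + N2)%N%:Z).
split=> [l u uU|l x|l c].
- rewrite (sc_mul hchi1) (sc_mul hchi2) (char_ppow hchi1) (char_ppow hchi2) -/la /cut.
  rewrite omega_ppow // /mu expfzMl [val _]/(val pi ^ l * val u).
  case: ltP => [lN|_]; last by ring.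
  by rewrite (low _ N1) ?(low _ N2) //; [ring | lia | lia].
- by split; apply: scalar_defect_geometric.
- by split; apply/exp_spanZ/spanE.
Qed.

(** Translation commutes with forming defects, and the scalar defects of [f] live on two levels, so
    [twist_family_span_all] gives one constant for all translates. *)
Lemma good_translate f : K_sigma v q chi1 chi2 f -> exists2 K : R, 0 <= K &
  forall a b u, ball absE 1 u -> good K (mirabolic_translate iota psi m a b f u).
Proof.
move=> /K_sigma_families[g1 [g2 [L [fE g0 gs]]]].
have spanD s t (g : int -> F -> E) : (forall l x, scalar_defect s t g l x = 0) ->
    (forall l (c : F), exp_span v psi (fun x => g l (c * x))) ->
    exists2 K : R, 0 <= K & forall l k u0 b u, val u0 \in val_unit v -> ball absE 1 u ->
      twisted_span K (twist_family pi iota psi m (scalar_defect s t (cut L g)) k u0 b u l).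
  move=> g00 gss; apply: (twist_family_span_all hF pi habsE habsF hpsi m n (J := [:: L; L + 1])).
    by move=> j _; apply: exp_span_scalar_defect_cut.
  by move=> j x jJ; apply: scalar_defect_cut.
have [K1 K10 K1P] := spanD s1 t1 g1 (fun l x => proj1 (g0 l x)) (fun l (c : F) => proj1 (gs l c)).
have [K2 K20 K2P] := spanD s2 t2 g2 (fun l x => proj2 (g0 l x)) (fun l (c : F) => proj2 (gs l c)).
exists (K1 + K2) => [|a b u u1]; first exact: addr_ge0.
have [u0 u0U aE] := unit_part hpi a; set k := v (val a) in aE.
have abs_chi chi (x : Kunit F) : smooth_char v chi -> tamely_ramified v chi ->
    val x \in val_unit v -> absE (chi x) = 1.
  move=> hchi htame xU; rewrite -(unit_extE chi xU).
  exact: (tame_abs hF habsE (tame_fun_unit_ext hchi htame) xU).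
exists (fun l y => chi1 u0 *: twist_family pi iota psi m (cut L g1) k u0 b u l y).
exists (fun l y => chi2 u0 *: twist_family pi iota psi m (cut L g2) k u0 b u l y), (L - k).
split=> [l x xU|l x lL|l|l].
- rewrite /mirabolic_translate aE.
  have -> : (ppow pi k * u0 * (ppow pi l * x) = ppow pi (l + k) * (u0 * x))%g.
    by rewrite addrC ppowD; apply: val_inj => /=; ring.
  rewrite fE; last by apply: val_unitM.
  rewrite (sc_mul hchi1) (sc_mul hchi2) /twist_family.
  have -> : tau (upper (ppow pi k * u0)%g b 1%g) u = tau (dg (ppow pi l))^-1%g
      (tau (dg (ppow pi l) * upper (ppow pi k * u0) b 1)%g u).
    by rewrite [in RHS]tauM tauKV.
  move: (tau (_ * _)%g u) => e; rewrite -tauZ.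
  congr (tau _ _); rewrite !scalerA -scalerDl; congr (_ *: _).
  rewrite [val (ppow pi l * x)%g]/(val pi ^ l * val x) [val (u0 * x)%g]/(val u0 * val x).
  ring.
- have lkL : l + k < L by rewrite -ltrBrDr.
  by rewrite /twist_family /cut lkL !mul0r !scale0r !scaler0.
- apply: (twisted_span_ext (f := fun x => chi1 u0 *:
      twist_family pi iota psi m (scalar_defect s1 t1 (cut L g1)) k u0 b u l x)).
    by move=> x _; rewrite defectZ defect_twist_family.
  apply: twisted_spanZ_le (K1P l k u0 b u u0U u1) => //.
  by rewrite abs_chi // mul1r lerDl.
- apply: (twisted_span_ext (f := fun x => chi2 u0 *:
      twist_family pi iota psi m (scalar_defect s2 t2 (cut L g2)) k u0 b u l x)).
    by move=> x _; rewrite defectZ defect_twist_family.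
  apply: twisted_spanZ_le (K2P l k u0 b u u0U u1) => //.
  by rewrite abs_chi // mul1r lerDr.
Qed.

End Recurrence.

(** Provides the number of induction steps that reaches level [l] from [L]. *)
Lemma lt_add_absz (l L : int) : l < L + (absz (l - L + 1))%:Z.
Proof. have := ler_norm (l - L + 1); lia. Qed.

(** * Boundedness at level 0 *)

Section Boundedness.
Variables (R : realType) (F : fieldType) (v : normalized_valuation F) (p q : nat).
Hypothesis hF : local_field0 v p q.
Variable pi : Kunit F.
Hypothesis hpi : v (val pi) = 1.
Variables (E : closedFieldType) (iota : {rmorphism F -> E}) (absE : E -> R).
Hypotheses (habsE : nonarch_abs absE) (habsF : extends_abs v q iota absE).
Variable psi : F -> E.
Hypothesis hpsi : self_dual_char v psi.
Variable m : int.
Implicit Types (r K : R) (s t c : E) (l : int).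

Section AnyDegree.
Variable n : nat.
Local Notation tau := (tau iota m (n := n)).
Local Notation V := 'rV[E]_n.+1.
Local Notation twisted_span := (twisted_span v iota absE psi m (n := n)).
Local Notation shift := (shift pi iota m (n := n)).
Local Notation defect := (defect pi iota m).
Implicit Type Phi : int -> F -> V.

(** Only level 0 carries the uniform radius [K], because only the coefficients C_0 are constrained;
    at the other levels any expansion will do. *)
Record bounded_at_0 K (phi : Kunit F -> V) (Psi : int -> F -> V) : Prop := BoundedAt0 {
  ba_eq : forall l (u : Kunit F), val u \in val_unit v ->
    phi (ppow pi l * u)%g = tau (dg (ppow pi l))^-1%g (Psi l (val u));
  ba_span : forall l, exists2 r : R, 0 <= r & twisted_span r (Psi l);
  ba_span0 : twisted_span K (Psi 0)
}.

Lemma defect_recurrence s t Phi l x : Phi l x = defect s t Phi l x +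
  (s *: shift (Phi (l - 1)) x + - t *: shift (shift (Phi (l - 2))) x).
Proof.
rewrite /defect; move: (_ *: shift (Phi _) x) (shift (shift _) x) => a b.
by rewrite scaleNr addrA -[_ + t *: b + a]addrA [t *: b + a]addrC addrA subrK addrK.
Qed.

(** The radius grows with the number of steps, which is harmless: this serves only to obtain some
    expansion at each level. *)
Lemma defect_span s t Phi (L : int) r : 0 <= r -> (forall l x, l < L -> Phi l x = 0) ->
  (forall l, twisted_span r (defect s t Phi l)) ->
  forall l, exists2 r' : R, 0 <= r' & twisted_span r' (Phi l).
Proof.
move=> r0 low dr.
suff H (k : nat) (l : int) : l < L + k%:Z -> exists2 r' : R, 0 <= r' & twisted_span r' (Phi l).
  by move=> l; apply: (H _ _ (lt_add_absz l L)).
elim: k l => [|k IHk] l lk.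
  exists 0 => //; apply: (twisted_span_ext (f := fun=> 0)) => [x _|]; last exact: twisted_span0.
  by rewrite low //; lia.
have [r1 r10 sp1] : exists2 r' : R, 0 <= r' & twisted_span r' (Phi (l - 1)) by apply: IHk; lia.
have [r2 r20 sp2] : exists2 r' : R, 0 <= r' & twisted_span r' (Phi (l - 2)) by apply: IHk; lia.
set w := absE (iota (val pi) ^ m); have w0 : 0 <= w by apply: (abs_ge0 habsE).
have sh1 := twisted_span_shift hF hpi habsE habsF r10 sp1.
have sh2 := twisted_span_shift hF hpi habsE habsF r20 sp2.
have sh22 := twisted_span_shift hF hpi habsE habsF (mulr_ge0 w0 r20) sh2.
have a0 c : 0 <= absE c by apply: (abs_ge0 habsE).
exists (r + (absE s * (w * r1) + absE (- t) * (w * (w * r2)))).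
  by rewrite !addr_ge0 ?mulr_ge0.
apply: twisted_span_ext (fun x _ => esym (defect_recurrence s t Phi l x)) _.
apply: twisted_spanD; first by apply: twisted_span_le (dr l); rewrite lerDl addr_ge0 ?mulr_ge0.
apply: twisted_spanD.
  by apply: twisted_spanZ_le sh1 => //; rewrite addrCA lerDl addr_ge0 ?mulr_ge0.
by apply: twisted_spanZ_le sh22 => //; rewrite addrA lerDr addr_ge0 ?mulr_ge0.
Qed.

Variables la mu : E.
(** The factor gained by [twisted_span_contract]. With it (i) becomes [central], and (ii) becomes
    the two inequalities. *)
Let w := q%:R * iota (val pi) ^+ n * iota (val pi) ^ m.
Hypothesis central : absE (la * mu * w * iota (val pi) ^ m) = 1.
Hypotheses (la_le : absE (la * w) <= 1) (mu_le : absE (mu * w) <= 1).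

(* Two vanishing levels contribute the factors (la + mu) w and la mu w pi^m, both integral. *)
Lemma defect_span_equal Phi (L : int) r : (n < q)%N -> 0 <= r ->
  (forall l x, l < L -> Phi l x = 0) ->
  (forall l, twisted_span r (defect (la + mu) (la * mu) Phi l)) ->
  (forall l u, l < 0 -> u \in val_unit v -> Phi l u = 0) ->
  twisted_span r (Phi 0).
Proof.
move=> nq r0 low dr vanish.
suff H (k : nat) (l : int) : l <= 0 -> l < L + k%:Z -> twisted_span r (Phi l).
  exact: (H _ _ (lexx _) (lt_add_absz 0 L)).
elim: k l => [|k IHk] l l0 lk.
  apply: (twisted_span_ext (f := fun=> 0)) => [x _|]; last exact: twisted_span0.
  by rewrite low //; lia.
have contract j : j < l -> j < L + k%:Z -> twisted_span (absE w * r) (shift (Phi j)).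
  move=> jl jk; apply: (twisted_span_contract hF hpi habsE habsF hpsi) => //.
    by apply: IHk => //; lia.
  by move=> u uU; apply: vanish => //; lia.
have c1 : twisted_span (absE w * r) (shift (Phi (l - 1))) by apply: contract; lia.
have c2 : twisted_span (absE w * r) (shift (Phi (l - 2))) by apply: contract; lia.
have wr0 : 0 <= absE w * r by rewrite mulr_ge0 ?(abs_ge0 habsE).
(* Nothing is known about [shift (Phi (l - 2))] on the units, so the outer shift gets only the plain
   bound |pi^m|; [central] compensates for it exactly. *)
have c22 := twisted_span_shift hF hpi habsE habsF wr0 c2.
apply: twisted_span_ext (fun x _ => esym (defect_recurrence (la + mu) (la * mu) Phi l x)) _.
apply: twisted_spanD => //; apply: twisted_spanD.
  apply: twisted_spanZ_le c1 => //; rewrite mulrA -(absM habsE) ler_piMl //.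
  by rewrite mulrDl; apply: absED_le.
apply: twisted_spanZ_le c22 => //; rewrite absEN // !mulrA -!(absM habsE).
by rewrite mulrAC central mul1r.
Qed.

Variables chi1 chi2 : Kunit F -> E.
Hypotheses (hchi1 : smooth_char v chi1) (hchi2 : smooth_char v chi2).
Hypotheses (htame1 : tamely_ramified v chi1) (htame2 : tamely_ramified v chi2).

Lemma nval_ppow_unit (l : int) (u : Kunit F) : val u \in val_unit v ->
  v (val (ppow pi l * u)%g) = l.
Proof.
case/andP=> u0 /eqP vu; rewrite [val _]/(val (ppow pi l) * val u).
by rewrite nvalM ?(valP (ppow pi l)) // (nval_ppow hpi) vu addr0.
Qed.

Lemma good_vanish s1 t1 s2 t2 r phi Phi1 Phi2 L :
  good_data v pi iota absE psi m chi1 chi2 s1 t1 s2 t2 r phi Phi1 Phi2 L ->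
  (forall x, val x \notin OF v -> phi x = 0) ->
  forall l (u : Kunit F), l < 0 -> val u \in val_unit v ->
    chi1 u *: Phi1 l (val u) + chi2 u *: Phi2 l (val u) = 0.
Proof.
case=> phiE _ _ _ phi0 l u l0 uU; apply: (tau_eq0 (iota := iota) (m := m)
  (g := (dg (ppow pi l))^-1%g)); rewrite -phiE // phi0 //.
rewrite OFE pow_idealE nval_ppow_unit // negb_or -ltNge l0 andbT.
exact: (valP (ppow pi l * u)%g).
Qed.

(** As the characters agree on units, Phi1 + Phi2 satisfies one recurrence. The common character is
    multiplied in once, after the induction, at the cost of the constant [C]. *)
Lemma bounded_equal K : (n < q)%N -> 0 <= K ->
  (forall u : Kunit F, val u \in val_unit v -> chi1 u = chi2 u) ->
  exists2 K' : R, 0 <= K' & forall phi,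
    good v pi iota absE psi m chi1 chi2 (la + mu) (la * mu) (la + mu) (la * mu) K phi ->
    (forall x, val x \notin OF v -> phi x = 0) -> exists Psi, bounded_at_0 K' phi Psi.
Proof.
move=> nq K0 chiE.
have te := tame_fun_unit_ext hchi1 htame1.
have [C C0 CP] := twisted_span_tame hF hpi iota habsE hpsi m n te.
exists (C * K) => [|phi [Phi1 [Phi2 [L gd]]] phi0]; first exact: mulr_ge0.
have vanish := good_vanish gd phi0; case: gd => phiE low sp1 sp2.
pose Phi l x := Phi1 l x + Phi2 l x.
have Plow l x : l < L -> Phi l x = 0.
  by move=> lL; rewrite /Phi; have [-> ->] := low l x lL; rewrite addr0.
have Psp l : twisted_span K (defect (la + mu) (la * mu) Phi l).
  by apply: twisted_span_ext (twisted_spanD (sp1 l) (sp2 l)) => x _; rewrite defectD.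
exists (fun l x => unit_ext v chi1 x *: Phi l x); split=> [l u uU|l|].
- by rewrite phiE // unit_extE // -chiE // scalerDr.
- have [r r0 sp] := defect_span K0 Plow Psp l.
  by exists (C * r); [exact: mulr_ge0 | exact: CP].
- apply: CP => //; apply: (defect_span_equal nq K0 Plow Psp) => l u l0 uU.
  have [x xE] := val_unit_exists uU; rewrite -xE in uU *.
  have := vanish l x l0 uU; rewrite -chiE // -scalerDr => /eqP.
  by rewrite scaler_eq0 (negPf (sc_neq0 hchi1 x)) => /eqP.
Qed.

End AnyDegree.

Lemma tame_funM e e' : tame_fun (E := E) v e -> tame_fun v e' -> tame_fun v (fun u => e u * e' u).
Proof.
case=> ec e0 en eM [ec' e0' en' eM']; split=> [x y xO yO xy|x xU|x xU|x y xU yU].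
- by rewrite (ec x y) // (ec' x y).
- by rewrite e0 // mul0r.
- by rewrite mulf_neq0 ?en ?en'.
- by rewrite eM // eM' // mulrACA.
Qed.

(** * Characters that differ on the units *)

Section DegreeZero.
Local Notation tau := (tau iota m (n := 0)).
Local Notation V := 'rV[E]_1.
Local Notation twisted_span := (twisted_span v iota absE psi m (n := 0)).
Local Notation shift := (shift pi iota m (n := 0)).
Local Notation defect := (defect pi iota m).
Variables la mu : E.
Let w := q%:R * iota (val pi) ^+ 0 * iota (val pi) ^ m.
Hypothesis central : absE (la * mu * w * iota (val pi) ^ m) = 1.
Hypotheses (la_le : absE (la * w) <= 1) (mu_le : absE (mu * w) <= 1).

(* A + e B vanishes on units, and e B vanishes off units, so shift A = shift (A + e B). *)
Lemma shift_relation_span e C r1 r2 (A B : F -> V) : tame_fun v e -> 0 <= r1 -> 0 <= r2 ->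
  0 <= C -> (forall r f, twisted_span r f -> twisted_span (C * r) (fun u => e u *: f u)) ->
  twisted_span r1 A -> twisted_span r2 B ->
  (forall u, u \in val_unit v -> A u + e u *: B u = 0) ->
  twisted_span (absE w * Num.max r1 (C * r2)) (shift A).
Proof.
move=> te r10 r20 C0 CP Ar Br AB.
have q0 : (0 < q)%N := ltnW (residue_card_gt1 hF).
have max0 : 0 <= Num.max r1 (C * r2) by rewrite le_max r10.
have sp : twisted_span (Num.max r1 (C * r2)) (fun u => A u + e u *: B u).
  apply: twisted_spanD; first by apply: twisted_span_le Ar; rewrite le_max lexx.
  by apply: twisted_span_le (CP _ _ Br); rewrite le_max lexx orbT.
have := twisted_span_contract hF hpi habsE habsF hpsi q0 max0 sp AB.
apply: twisted_span_ext => u uO; rewrite /shift (tame_off te) ?scale0r ?addr0 //.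
by rewrite -OF_pow1 ?OFM ?(val_pi_OF hpi) // mulrC mul_pi_pow1.
Qed.

Variables chi1 chi2 : Kunit F -> E.
Hypotheses (hchi1 : smooth_char v chi1) (hchi2 : smooth_char v chi2).
Hypotheses (htame1 : tamely_ramified v chi1) (htame2 : tamely_ramified v chi2).

(* The radii r1 and r2 are balanced by the Gauss sum: r2 = |mu w g'| r1 makes both induction
   steps work because |g g' q| = 1. *)
Lemma bounded_distinct K : 0 <= K ->
  (exists2 u : Kunit F, val u \in val_unit v & chi1 u != chi2 u) ->
  exists2 K' : R, 0 <= K' & forall phi : Kunit F -> V, good v pi iota absE psi m chi1 chi2 la 0 mu 0 K phi ->
    (forall x, val x \notin OF v -> phi x = 0) -> exists Psi, bounded_at_0 K' phi Psi.
Proof.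
move=> K0 [u0 u0U chi_ne].
have te1 := tame_fun_unit_ext hchi1 htame1; have te2 := tame_fun_unit_ext hchi2 htame2.
have [C1 C10 C1P] := twisted_span_tame hF hpi iota habsE hpsi m 0 te1.
have [C2 C20 C2P] := twisted_span_tame hF hpi iota habsE hpsi m 0 te2.
pose e u := unit_ext v chi2 u * (unit_ext v chi1 u)^-1.
have te : tame_fun v e by apply: tame_funM => //; apply: tame_fun_inv.
have nt : exists2 y, y \in val_unit v & e y != 1.
  exists (val u0) => //; rewrite /e !unit_extE //.
  apply: contra_neq chi_ne => h; apply: (mulIf (invr_neq0 (sc_neq0 hchi1 u0))).
  by rewrite h divff // (sc_neq0 hchi1).
have te' := tame_fun_inv te.
have nt' : exists2 y, y \in val_unit v & (e y)^-1 != 1.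
  by case: nt => y yU ey; exists y => //; rewrite invr_eq1.
have [rs rsS] := residue_system_exists hF.
set g := absE (gauss_coef q pi psi e rs).
set g' := absE (gauss_coef q pi psi (fun u => (e u)^-1) rs).
have gg : g * g' = (absE q%:R)^-1 := gauss_coef_mul hF hpi iota habsE hpsi te rsS nt.
have g0 : 0 <= g := abs_ge0 habsE _.
have g'0 : 0 <= g' := abs_ge0 habsE _.
have aq0 : 0 < absE q%:R := absE_card_gt0 hF iota habsE.
have w0 : 0 < absE (mu * w).
  rewrite lt_neqAle (abs_ge0 habsE) andbT eq_sym; apply/eqP => h.
  have := central; have -> : la * mu * w * iota (val pi) ^ m = la * iota (val pi) ^ m * (mu * w) by ring.
  by rewrite (absM habsE) h mulr0 => /eqP; rewrite eq_sym oner_eq0.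
pose c := absE (mu * w) * g'.
have c0 : 0 < c.
  rewrite mulr_gt0 // lt_neqAle g'0 andbT; apply: contraTneq aq0 => g'E.
  by move: gg; rewrite -g'E mulr0 => /esym/eqP; rewrite invr_eq0 => /eqP ->; rewrite ltxx.
(* The factor 1 + 1/c makes both [r1] and [c * r1] at least [K], so that the defects fit in either
   radius. *)
pose r1 := K * (1 + c^-1); pose r2 := c * r1.
have r1K : K <= r1 by rewrite /r1 ler_peMr // lerDl invr_ge0 ltW.
have r2K : K <= r2.
  by rewrite /r2 /r1 mulrCA mulrDr mulr1 mulfV ?lt0r_neq0 // ler_peMr // lerDr ltW.
have r10 : 0 <= r1 := le_trans K0 r1K.
have r20 : 0 <= r2 := le_trans K0 r2K.
(* The constant that appears is |la mu w^2| g g'. As g g' = |q|^-1 and w^2 / q = w pi^m for n = 0,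
   it equals 1 by [central]. *)
have step1 : absE la * (absE w * Num.max r1 (g * r2)) <= r1.
  rewrite mulrA -(absM habsE) maxr_pMr ?(abs_ge0 habsE) // ge_max ler_piMl //=.
  have -> : absE (la * w) * (g * r2) = (absE (la * w) * absE (mu * w) * (g * g')) * r1.
    by rewrite /r2 /c; ring.
  rewrite gg -!(absM habsE) -absEV // -(absM habsE).
  have -> : la * w * (mu * w) / q%:R = la * mu * w * iota (val pi) ^ m.
    by rewrite /w expr0; field; rewrite (card_neq0 hF iota).
  by rewrite central mul1r.
have step2 : absE mu * (absE w * Num.max r2 (g' * r1)) <= r2.
  rewrite mulrA -(absM habsE) maxr_pMr ?(abs_ge0 habsE) // ge_max ler_piMl //=.
  by rewrite mulrA.
exists (Num.max (C1 * r1) (C2 * r2)) => [|phi [A [B [L gd]]] phi0].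
  by rewrite le_max mulr_ge0.
have vanish := good_vanish gd phi0; case: gd => phiE low sp1 sp2.
have lowA l x : l < L -> A l x = 0 by move=> lL; case: (low l x lL).
have lowB l x : l < L -> B l x = 0 by move=> lL; case: (low l x lL).
exists (fun l x => unit_ext v chi1 x *: A l x + unit_ext v chi2 x *: B l x).
split=> [l u uU|l|].
- by rewrite phiE // !unit_extE.
- have [ra ra0 spA] := defect_span K0 lowA sp1 l.
  have [rb rb0 spB] := defect_span K0 lowB sp2 l.
  exists (Num.max (C1 * ra) (C2 * rb)); first by rewrite le_max mulr_ge0.
  apply: twisted_spanD; [apply: twisted_span_le (C1P _ _ ra0 spA) |
    apply: twisted_span_le (C2P _ _ rb0 spB)]; by rewrite le_max lexx ?orbT.
have relA l u : l < 0 -> u \in val_unit v -> A l u + e u *: B l u = 0.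
  move=> l0 uU; have [x xE] := val_unit_exists uU; rewrite -xE in uU *.
  have := vanish l x l0 uU => /(congr1 (fun z => (chi1 x)^-1 *: z)).
  rewrite scaler0 scalerDr !scalerA mulVf ?(sc_neq0 hchi1) // scale1r => <-.
  by rewrite /e !unit_extE // mulrC.
have relB l u : l < 0 -> u \in val_unit v -> B l u + (e u)^-1 *: A l u = 0.
  move=> l0 uU; have := relA l u l0 uU => /(congr1 (fun z => (e u)^-1 *: z)).
  by rewrite scaler0 scalerDr scalerA mulVf ?(tame_neq0 te) // scale1r addrC.
suff H (k : nat) (l : int) : l <= 0 -> l < L + k%:Z -> twisted_span r1 (A l) /\ twisted_span r2 (B l).
  have [spA spB] := H _ _ (lexx _) (lt_add_absz 0 L).
  apply: twisted_spanD; [apply: twisted_span_le (C1P _ _ r10 spA) |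
    apply: twisted_span_le (C2P _ _ r20 spB)]; by rewrite le_max lexx ?orbT.
elim: k l => [|k IHk] l l0 lk.
  rewrite addr0 in lk; split; apply: (twisted_span_ext (f := fun=> 0)) => [x _|]; try exact: twisted_span0.
    by rewrite lowA.
  by rewrite lowB.
have [spA spB] : twisted_span r1 (A (l - 1)) /\ twisted_span r2 (B (l - 1)).
  by apply: IHk; [apply: le_trans l0; rewrite gerBl | rewrite ltrBlDr -addrA -PoszD addn1].
have l1 : l - 1 < 0 by rewrite ltrBlDr add0r (le_lt_trans l0).
have gP r f : twisted_span r f -> twisted_span (g * r) (fun u => e u *: f u).
  exact: (twisted_span_gauss hF hpi habsE hpsi te rsS nt).
have gP' r f : twisted_span r f -> twisted_span (g' * r) (fun u => (e u)^-1 *: f u).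
  exact: (twisted_span_gauss hF hpi habsE hpsi te' rsS nt').
have shA := shift_relation_span te r10 r20 g0 gP spA spB (fun u => relA (l - 1) u l1).
have shB := shift_relation_span te' r20 r10 g'0 gP' spB spA (fun u => relB (l - 1) u l1).
split.
- apply: (twisted_span_ext (f := fun x => defect la 0 A l x + la *: shift (A (l - 1)) x)).
    by move=> x _; rewrite [RHS](defect_recurrence la 0) oppr0 scale0r addr0.
  apply: twisted_spanD; first exact: twisted_span_le (sp1 l).
  apply: (twisted_spanZ_le habsE step1 shA).
- apply: (twisted_span_ext (f := fun x => defect mu 0 B l x + mu *: shift (B (l - 1)) x)).
    by move=> x _; rewrite [RHS](defect_recurrence mu 0) oppr0 scale0r addr0.
  apply: twisted_spanD; first exact: twisted_span_le (sp2 l).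
  apply: (twisted_spanZ_le habsE step2 shB).
Qed.

End DegreeZero.

End Boundedness.

(** * The lattices *)

Section Expansion.
Variables (R : realType) (F : fieldType) (v : normalized_valuation F) (p q : nat).
Hypothesis hF : local_field0 v p q.
Variable pi : Kunit F.
Hypothesis hpi : v (val pi) = 1.
Variables (E : closedFieldType) (iota : {rmorphism F -> E}) (absE : E -> R).
Hypotheses (habsE : nonarch_abs absE) (habsF : extends_abs v q iota absE).
Variable psi : F -> E.
Hypothesis hpsi : self_dual_char v psi.
Variables (m : int) (n : nat).
Local Notation tau := (tau iota m (n := n)).
Local Notation V := 'rV[E]_n.+1.
Implicit Types (r K : R).

(** A spanning family with as many members as the dimension is a basis; the casts only identify
    [\dim {:V}] with [n.+1]. *)
Lemma is_lattice_span (b : 'I_n.+1 -> V) :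
  (forall x, exists c : 'I_n.+1 -> E, x = \sum_i c i *: b i) ->
  is_lattice absE [set x | exists2 c : 'I_n.+1 -> E,
    forall i, absE (c i) <= 1 & x = \sum_i c i *: b i].
Proof.
move=> bP; have dimV : \dim {:V} = n.+1 by rewrite dimvf; apply: mul1n.
pose s := [seq b i | i <- enum 'I_n.+1].
have szs : size s == \dim {:V} by rewrite size_map size_enum_ord dimV.
have nths (i : 'I_(\dim {:V})) : s`_i = b (cast_ord dimV i).
  have iN : (i < n.+1)%N := ltn_ord (cast_ord dimV i).
  rewrite (nth_map ord0) ?size_enum_ord //; congr (b _).
  by apply: val_inj; rewrite /= nth_enum_ord.
have sumE (c : 'I_(\dim {:V}) -> E) : \sum_i c i *: s`_i =
    \sum_j c (cast_ord (esym dimV) j) *: b j.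
  rewrite (reindex (cast_ord (esym dimV))); last first.
    by exists (cast_ord dimV) => i _; rewrite ?cast_ordK ?cast_ordKV.
  by apply: eq_bigr => j _; rewrite nths cast_ordKV.
exists (Tuple szs).
  rewrite basisEdim (eqP szs) leqnn andbT; apply/subvP => x _.
  have [c ->] := bP x; apply: memv_suml => i _; apply/memvZ/memv_span.
  by apply: map_f; rewrite mem_enum.
apply/seteqP; split=> x /= [c c1 ->].
  exists (fun i => c (cast_ord dimV i)) => //.
  by rewrite sumE; apply: eq_bigr => j _; rewrite cast_ordKV.
by exists (fun j => c (cast_ord (esym dimV) j)); rewrite // sumE.
Qed.

Lemma is_lattice_ball (c : E) (b : F) : c != 0 ->
  is_lattice absE [set x : V | ball absE (absE c) (tau (up (- b)) x)].
Proof.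
move=> c0; pose e (i : 'I_n.+1) : V := c *: tau (up b) (delta_mx 0 i).
have upK x : tau (up b) (tau (up (- b)) x) = x by rewrite -tauM -upD subrr up0 tau1.
have upKV x : tau (up (- b)) (tau (up b) x) = x by rewrite -tauM -upD addNr up0 tau1.
have ac : 0 < absE c by apply: absE_gt0.
have eE x : x = \sum_i (tau (up (- b)) x 0 i / c) *: e i.
  rewrite -[LHS]upK; move: (tau (up (- b)) x) => y.
  rewrite {1}(row_sum_delta y) tau_sum; apply: eq_bigr => i _.
  by rewrite tauZ /e; move: (tau _ _) => t; rewrite scalerA divfK.
have -> : [set x : V | ball absE (absE c) (tau (up (- b)) x)] =
    [set x | exists2 d : 'I_n.+1 -> E, forall i, absE (d i) <= 1 & x = \sum_i d i *: e i].
  apply/seteqP; split=> x /= => [xc|[d d1 ->] i].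
    exists (fun i => tau (up (- b)) x 0 i / c) => // i.
    by rewrite absM // absEV // ler_pdivrMr // mul1r.
  have -> : tau (up (- b)) (\sum_i d i *: e i) = \row_i (d i * c).
    rewrite tau_sum [RHS]row_sum_delta; apply: eq_bigr => j _.
    by rewrite /e tauZ tauZ upKV scalerA mxE.
  by rewrite mxE absM // ler_piMl // ltW.
by apply: is_lattice_span => x; exists (fun i => tau (up (- b)) x 0 i / c).
Qed.

Lemma expansion_of_bounded K : 0 <= K -> exists M0 : Wquot v -> set V,
  (forall beta, is_lattice absE (M0 beta)) /\
  forall (phi : Kunit F -> V) Psi, bounded_at_0 v pi iota absE psi m K phi Psi ->
    (forall x, val x \notin OF v -> phi x = 0) ->
    exists (l0 : int) (C : int -> Wquot v -> V),
      [/\ forall l, finite_set [set beta | C l beta != 0],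
          forall x, phi x =
            \sum_(l \in [set l : int | l0 <= l])
              \sum_(beta \in [set: Wquot v]) psi_phi psi pi l beta x *: C l beta
        & forall beta, M0 beta (C 0 beta)].
Proof.
move=> K0; have [c c0 Kc] := absE_unbounded hF hpi habsE habsF K.
exists (fun beta => [set x : V | ball absE (absE c) (tau (up (- repr beta)) x)]).
split=> [beta|phi Psi [phiE span span0] phi0]; first exact: is_lattice_ball.
have /choice[BC BCP] : forall l : int, exists BC : seq (Wquot v) * (Wquot v -> V),
    [/\ uniq BC.1, forall beta, beta \notin BC.1 -> BC.2 beta = 0,
        l = 0 -> forall beta, ball absE K (tau (up (- repr beta)) (BC.2 beta)) &
        forall u, u \in OF v -> Psi l u = \sum_(beta <- BC.1) psi (repr beta * u) *: BC.2 beta].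
  move=> l; have [->|l0] := eqVneq l 0.
    have [B [C [uB C0 CK CE]]] := twisted_span_normal hF habsE habsF hpsi K0 span0.
    by exists (B, C).
  have [r r0 spr] := span l.
  have [B [C [uB C0 _ CE]]] := twisted_span_normal hF habsE habsF hpsi r0 spr.
  by exists (B, C); split=> // l0'; rewrite l0' eqxx in l0.
pose C (l : int) (beta : Wquot v) : V := tau (dg (ppow pi l))^-1%g ((BC l).2 beta).
have C_off l beta : beta \notin (BC l).1 -> C l beta = 0.
  by case: (BCP l) => _ C0 _ _ bB; rewrite /C C0 // tau0.
(* Level 0 is a valid start because phi vanishes outside O_F. At a point [x] only the level l = v(x)
   contributes, so the sum over levels reduces to one term. *)
exists 0, C; split=> [l|x|beta].
- apply: (@sub_finite_set _ _ [set` (BC l).1]); last exact: finite_seq.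
  by move=> beta /=; apply: contra_neqT => /C_off.
- have inner l : \sum_(beta \in [set: Wquot v]) psi_phi psi pi l beta x *: C l beta =
      \sum_(beta <- (BC l).1) psi_phi psi pi l beta x *: C l beta.
    have [uB _ _ _] := BCP l; rewrite [RHS]fsbig_seq // (fsbig_widen [set` (BC l).1] [set: Wquot v]) //.
    by move=> beta [_ /= /negP/C_off ->]; rewrite /= scaler0.
  under eq_fsbigr => l _ do rewrite inner.
  have [u uU xE] := unit_part hpi x; set k := v (val x) in xE.
  have off l : l != k -> \sum_(beta <- (BC l).1) psi_phi psi pi l beta x *: C l beta = 0.
    move=> lk; apply: big1 => beta _.
    by rewrite /psi_phi -/k eq_sym (negPf lk) mulr0 scale0r.
  have [k0|k0] := ltP k 0.
    rewrite phi0 ?fsbig1 // => [l /= l0|]; first by apply: off; apply: contraTneq l0 => ->; rewrite -ltNge.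
    by rewrite OFE pow_idealE negb_or (valP x) -/k -ltNge.
  rewrite -(fsbig_widen [set k]) ?fsbig_set1; first last.
  + by move=> l [_ /= /eqP lk]; apply: off.
  + by move=> l ->.
  rewrite {1}xE phiE //; have [_ _ _ ->] := BCP k; last exact: val_unit_OF.
  rewrite tau_sum; apply: eq_bigr => beta _; rewrite tauZ; congr (_ *: _).
  rewrite /psi_phi -/k eqxx mulr1; congr (psi (_ * _)).
  rewrite {1}xE [val (ppow pi k * u)%g]/(val pi ^ k * val u) mulrA -expfzDr ?(valP pi) //.
  by rewrite addNr expr0z mul1r.
- have [_ _ /(_ erefl beta) CK _] := BCP 0.
  by rewrite /C ppow0 dg1 invg1 tau1; apply: ball_le CK.
Qed.

End Expansion.

Theorem theorem1p2 (R : realType)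
    (F : fieldType) (v : normalized_valuation F) (p q : nat)
    (hF : local_field0 v p q)
    (pi : Kunit F) (hpi : v (val pi) = 1)
    (E : closedFieldType) (iota : {rmorphism F -> E})
    (hE : forall x : E, algebraicOver iota x)
    (absE : E -> R) (habsE : nonarch_abs absE)
    (habsF : extends_abs v q iota absE)
    (psi : F -> E) (hpsi : self_dual_char v psi)
    (chi1 chi2 : Kunit F -> E)
    (hchi1 : smooth_char v chi1) (hchi2 : smooth_char v chi2)
    (hirr : rep_irreducible (Ind v chi1 chi2) (@right_translation F E))
    (m : int) (n : nat)
    (sigma : GL2 F -> (Kunit F -> E^o) -> (Kunit F -> E^o))
    (hsigma : kirillov_action v q psi chi1 chi2 sigma)
    (lam mu : E)
    (hlam : lam = chi1 pi * iota (val pi) ^ m)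
    (hmu : mu = omega v E q pi * chi2 pi * iota (val pi) ^ m)
    (hi : absE (lam * mu * q%:R * iota (val pi) ^+ n) = 1)
    (hii : absE lam <= absE ((q%:R)^-1 * iota (val pi) ^- n) /\
           absE mu <= absE ((q%:R)^-1 * iota (val pi) ^- n))
    (hcase : (unramified v chi1 /\ unramified v chi2 /\ (n < q)%N) \/
             (tamely_ramified v chi1 /\ tamely_ramified v chi2 /\ n = 0%N))
    (w : Kunit F -> 'rV[E]_n.+1)
    (hw : K_rho v q chi1 chi2 w) (hw0 : w <> 0) :
  exists M0 : Wquot v -> set 'rV[E]_n.+1,
    (forall beta, is_lattice absE (M0 beta)) /\
    forall phi : Kunit F -> 'rV[E]_n.+1,
      OE_span absE (rho iota sigma m (n := n)) w phi ->
      (forall x, val x \notin OF v -> phi x = 0) ->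
      exists (l0 : int) (C : int -> Wquot v -> 'rV[E]_n.+1),
        [/\ forall l, finite_set [set beta | C l beta != 0],
            forall x, phi x =
              \sum_(l \in [set l : int | l0 <= l])
                \sum_(beta \in [set: Wquot v])
                   psi_phi psi pi l beta x *: C l beta
          & forall beta, M0 beta (C 0 beta)].
Proof.
have htame : tamely_ramified v chi1 /\ tamely_ramified v chi2.
  by case: hcase => [[u1 [u2 _]]|[t1 [t2 _]]] //; split; apply: unramified_tame.
have [htame1 htame2] := htame.
have nq : (n < q)%N.
  by case: hcase => [[_ [_ nq]]|[_ [_ ->]]] //; apply: ltnW (residue_card_gt1 hF).
set w0 := iota (val pi); have w0n0 : w0 != 0 := iota_pi_neq0 pi iota.
have q0 := card_neq0 hF iota.
pose la := chi1 pi; pose mu' := omega v E q pi * chi2 pi.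
pose ww := q%:R * w0 ^+ n * w0 ^ m.
have omega_pi : omega v E q pi = q%:R^-1 by rewrite /omega hpi exprN1.
have central : absE (la * mu' * ww * w0 ^ m) = 1.
  rewrite -hi hlam hmu; congr absE; rewrite /la /mu' /ww -/w0.
  by move: (w0 ^ m) (w0 ^+ n) (omega v E q pi) => a b c; ring.
have hcentral : absE (chi1 pi * chi2 pi * w0 ^ m * w0 ^ m * w0 ^+ n) = 1.
  rewrite -central /la /mu' /ww omega_pi; congr absE.
  by move: (w0 ^ m) (w0 ^+ n) => a b; field.
have le1 (x y : E) : absE y <= absE (q%:R^-1 * w0 ^- n) -> y = x * w0 ^ m ->
    absE (x * ww) <= 1.
  move=> yle yE; have -> : x * ww = y * (q%:R * w0 ^+ n).
    by rewrite yE /ww; move: (w0 ^ m) => a; ring.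
  have qw0 : q%:R * w0 ^+ n != 0 by rewrite mulf_neq0 ?expf_neq0.
  rewrite (absM habsE) -ler_pdivlMr ?absE_gt0 // mul1r -(absEV habsE) invfM.
  exact: yle.
have la_le : absE (la * ww) <= 1 by apply: le1 (proj1 hii) hlam.
have mu_le : absE (mu' * ww) <= 1 by apply: le1 (proj2 hii) hmu.
(* The reduction to mirabolic translates works for any coefficients having la and mu as roots; their
   choice and the bound at level 0 depend on whether the characters agree on units. *)
suff [s1 [t1 [s2 [t2 [root1 root2 dbl bnd]]]]] : exists s1 t1 s2 t2 : E,
    [/\ la ^+ 2 - s1 * la + t1 = 0, mu' ^+ 2 - s2 * mu' + t2 = 0,
        chi1 = (fun x => omega v E q x * chi2 x) -> s1 = 2 * la /\ t1 = la ^+ 2 &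
        forall K : R, 0 <= K -> exists2 K' : R, 0 <= K' &
          forall phi : Kunit F -> 'rV[E]_n.+1,
            good v pi iota absE psi m chi1 chi2 s1 t1 s2 t2 K phi ->
            (forall x, val x \notin OF v -> phi x = 0) ->
            exists Psi, bounded_at_0 v pi iota absE psi m K' phi Psi].
  have [K K0 KP] := good_OE_span hF hpi habsE habsF hchi1 hchi2 htame1 htame2 hcentral hsigma
    (good_zero v pi iota absE psi m n chi1 chi2 s1 t1 s2 t2) (@good_add _ _ _ _ _ _ _ _ _ _ _ _ _ _ _ _)
    (@good_scale _ _ _ _ _ _ _ habsE _ _ _ _ _ _ _ _ _) (@good_mono _ _ _ _ _ _ _ _ _ _ _ _ _ _ _ _)
    (fun f => @good_translate _ _ _ _ _ hF _ hpi _ _ _ habsE habsF _ hpsi m n _ _ hchi1 hchi2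
       htame1 htame2 _ _ _ _ root1 root2 dbl f) hw.
  have [K' K'0 K'P] := bnd K K0.
  have [M0 [latM0 expM0]] := expansion_of_bounded hF hpi habsE habsF hpsi m n K'0.
  exists M0; split=> // phi /KP phi_good phi0.
  by have [Psi bPsi] := K'P phi phi_good phi0; apply: expM0 bPsi phi0.
have [chiE|chiN] := pselect (forall u : Kunit F, val u \in val_unit v -> chi1 u = chi2 u).
  exists (la + mu'), (la * mu'), (la + mu'), (la * mu'); split; try by ring.
    (* Evaluated at pi, the premise says that la and mu coincide, so the root is double. *)
    move=> /(congr1 (fun chi => chi pi)); rewrite -/la -/mu' => <-.
    by split; ring.
  by move=> K K0; apply: (bounded_equal hF hpi habsE habsF hpsi central la_le mu_le hchi1 htame1 nq K0 chiE).
have [u uU chi_ne] : exists2 u : Kunit F, val u \in val_unit v & chi1 u != chi2 u.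
  apply: contrapT => no_u; apply: chiN => u uU; apply/eqP.
  by apply: contrapT => chi_ne; apply: no_u; exists u => //; apply/negP.
(* Two unramified characters agree on units, so only the tamely ramified case is left. *)
have n0 : n = 0%N.
  case: hcase => [[u1 [u2 _]]|[_ [_ ->]]] //.
  by move: chi_ne; case/andP: uU => _ /eqP vu; rewrite u1 // u2 // eqxx.
exists la, 0, mu', 0; split; try by ring.
  (* Since omega is unramified, the premise would force the characters to agree on units. *)
  move=> chiE; case/eqP: chi_ne; rewrite chiE /omega.
  by case/andP: uU => _ /eqP ->; rewrite oppr0 expr0z mul1r.
move=> K K0; subst n; apply: (bounded_distinct hF hpi habsE habsF hpsi central la_le mu_le
  hchi1 hchi2 htame1 htame2 K0).
by exists u.
Qed.
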